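(* Let $0<\alpha<1$ and let $T>0$ be a fixed constant. Let $u\in L^\infty(0,T;H^2(0,1))$, with $\partial_t^\alpha u\in L^\infty(0,T;L^2(0,1))$, be a solution to the lateral Cauchy problem $$\partial_t^\alpha u-\partial_x^2u=0\ \text{ in } (0,1)\times(0,T],\qquad u(0,\cdot)=u_x(0,\cdot)=0\ \text{ in } [0,T],$$ where $\partial_t^\alpha$ is the Caputo derivative of order $\alpha$ in $t$. Then $$u(x,t)=0,\quad (x,t)\in[0,1]\times[0,T].$$
   Context: For $0<\alpha<1$ the Caputo derivative is defined by $$\partial_t^\alpha \phi(t)=\frac{1}{\Gamma(1-\alpha)}\int_0^t\frac{\phi'(\tau)}{(t-\tau)^\alpha}\,d\tau,\quad t>0,$$ where $\Gamma$ is the Gamma function and, as is usual for this formula, $\phi$ is absolutely continuous in $t$, so that $\phi'$ is its integrable almost-everywhere derivative; for a function $u(x,t)$ it is applied in the variable $t$ for fixed $x$. The class of solutions considered consists of functions with $u\in L^\infty(0,T;H^2(0,1))$ and $\partial_t^\alpha u\in L^\infty(0,T;L^2(0,1))$. The values $u(0,t)$ and $u_x(0,t)$ are understood via the embedding $H^2(0,1)\subset C^1[0,1]$. No initial condition and no condition at $x=1$ is imposed on $u$. *)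

(* Defs.v *)
From HB Require Import structures.
From mathcomp Require Import all_boot all_order all_algebra.
From mathcomp Require Import all_classical all_reals all_analysis.

Set Implicit Arguments.
Unset Strict Implicit.
Unset Printing Implicit Defensive.

Import Order.TTheory GRing.Theory Num.Theory.
Import numFieldNormedType.Exports.

Local Open Scope classical_set_scope.
Local Open Scope ring_scope.

Section caputo.
Context {R : realType}.
Local Notation mu := (@lebesgue_measure R).

Definition abs_continuous (a b : R) (f : R -> R) : Prop :=
  forall e : R, 0 < e -> exists2 d : R, 0 < d &
    forall (n : nat) (l r : nat -> R),
      (forall i, (i < n)%N -> [/\ a <= l i, l i <= r i & r i <= b]) ->
      trivIset [set i | (i < n)%N] (fun i => `]l i, r i[%classic) ->
      \sum_(i < n) (r i - l i) < d ->
      \sum_(i < n) `|f (r i) - f (l i)| < e.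

Definition Gamma (z : R) : R :=
  \int[mu]_(t in `]0, +oo[) (t `^ (z - 1) * expR (- t)).

(* For phi absolutely continuous, derive1 phi is the almost-everywhere derivative
   (with an arbitrary value on the null set where phi is not derivable). *)
Definition caputo (alpha : R) (phi : R -> R) (t : R) : R :=
  (Gamma (1 - alpha))^-1 *
  \int[mu]_(tau in `]0, t[) (derive1 phi tau / (t - tau) `^ alpha).

End caputo.

Section sobolev.
Context {R : realType}.
Local Notation mu := (@lebesgue_measure R).
Implicit Types (D : set R) (f g psi : R -> R).

Definition test_function D psi : Prop :=
  (forall n x, derivable (derive1n n psi) x 1) /\
  exists K, [/\ compact K, K `<=` D & forall x, ~ K x -> psi x = 0].

Definition is_weak_derivative D f g : Prop :=
  [/\ locally_integrable D f, locally_integrable D g &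
      forall psi, test_function D psi ->
        \int[mu]_(x in D) (f x * derive1 psi x) =
        - \int[mu]_(x in D) (g x * psi x)].

(* A weak derivative is unique only up to a null set; this picks one. *)
Definition weak_derivative D f : R -> R :=
  xget (cst 0) [set g | is_weak_derivative D f g].

Definition L2norm D f : \bar R := 'N[mu]_2%:E[EFin \o (f \_ D)]%E.

(* measurable_fun is Borel measurability, so Lebesgue measurability is
   equality almost everywhere with a Borel function *)
Definition L2 D f : Prop :=
  (exists2 g, measurable_fun D g & {ae mu, forall x, D x -> f x = g x}) /\
  (L2norm D f < +oo)%E.

Definition H2 D f : Prop :=
  L2 D f /\
  exists g h, [/\ is_weak_derivative D f g, L2 D g,
                  is_weak_derivative D g h & L2 D h].

Definition H2norm D f : \bar R :=
  ((L2norm D f `^ 2 + L2norm D (weak_derivative D f) `^ 2 +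
    L2norm D (weak_derivative D (weak_derivative D f)) `^ 2) `^ 2^-1)%E.

End sobolev.

(* Bochner spaces of functions of t with values in a space of functions of x:
   X is the set of functions of x, N its norm. *)
Section bochner.
Context {R : realType}.
Local Notation mu := (@lebesgue_measure R).
Implicit Types (X : set (R -> R)) (N : (R -> R) -> \bar R) (w : R -> R -> R).

Definition simple_path X w : Prop :=
  exists (n : nat) (A : 'I_n -> set R) (v : 'I_n -> R -> R),
    [/\ forall i, measurable (A i), forall i, X (v i) &
        w = fun t x => \sum_(i < n) \1_(A i) t * v i x].

Definition strongly_measurable (T : R) X N w : Prop :=
  exists2 s : nat -> R -> R -> R, forall n, simple_path X (s n) &
    {ae mu, forall t, `]0, T[%classic t ->
       N (w t \- s n t) @[n --> \oo] --> 0%E}.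

Definition Linfty (T : R) X N w : Prop :=
  [/\ {ae mu, forall t, `]0, T[%classic t -> X (w t)},
      strongly_measurable T X N w &
      exists M : R, {ae mu, forall t, `]0, T[%classic t -> (N (w t) <= M%:E)%E}].

End bochner.

(* Main.v *)
Require Import Defs.
From HB Require Import structures.
From mathcomp Require Import all_boot all_order all_algebra.
From mathcomp Require Import all_classical all_reals all_analysis.
From mathcomp Require Import measurable_realfun ring lra.

Set Implicit Arguments.
Unset Strict Implicit.
Unset Printing Implicit Defensive.

Import Order.TTheory GRing.Theory Num.Theory.
Import numFieldNormedType.Exports.

Local Open Scope classical_set_scope.
Local Open Scope ring_scope.

(* Let c be the Caputo derivative of u and v = u_xx, so that c(., t) = v(., t) a.e. The Cauchy
   data give u(x, t) = \int_0^x (x - y) c(y, t) dy, hence |u| <= M for a.e. x. Truncated Laplace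
   transforms W and c^ of u and c over ]0, T[ satisfy, for real s > 0,
     W(x) = \int_0^x (x - y) c^(y) dy   and   c^ = s^alpha W - s^(alpha-1) u(., 0) + r,
   where |r| <= 3 M s^(alpha-1) exp(-s T), because the kernel is decreasing beyond T. With
   m = s^(alpha/2), variation of constants yields
     m W(X) = \int_0^X sinh(m (X - y)) (r(y) - s^(alpha-1) u(y, 0)) dy.
   Since alpha < 2, exp(m - s T) is negligible. Letting m = n, the function y |-> u(X - y, 0)
   has bounded exponential moments, so u(., 0) = 0 by Mikusinski's theorem. Then
   |W(X)| <= 3 M exp(m - s T) with m = o(s), so the exponential moments of t |-> u(X, T - t)
   grow subexponentially, and u(X, .) = 0 by Mikusinski's theorem again. *)

(** * Fubini on rectangles and triangles *)

(** Two obstacles shape the proof. First, the only bound uniform in x is |u| <= M: u_t(x, .) is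
    integrable for almost every x, but nothing controls its norm in x, so the part of the kernel
    beyond T has to be estimated through u itself. Second, the hypotheses describe u in one variable
    for almost every value of the other, whereas Fubini needs u and its Caputo derivative to be
    jointly measurable. A modified copy of u, and an explicit formula for its derivative in place of
    a choice of density for each x, repair this; the exceptional null sets are then removed by
    continuity, first in t and finally in x.

    The initial value must be eliminated before the main estimate. Its contribution to W(X) can be
    as large as exp(m) and carries no factor exp(-s T), so multiplication by exp(s T) would not
    leave a subexponential quantity. The two uses of Mikusinski's theorem sample s differently: s =
    n^(2/alpha) turns the sinh kernel into integer exponential moments in space, s = n turns the
    Laplace transform into integer exponential moments in time. No complex variable is needed. *)

Section fubini_rectangle.
Context d1 d2 (T1 : measurableType d1) (T2 : measurableType d2) (R : realType).
Variables (m1 : {sigma_finite_measure set T1 -> \bar R})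
  (m2 : {sigma_finite_measure set T2 -> \bar R}).
Implicit Types (A : set T1) (B : set T2) (F : T1 -> T2 -> R).

(** Tonelli on the whole product for the extension of [F] by zero: its slices are zero extensions of
    slices of [F], or vanish identically. *)
Lemma integrable_rectP A B F : measurable A -> measurable B ->
  measurable_fun (A `*` B) (fun z : T1 * T2 => F z.1 z.2) ->
  (\int[m1]_(x in A) \int[m2]_(y in B) `|(F x y)%:E| < +oo)%E ->
  (m1 \x m2)%E.-integrable (A `*` B) (fun z => (F z.1 z.2)%:E).
Proof.
move=> mA mB mF Foo.
pose f (z : T1 * T2) : \bar R :=
  (((fun z => F z.1 z.2 : R) \_ (A `*` B)) z)%:E.
have mAB : measurable (A `*` B) by exact: measurableX.
have mf : measurable_fun setT f.
  by apply/measurable_EFinP; apply/(measurable_restrictT _ mAB).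
have fxy x y : f (x, y) = (((F x \_ B) \_ (fun=> A x)) y)%:E.
  rewrite /f !patchE; case: (boolP ((x, y) \in A `*` B)).
    by rewrite in_setX /= => /andP[xA ->]; rewrite mem_set//; exact: set_mem.
  rewrite in_setX /= negb_and => /orP[] h.
    by rewrite memNset//; move/negP: h; apply: contra_not => /mem_set.
  by rewrite (negbTE h); case: ifP.
have fA x : A x -> forall y, f (x, y) = ((F x \_ B) y)%:E.
  by move=> Ax y; rewrite fxy patchE mem_set.
have fNA x : ~ A x -> forall y, f (x, y) = 0.
  by move=> Ax y; rewrite fxy patchE memNset.
apply/(integrable_mkcond _ mAB); apply: (@eq_integrable _ _ _ _ _ measurableT f).
  by move=> z _; rewrite /f !patchE; case: ifP.
apply/integrable12ltyP=> //; apply: le_lt_trans Foo.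
rewrite [leRHS]integral_mkcond le_eqVlt; apply/orP; left; apply/eqP.
  apply: eq_integral => x _; rewrite patchE; case: ifPn => xA.
    rewrite [RHS]integral_mkcond; apply: eq_integral => y _.
    by rewrite fA; [rewrite !patchE; case: ifP => // _; rewrite abse0|exact: set_mem].
  rewrite (eq_integral (fun=> 0)) ?integral0// => y _.
  by rewrite fNA ?abse0// => /mem_set; rewrite (negbTE xA).
Qed.

Lemma integrable_rect_dominated A B F (G : T1 -> R) (H : T2 -> R) :
  measurable A -> measurable B ->
  measurable_fun (A `*` B) (fun z : T1 * T2 => F z.1 z.2) ->
  m1.-integrable A (EFin \o G) -> m2.-integrable B (EFin \o H) ->
  (forall x y, A x -> B y -> `|F x y| <= G x * H y) ->
  (m1 \x m2)%E.-integrable (A `*` B) (fun z => (F z.1 z.2)%:E).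
Proof.
move=> mA mB mF iG iH FGH.
have mAB : measurable (A `*` B) by exact: measurableX.
apply: (@le_integrable _ _ _ _ _ mAB _ (fun z : T1 * T2 => (G z.1 * H z.2)%:E)).
- exact/measurable_EFinP.
- move=> [x y] [/= Ax By]; rewrite lee_fin (le_trans (FGH _ _ Ax By))//; exact: ler_norm.
apply: (@integrable_rectP A B (fun x y => G x * H y)) => //.
  apply: measurable_funM.
  - apply: (@measurable_comp _ _ _ _ _ _ A G _ fst) => //.
    + by move=> _ [z [? _] <-].
    + by have /measurable_EFinP := measurable_int _ iG.
    + by apply: measurable_funTS; exact: measurable_fst.
  - apply: (@measurable_comp _ _ _ _ _ _ B H _ snd) => //.
    + by move=> _ [z [_ ?] <-].
    + by have /measurable_EFinP := measurable_int _ iH.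
    + by apply: measurable_funTS; exact: measurable_snd.
rewrite (eq_integral (fun x => (\int[m2]_(y in B) `|(H y)%:E|) * `|(G x)%:E|)%E); last first.
  move=> x _; rewrite muleC -ge0_integralZl//.
    by apply: eq_integral => y _; rewrite /= normrM EFinM.
  by apply: measurableT_comp => //; exact: measurable_int iH.
have /integrableP[mG Goo] := iG; have /integrableP[mH Hoo] := iH.
have H0 : (0 <= \int[m2]_(y in B) `|(H y)%:E|)%E by exact: integral_ge0.
have mG' : measurable_fun A (fun x => `|(G x)%:E|%E) by exact: measurableT_comp.
by rewrite ge0_integralZl// lte_mul_pinfty// ge0_fin_numE.
Qed.

Lemma fubini_rect A B F : measurable A -> measurable B ->
  (m1 \x m2)%E.-integrable (A `*` B) (fun z => (F z.1 z.2)%:E) ->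
  [/\ m1.-integrable A (fun x => (\int[m2]_(y in B) F x y)%:E),
      m2.-integrable B (fun y => (\int[m1]_(x in A) F x y)%:E),
      \int[m1]_(x in A) (\int[m2]_(y in B) F x y) =
      \int[m2]_(y in B) (\int[m1]_(x in A) F x y) &
      {ae m1, forall x, A x -> m2.-integrable B (EFin \o F x)} /\
      {ae m2, forall y, B y -> m1.-integrable A (EFin \o F^~ y)}].
Proof.
move=> mA mB iF.
have mF : measurable_fun (A `*` B) (fun z : T1 * T2 => F z.1 z.2).
  by have /measurable_EFinP := measurable_int _ iF.
pose f (z : T1 * T2) : \bar R :=
  (((fun z => F z.1 z.2 : R) \_ (A `*` B)) z)%:E.
have mAB : measurable (A `*` B) by exact: measurableX.
have mf : measurable_fun setT f.
  by apply/measurable_EFinP; apply/(measurable_restrictT _ mAB).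
have fxy x y : f (x, y) = (((F x \_ B) \_ (fun=> A x)) y)%:E.
  rewrite /f !patchE; case: (boolP ((x, y) \in A `*` B)).
    by rewrite in_setX /= => /andP[xA ->]; rewrite mem_set//; exact: set_mem.
  rewrite in_setX /= negb_and => /orP[] h.
    by rewrite memNset//; move/negP: h; apply: contra_not => /mem_set.
  by rewrite (negbTE h); case: ifP.
have fyx x y : f (x, y) = ((((F^~ y) \_ A) \_ (fun=> B y)) x)%:E.
  rewrite /f !patchE; case: (boolP ((x, y) \in A `*` B)).
    by rewrite in_setX /= => /andP[-> xA]; rewrite mem_set//; exact: set_mem.
  rewrite in_setX /= negb_and => /orP[] h; first by rewrite (negbTE h); case: ifP.
  by rewrite memNset//; move/negP: h; apply: contra_not => /mem_set.
have fA x : A x -> forall y, f (x, y) = ((F x \_ B) y)%:E.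
  by move=> Ax y; rewrite fxy patchE mem_set.
have fNA x : ~ A x -> forall y, f (x, y) = 0.
  by move=> Ax y; rewrite fxy patchE memNset.
have fB y : B y -> forall x, f (x, y) = ((F^~ y \_ A) x)%:E.
  by move=> By x; rewrite fyx patchE mem_set.
have fNB y : ~ B y -> forall x, f (x, y) = 0.
  by move=> By x; rewrite fyx patchE memNset.
have intf : (m1 \x m2)%E.-integrable setT f.
  apply: (eq_integrable measurableT) ((integrable_mkcond _ mAB).1 iF).
  by move=> z _; rewrite /f !patchE; case: ifP.
have FA x : A x -> \int[m2]_(y in B) F x y = fine (\int[m2]_y f (x, y)).
  move=> Ax; rewrite Rintegral_mkcond; congr fine; apply: eq_integral => y _.
  by rewrite fA.
have FB y : B y -> \int[m1]_(x in A) F x y = fine (\int[m1]_x f (x, y)).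
  move=> By; rewrite Rintegral_mkcond; congr fine; apply: eq_integral => x _.
  by rewrite fB.
(* A slice integral may be infinite, and [fine] then returns 0. Integrability of [G] confines this
   to a null set, so the real-valued version has the same integral. *)
have aux d (T : measurableType d) (m : {measure set T -> \bar R}) (G : T -> \bar R) D (H : T -> R) : measurable D ->
    m.-integrable setT G -> (forall x, D x -> H x = fine (G x)) ->
    (forall x, ~ D x -> G x = 0) ->
    m.-integrable D (EFin \o H) /\ \int[m]_(x in D) H x = fine (\int[m]_x G x).
  move=> mD iG HG G0.
  have iG' := integrableS measurableT mD (@subsetT _ _) iG.
  have aeHG : ae_eq m D G (EFin \o H).
    apply: filterS (integrable_ae mD iG') => x /= Gfin Dx.
    by rewrite HG// fineK// Gfin.
  have mH : measurable_fun D (EFin \o H).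
    apply: (@eq_measurable_fun _ _ _ _ D (EFin \o (fine \o G))).
      by move=> x /set_mem Dx /=; rewrite HG.
    by apply/measurable_EFinP; apply: measurableT_comp => //; exact: measurable_int iG'.
  have iH : m.-integrable D (EFin \o H).
    apply: (le_integrable mD mH); last exact: iG'.
    move=> x Dx /=; rewrite HG//.
    by case: (G x) => [r||] //=; rewrite ?normr0 leey.
  split => //; congr fine.
  have -> : (\int[m]_(x in D) (H x)%:E = \int[m]_(x in D) G x)%E.
    apply: ae_eq_integral => //; [exact: measurable_int iG'|exact: ae_eq_sym].
  rewrite [LHS]integral_mkcond; apply: eq_integral => x _; rewrite patchE.
  by case: ifPn => // xD; rewrite G0// => /mem_set; rewrite (negbTE xD).
have FN1 x : ~ A x -> (\int[m2]_y f (x, y) = 0)%E.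
  by move=> Ax; rewrite (eq_integral (cst 0%E)) ?integral0// => y _; exact: fNA.
have FN2 y : ~ B y -> (\int[m1]_x f (x, y) = 0)%E.
  by move=> By; rewrite (eq_integral (cst 0%E)) ?integral0// => x _; exact: fNB.
have [iF1 F1] := aux _ _ m1 _ A _ mA (integrable_fubini_F intf) FA FN1.
have iG2 : m2.-integrable setT (fun y => \int[m1]_x f (x, y))%E.
  apply/integrableP; split; first exact: (measurable_fubini_G intf).
  apply: le_lt_trans ((integrable21ltyP _ _ mf).1 intf); apply: ge0_le_integral => //.
  - by apply: measurableT_comp => //; exact: (measurable_fubini_G intf).
  - apply: (measurable_fun_fubini_tonelli_G (abse \o f)) => //=.
    exact: measurableT_comp.
  - by move=> y _; apply: le_abse_integral => //; exact: measurableT_comp.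
have [iF2 F2] := aux _ _ m2 _ B _ mB iG2 FB FN2.
split => //.
  by rewrite F1 F2; congr fine; exact: (Fubini intf).
split.
- apply: filterS (ae_integrable1 intf) => x /= H Ax.
  by rewrite integrable_mkcond//; apply: eq_integrable H => // y _;
    rewrite fA//= !patchE; case: ifP.
- apply: filterS (ae_integrable2 intf) => y /= H By.
  by rewrite integrable_mkcond//; apply: eq_integrable H => // x _;
    rewrite fB//= !patchE; case: ifP.
Qed.

End fubini_rectangle.

Section triangle.
Context {R : realType}.
Local Notation mu := (@lebesgue_measure R).
Local Notation RR := (measurableTypeR R).

(** Cutting [p] off to 0 where x <= y reduces the triangle to the square. The domination is given on
    the triangle only, and [G], [H] may have any sign elsewhere, hence the absolute values in the
    proof. *)
Lemma fubini_triangle (a b : R) (p : R -> R -> R) (G H : R -> R) :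
  measurable_fun (`]a, b[ `*` `]a, b[ : set (RR * RR))
    (fun z : RR * RR => p z.1 z.2) ->
  mu.-integrable `]a, b[ (EFin \o G) -> mu.-integrable `]a, b[ (EFin \o H) ->
  (forall x y, a < y -> y < x -> x < b -> `|p x y| <= G x * H y) ->
  [/\ mu.-integrable `]a, b[ (fun x => (\int[mu]_(y in `]a, x[) p x y)%:E),
      mu.-integrable `]a, b[ (fun y => (\int[mu]_(x in `]y, b[) p x y)%:E) &
      \int[mu]_(x in `]a, b[) (\int[mu]_(y in `]a, x[) p x y) =
      \int[mu]_(y in `]a, b[) (\int[mu]_(x in `]y, b[) p x y)].
Proof.
move=> mp iG iH pGH; pose F x y := if y < x then p x y else 0.
have mI : measurable (`]a, b[%classic : set RR) by exact: measurable_itv.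
have mII : measurable (`]a, b[ `*` `]a, b[ : set (RR * RR)) by exact: measurableX.
have mF : measurable_fun (`]a, b[ `*` `]a, b[ : set (RR * RR))
    (fun z : RR * RR => F z.1 z.2).
  rewrite /F; apply: measurable_fun_if => //.
  - apply: measurable_fun_ltr; apply: measurable_funTS; [exact: measurable_snd|exact: measurable_fst].
  - by apply: measurable_funS mp => // x [].
have H0 y : a < y -> y < b -> 0 <= `|H y| by [].
have iG' : mu.-integrable `]a, b[ (EFin \o (fun x => `|G x|)) by exact: integrable_norm.
have iH' : mu.-integrable `]a, b[ (EFin \o (fun x => `|H x|)) by exact: integrable_norm.
have FGH x y : `]a, b[%classic x -> `]a, b[%classic y -> `|F x y| <= `|G x| * `|H y|.
  rewrite /= !in_itv /= => /andP[ax xb] /andP[ay yb]; rewrite /F; case: ifP => yx.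
    by rewrite -normrM; apply: le_trans (ler_norm _); exact: pGH.
  by rewrite normr0 mulr_ge0.
have [i1 i2 e _] := fubini_rect mI mI (integrable_rect_dominated mI mI mF iG' iH' FGH).
have E1 x : x \in `]a, b[%classic ->
    \int[mu]_(y in `]a, b[) F x y = \int[mu]_(y in `]a, x[) p x y.
  rewrite inE /= in_itv /= => /andP[ax xb].
  rewrite (_ : `]a, x[%classic = `]a, b[ `&` [set y | y < x]); last first.
    apply/seteqP; split => y /=; rewrite !in_itv/=.
      by move=> /andP[-> yx]; rewrite (lt_trans yx).
    by move=> [/andP[-> _] ->].
  rewrite Rintegral_mkcondr; apply: eq_Rintegral => y _; rewrite patchE /F.
  case: ifPn => yx; first by rewrite mem_set.
  by rewrite memNset//= => yx'; rewrite yx' in yx.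
have E2 y : y \in `]a, b[%classic ->
    \int[mu]_(x in `]a, b[) F x y = \int[mu]_(x in `]y, b[) p x y.
  rewrite inE /= in_itv /= => /andP[ay yb].
  rewrite (_ : `]y, b[%classic = `]a, b[ `&` [set x | y < x]); last first.
    apply/seteqP; split => x /=; rewrite !in_itv/=.
      by move=> /andP[yx ->]; rewrite (lt_trans ay yx).
    by move=> [/andP[_ ->] ->].
  rewrite Rintegral_mkcondr; apply: eq_Rintegral => x _; rewrite patchE /F.
  case: ifPn => yx; first by rewrite mem_set.
  by rewrite memNset//= => yx'; rewrite yx' in yx.
split.
- by apply: eq_integrable i1 => // x xab; rewrite /= E1.
- by apply: eq_integrable i2 => // y yab; rewrite /= E2.
- transitivity (\int[mu]_(x in `]a, b[) (\int[mu]_(y in `]a, b[) F x y)).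
    by apply: eq_Rintegral => x xab; rewrite -E1.
  by rewrite e; apply: eq_Rintegral => y yab; rewrite -E2.
Qed.

Lemma measurable_fun_prod_mul (A B : set R) (p q : R -> R) :
  measurable A -> measurable B -> measurable_fun A p -> measurable_fun B q ->
  measurable_fun (A `*` B : set (RR * RR)) (fun z : RR * RR => p z.1 * q z.2).
Proof.
move=> mA mB mp mq; have mAB : measurable (A `*` B : set (RR * RR)) by exact: measurableX.
apply: measurable_funM.
- apply: (@measurable_comp _ _ _ _ _ _ A p _ fst) => //.
  + by move=> _ [z [? _] <-].
  + by apply: measurable_funTS; exact: measurable_fst.
- apply: (@measurable_comp _ _ _ _ _ _ B q _ snd) => //.
  + by move=> _ [z [_ ?] <-].
  + by apply: measurable_funTS; exact: measurable_snd.
Qed.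

Lemma integrable_Rintegral_le (D : set R) (f : R -> R) :
  mu.-integrable D (EFin \o f) -> measurable_fun D f.
Proof. by move=> /measurable_int/measurable_EFinP. Qed.

(** Fubini for [p x * g y] on the triangle y < x: the inner integrals are p x (f x - f a) and g y (P
    b - P y). Only the integral representations of [f] and [P] enter, so no point of
    differentiability has to be found. *)
Lemma integration_by_parts_density (a b : R) (f g P p : R -> R) : a < b ->
  mu.-integrable `]a, b[ (EFin \o g) -> mu.-integrable `]a, b[ (EFin \o p) ->
  (forall t, a < t -> t <= b -> f t = f a + \int[mu]_(x in `]a, t[) g x) ->
  (forall t, a < t -> t <= b -> P t = P a + \int[mu]_(x in `]a, t[) p x) ->
  \int[mu]_(x in `]a, b[) (g x * P x) =
    f b * P b - f a * P a - \int[mu]_(x in `]a, b[) (f x * p x).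
Proof.
move=> ab ig ip fE PE.
have mI : measurable (`]a, b[%classic : set RR) by exact: measurable_itv.
have mpg := measurable_fun_prod_mul mI mI (integrable_Rintegral_le ip) (integrable_Rintegral_le ig).
have [] := @fubini_triangle a b (fun x y => p x * g y) (fun x => `|p x|) (fun x => `|g x|) mpg _ _ _.
- exact: integrable_norm.
- exact: integrable_norm.
- by move=> x y _ _ _; rewrite normrM.
move=> i1 i2 e.
have sub t : t \in `]a, b[%classic -> (`]a, t[ `<=` `]a, b[) /\ (`]t, b[ `<=` `]a, b[).
  rewrite inE /= in_itv/= => /andP[at_ tb]; split=> x /=; rewrite !in_itv /= => /andP[h1 h2].
    by rewrite h1 (lt_trans h2).
  by rewrite h2 (lt_trans at_).
have E1 x : x \in `]a, b[%classic ->
    \int[mu]_(y in `]a, x[) (p x * g y) = f x * p x - f a * p x.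
  move=> xab; have [s1 _] := sub _ xab.
  rewrite RintegralZl//; last exact: integrableS ig.
  by move: xab; rewrite inE /= in_itv/= => /andP[ax xb]; rewrite fE ?ltW//; ring.
have E2 y : y \in `]a, b[%classic ->
    \int[mu]_(x in `]y, b[) (p x * g y) = g y * P b - g y * P y.
  move=> yab; have [s1 s2] := sub _ yab.
  have ip1 : mu.-integrable `]a, y[ (EFin \o p) by exact: integrableS ip.
  have ip2 : mu.-integrable `]y, b[ (EFin \o p) by exact: integrableS ip.
  rewrite RintegralZr//.
  move: (yab); rewrite inE /= in_itv/= => /andP[ay yb].
  rewrite (PE b)// (PE y)// ?ltW//.
  have := @Rintegral_itvB R p (BRight a) (BLeft b) y ip (ltW _) _.
  rewrite -Rintegral_itv_bndo_bndc// => <- //; ring.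
have {}e : \int[mu]_(x in `]a, b[) (f x * p x - f a * p x) =
    \int[mu]_(y in `]a, b[) (g y * P b - g y * P y).
  transitivity (\int[mu]_(x in `]a, b[) (\int[mu]_(y in `]a, x[) (p x * g y))).
    by apply: eq_Rintegral => x xab; rewrite -E1.
  by rewrite e; apply: eq_Rintegral => y yab; rewrite -E2.
move: e.
have ifap : mu.-integrable `]a, b[ (EFin \o (fun x => f a * p x)).
  exact: (integrableZl mI (f a) ip).
have igP : mu.-integrable `]a, b[ (EFin \o (fun x => g x * P b)).
  exact: (integrableZr mI (P b) ig).
have ifp : mu.-integrable `]a, b[ (EFin \o (fun x => f x * p x)).
  have := integrableD mI i1 ifap; apply: eq_integrable => // x xab.
  by rewrite /= E1//= -EFinD subrK.
have igPx : mu.-integrable `]a, b[ (EFin \o (fun x => g x * P x)).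
  have := integrableB mI igP i2; apply: eq_integrable => // x xab.
  by rewrite /= E2//= -EFinB subKr.
rewrite !RintegralB// RintegralZl// RintegralZr//.
rewrite (fE b)// (PE b)//; lra.
Qed.

End triangle.

(** * Integrals of continuous functions and dominated convergence *)

Section integrable_continuous.
Context {R : realType}.
Local Notation mu := (@lebesgue_measure R).
Local Notation RR := (measurableTypeR R).

Lemma measurable_itvoo (a b : R) : measurable (`]a, b[%classic : set RR).
Proof. exact: measurable_itv. Qed.

Lemma continuous_bounded_itv (a b : R) (g : R -> R) : {within `[a, b], continuous g} ->
  exists M, forall x, x \in `[a, b] -> `|g x| <= M.
Proof.
move=> cg; have [ab|ba] := leP a b; last first.
  by exists 0 => x; rewrite in_itv/= => /andP[ax xb]; have := le_trans ax xb; rewrite leNgt ba.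
have cn : {within `[a, b], continuous (fun x => `|g x|)}.
  by move=> x; apply: continuous_comp; [exact: cg|exact: norm_continuous].
by have [c cab H] := EVT_max ab cn; exists `|g c|.
Qed.

Lemma integrable_continuousM (a b : R) (g f : R -> R) : continuous g ->
  mu.-integrable `]a, b[ (EFin \o f) -> mu.-integrable `]a, b[ (EFin \o (fun x => g x * f x)).
Proof.
move=> cg ifi; have [M HM] := continuous_bounded_itv (@continuous_subspaceT _ _ `[a, b] _ cg).
have mg : measurable_fun `]a, b[ g by apply: measurable_funTS; exact: continuous_measurable_fun.
have bg : [bounded g x | x in `]a, b[].
  exists M; split; first exact: num_real.
  by move=> N MN x xab; apply: le_trans (HM x _) (ltW MN); exact: subset_itv_oo_cc xab.
have := integrableMl (measurable_itvoo a b) ifi mg bg.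
by apply: eq_integrable => // x _; rewrite /= mulrC.
Qed.

Lemma integrable_within_continuous (a b : R) (f : R -> R) : {within `[a, b], continuous f} ->
  mu.-integrable `]a, b[ (EFin \o f).
Proof.
move=> cf; apply: integrableS (continuous_compact_integrable (@segment_compact _ a b) cf) => //.
exact: subset_itv_oo_cc.
Qed.

Lemma dominated_cvg_Rintegral (A : set RR) (f_ : nat -> R -> R) (f g : R -> R) :
  measurable A -> (forall n, measurable_fun A (f_ n)) ->
  (forall x, A x -> f_ n x @[n --> \oo] --> f x) ->
  mu.-integrable A (EFin \o g) -> (forall n x, A x -> `|f_ n x| <= g x) ->
  mu.-integrable A (EFin \o f) /\
  \int[mu]_(x in A) f_ n x @[n --> \oo] --> \int[mu]_(x in A) f x.
Proof.
move=> mA mf cvf ig fg.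
have mfl : measurable_fun A f by apply: measurable_fun_cvg cvf.
have [] := @dominated_convergence _ _ _ mu A mA
  (fun n x => (f_ n x)%:E) (EFin \o f) (EFin \o g).
- by move=> n; apply/measurable_EFinP.
- exact/measurable_EFinP.
- by apply: aeW => x Ax; apply: cvg_EFin; [exact: nearW|exact: cvf].
- exact: ig.
- by apply: aeW => x n Ax; rewrite lee_fin; exact: fg.
move=> ifl _ cv; split => //; apply: fine_cvg; rewrite fineK//.
exact: (integrable_fin_num mA ifl).
Qed.

Lemma Rintegral_FTC (g F : R -> R) (s t : R) : s < t -> {within `[s, t], continuous g} ->
  (forall x : R, s <= x -> x <= t -> is_derive x (1 : R) F (g x)) ->
  \int[mu]_(x in `]s, t[) g x = F t - F s.
Proof.
move=> st cg dF.
have cF x : s <= x -> x <= t -> {for x, continuous F}.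
  by move=> sx xt; apply/differentiable_continuous/derivable1_diffP; have [] := dF x sx xt.
have dp : derivable_oo_LRcontinuous F s t.
  split.
  - by move=> x; rewrite in_itv/= => /andP[/ltW sx /ltW xt]; have [] := dF x sx xt.
  - exact/cvg_at_right_filter/cF/ltW.
  - exact/cvg_at_left_filter/cF/lexx/ltW.
have F'g : {in `]s, t[, derive1 F =1 g}.
  move=> x; rewrite in_itv/= => /andP[/ltW sx /ltW xt].
  by rewrite derive1E; have [_ ->] := dF x sx xt.
have h := continuous_FTC2 st cg dp F'g.
have ig := integrable_within_continuous cg.
rewrite /Rintegral -(@integral_itv_bndoo _ s t _ true false)//; first by rewrite h.
exact: measurable_int ig.
Qed.

End integrable_continuous.

(** * The fundamental theorem of calculus for absolutely continuous functions *)

Section abs_continuous_seq.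
Context {R : realType}.
Implicit Types (a b : R) (f : R -> R) (p q : R * R) (L : seq (R * R)).

Definition sub_itv a b p := [&& a <= p.1, p.1 <= p.2 & p.2 <= b].

Definition nonoverlap : rel (R * R) := fun p q => (p.2 <= q.1) || (q.2 <= p.1).

Definition itv_family a b L := all (sub_itv a b) L && pairwise nonoverlap L.

(** Lists of pairs let families be refined and permuted by list operations, and the non-strict bound
    survives the supremum that defines the total variation. *)
Definition seq_ac a b f := forall e, 0 < e -> exists2 d, 0 < d &
  forall L, itv_family a b L -> \sum_(p <- L) (p.2 - p.1) < d ->
    \sum_(p <- L) `|f p.2 - f p.1| <= e.

Lemma nonoverlapC : symmetric nonoverlap.
Proof. by move=> p q; rewrite /nonoverlap orbC. Qed.

Lemma abs_continuous_seq_ac a b f : abs_continuous a b f -> seq_ac a b f.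
Proof.
move=> acf e e0; have [d d0 H] := acf e e0; exists d => // L /andP[/allP Lab Ld] Lsum.
pose l i := (nth (0, 0) L i).1; pose r i := (nth (0, 0) L i).2.
have -> : \sum_(p <- L) `|f p.2 - f p.1| = \sum_(i < size L) `|f (r i) - f (l i)|.
  by rewrite (big_nth (0, 0)) big_mkord.
apply/ltW/H.
- move=> i iL; have /and3P[] := Lab _ (mem_nth (0, 0) iL); by split.
- apply/trivIsetP => i j /= iL jL ij; apply/seteqP; split=> // x /= [].
  rewrite !in_itv /= => /andP[lx xr] /andP[lx' xr'].
  have : nonoverlap (nth (0, 0) L i) (nth (0, 0) L j).
    have /(pairwiseP (0, 0)) H' := Ld.
    have [ji|ij'|/eqP] := ltngtP j i; last by rewrite eq_sym (negbTE ij).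
      by rewrite nonoverlapC; apply: H'.
    exact: H'.
  rewrite /nonoverlap -/(r i) -/(r j) -/(l i) -/(l j); lra.
- by move: Lsum; rewrite (big_nth (0, 0)) big_mkord.
Qed.

Lemma seq_acD a b f g : seq_ac a b f -> seq_ac a b g ->
  seq_ac a b (fun x => f x + g x).
Proof.
move=> acf acg e e0; have e20 : 0 < e / 2 by rewrite divr_gt0.
have [d d0 Hf] := acf _ e20; have [d' d'0 Hg] := acg _ e20.
exists (Num.min d d'); first by rewrite lt_min d0.
move=> L Lab; rewrite lt_min => /andP[Ld Ld'].
rewrite [leRHS]splitr; apply: le_trans (lerD (Hf _ Lab Ld) (Hg _ Lab Ld')).
rewrite -big_split /=; apply: ler_sum => p _.
by rewrite opprD addrACA; exact: ler_normD.
Qed.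


Lemma itv_partition_pairmap a b f s : itv_partition a b s ->
  let L := pairmap pair a s in
  [/\ itv_family a b L, \sum_(p <- L) (p.2 - p.1) = b - a &
      \sum_(p <- L) `|f p.2 - f p.1| = variation a b f s].
Proof.
elim: s a => [|x s IH] a /=.
  move=> /itv_partition_nil <-; split; rewrite ?big_nil ?subrr//.
  by rewrite /variation big_nil.
move=> abs; have axs := itv_partition_cons abs.
have [/andP[Lall Lpw] Lsum Lvar] := IH _ axs.
have ax : a <= x by case: abs => /= /andP[/ltW].
have xb := itv_partition_le axs.
split.
- apply/andP; split => /=.
    rewrite /sub_itv /= lexx ax xb /=.
    by apply: sub_all Lall => p /and3P[h1 h2 h3]; rewrite /sub_itv h2 h3 (le_trans ax).
  rewrite Lpw andbT; apply: sub_all Lall => p /and3P[h1 h2 h3].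
  by rewrite /nonoverlap /= h1.
- by rewrite big_cons Lsum /=; lra.
- rewrite big_cons Lvar /variation /= big_nat_recl//=.
Qed.

Lemma itv_family_catCA a b L1 L2 L3 :
  itv_family a b (L1 ++ L2 ++ L3) = itv_family a b (L2 ++ L1 ++ L3).
Proof.
rewrite /itv_family (perm_all _ (permEl (perm_catCA L1 L2 L3))); congr andb.
have sw : allrel nonoverlap L1 L2 = allrel nonoverlap L2 L1.
  by rewrite allrelC; apply: eq_allrel => p q; rewrite nonoverlapC.
rewrite !pairwise_cat !allrel_catr sw.
move: (allrel _ L2 L1) (allrel _ L1 L3) (allrel _ L2 L3) (pairwise _ L1) => [] [] [] [].
all: by move: (pairwise _ L2) (pairwise _ L3) => [] [].
Qed.

Lemma itv_family_refine a b p L L' : itv_family p.1 p.2 L' ->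
  itv_family a b (p :: L) -> itv_family a b (L' ++ L).
Proof.
move=> /andP[/allP L'all L'pw] /andP[/= /andP[/and3P[ap pp pb] Lall] /andP[pL Lpw]].
apply/andP; split.
  rewrite all_cat Lall andbT; apply/allP => q /L'all /and3P[h1 h2 h3].
  by rewrite /sub_itv h2 (le_trans ap h1) (le_trans h3 pb).
rewrite pairwise_cat L'pw Lpw !andbT; apply/allrelP => q q' /L'all /and3P[h1 h2 h3].
by move=> /(allP pL); rewrite /nonoverlap => /orP[] h; apply/orP; [left|right]; lra.
Qed.

(* The intervals are replaced one after the other by the pieces of a partition. *)
Lemma seq_ac_total_variation_aux a b f e d :
  (forall L, itv_family a b L -> \sum_(p <- L) (p.2 - p.1) < d ->
    \sum_(p <- L) `|f p.2 - f p.1| <= e) ->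
  forall L L', itv_family a b (L ++ L') -> \sum_(p <- L ++ L') (p.2 - p.1) < d ->
  (\sum_(p <- L) total_variation p.1 p.2 f +
     (\sum_(p <- L') `|f p.2 - f p.1|)%:E <= e%:E)%E.
Proof.
move=> H; elim=> [L' ? ?|p L IH L' fam sm].
  by rewrite big_nil add0e lee_fin; exact: H.
have pp : p.1 <= p.2 by move: fam => /andP[/= /andP[/and3P[]]].
have famLL : itv_family a b (L ++ L').
  move: fam => /andP[/= /andP[? h1] /andP[? h2]]; exact/andP.
have : p.1 = p.2 \/ p.1 < p.2 by case: ltgtP pp; [right|by []|left].
case=> [pe|plt].
  rewrite big_cons pe total_variationxx add0e; apply: IH => //.
  by move: sm; rewrite /= big_cons pe subrr add0r.
(* One partition of [p] at a time: its pieces join [L'], and the supremum over partitions is taken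
   only after the other terms, which form [X], have been moved to the right. *)
have step s : itv_partition p.1 p.2 s ->
    ((variation p.1 p.2 f s)%:E + (\sum_(p <- L) total_variation p.1 p.2 f +
     (\sum_(p <- L') `|f p.2 - f p.1|)%:E) <= e%:E)%E.
  move=> /(itv_partition_pairmap f)[fams sums vars].
  apply: (@le_trans _ _ (\sum_(p <- L) total_variation p.1 p.2 f +
      (\sum_(p <- pairmap pair p.1 s ++ L') `|f p.2 - f p.1|)%:E)%E).
    by rewrite big_cat /= EFinD vars addeCA.
  apply: IH.
    have := itv_family_refine fams fam.
    by rewrite itv_family_catCA.
  by rewrite (perm_big _ (permEl (perm_catCA L _ L'))) big_cat /= sums; move: sm; rewrite /= big_cons.
rewrite big_cons -addeA.
set X := (X in (_ + X)%E).
have X0 : (0 <= X)%E.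
  apply: adde_ge0; last by rewrite lee_fin; apply: sumr_ge0.
  rewrite big_seq; apply: sume_ge0 => q qL; apply: total_variation_ge0.
  by move: famLL => /andP[/allP/(_ q)]; rewrite mem_cat qL /= => /(_ isT)/and3P[].
(* The trivial partition of [p] already bounds [X] by [e]; finiteness allows the subtraction. *)
have Xfin : X \is a fin_num.
  rewrite ge0_fin_numE //.
  apply: le_lt_trans (ltry e); apply: le_trans (step _ (itv_partition1 plt)).
  by rewrite -/X leeDr // lee_fin variation_ge0.
rewrite -leeBrDr //; apply: ge_ereal_sup => _ [_ [s ps <-] <-].
by rewrite leeBrDr //; exact: step.
Qed.

Lemma seq_ac_total_variation a b f e : 0 < e -> seq_ac a b f ->
  exists2 d, 0 < d & forall L, itv_family a b L -> \sum_(p <- L) (p.2 - p.1) < d ->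
    (\sum_(p <- L) total_variation p.1 p.2 f <= e%:E)%E.
Proof.
move=> e0 /(_ e e0)[d d0 H]; exists d => // L Lab Ld.
have := @seq_ac_total_variation_aux _ _ _ _ _ H L [::].
by rewrite cats0 big_nil adde0; apply.
Qed.

(** Intervals shorter than the [d] belonging to e = 1 have variation at most 1, and finitely many of
    them cover [a, x]. *)
Lemma seq_ac_bounded_variation a b f x : a <= x -> x <= b -> seq_ac a b f ->
  total_variation a x f \is a fin_num.
Proof.
move=> ax xb acf.
have [d d0 H] := seq_ac_total_variation ltr01 acf.
have small y z : a <= y -> y <= z -> z <= b -> z - y < d ->
    total_variation y z f \is a fin_num.
  move=> ay yz zb zyd; rewrite ge0_fin_numE ?total_variation_ge0//.
  have := H [:: (y, z)]; rewrite !big_seq1 /= => /(_ _ zyd)/le_lt_trans; apply; last exact: ltry.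
  by rewrite /itv_family /sub_itv /= ay yz zb.
(* Steps of [d / 2] keep the length of each piece strictly below [d]. *)
have fin n y : a <= y -> y <= b -> y - a < d / 2 * n.+1%:R ->
    total_variation a y f \is a fin_num.
  elim: n y => [|n IH] y ay yb ylt.
    by apply: small => //; move: ylt; rewrite mulr1; lra.
  have [yd|yd] := leP (y - a) (d / 2); first by apply: small => //; lra.
  rewrite (@total_variationD _ a y (y - d / 2)) ?fin_numD; [|lra|lra].
  have y1 : y - d / 2 - a < d / 2 * n.+1%:R.
    by move: ylt; rewrite -[n.+2]addn1 natrD mulrDr; lra.
  have -> /= : total_variation a (y - d / 2) f \is a fin_num by apply: IH; lra.
  by apply: small => //; lra.
apply: (fin (Num.bound ((x - a) / (d / 2)))) => //.
rewrite mulrC -ltr_pdivrMr ?divr_gt0//.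
apply: lt_trans (_ : (Num.bound ((x - a) / (d / 2)))%:R < _); last by rewrite ltr_nat.
by apply: archi_boundP; rewrite divr_ge0 ?subr_ge0// ltW// divr_gt0.
Qed.

(** By additivity the increment of the variation function over an interval is the variation of [f]
    there, and those variations are small in sum by [seq_ac_total_variation]. *)
Lemma seq_ac_tv a b f : seq_ac a b f ->
  seq_ac a b (fun x => fine (total_variation a x f)).
Proof.
move=> acf e e0; have [d d0 H] := seq_ac_total_variation e0 acf.
exists d => // L fam Ld; rewrite -lee_fin; apply: le_trans (H _ fam Ld).
rewrite -sumEFin [in leLHS]big_seq [in leRHS]big_seq; apply: lee_sum => p pL.
have /and3P[ap pp pb] : sub_itv a b p by move: fam => /andP[/allP/(_ _ pL)].
have f1 := seq_ac_bounded_variation ap (le_trans pp pb) acf.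
have f2 := seq_ac_bounded_variation (le_trans ap pp) pb acf.
rewrite (total_variationD f ap pp) fineD //; last first.
  have := f2; rewrite (total_variationD f ap pp) fin_numD => /andP[//].
rewrite addrAC subrr add0r ger0_norm ?fine_ge0 ?total_variation_ge0//.
rewrite fineK //; have := f2; rewrite (total_variationD f ap pp) fin_numD => /andP[//].
Qed.

End abs_continuous_seq.

(** * Radon-Nikodym densities of absolutely continuous increasing functions *)

Section density.
Context {R : realType}.
Local Notation mu := (@lebesgue_measure R).
Implicit Types (a b : R) (h : R -> R).

(** The pair is inf and sup of the trace of [I] on ]a, b]. The open hull lies in [I], so the measure
    of [I] controls its length; the half-open hull contains the trace, so an increment of the
    function controls its Stieltjes measure. An empty trace is encoded by (a, a). *)
Lemma open_interval_oc_hull a b (I : set R) : a < b -> open I -> is_interval I ->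
  exists p : R * R, [/\ sub_itv a b p, p = (a, a) \/ p.1 < p.2,
    `]p.1, p.2[ `<=` I & I `&` `]a, b] `<=` `]p.1, p.2]].
Proof.
move=> ab oI iI; pose A := I `&` `]a, b].
have [A0|/set0P A0] := eqVneq A set0.
  exists (a, a); split; first by rewrite /sub_itv /= lexx ltW.
  - by left.
  - by rewrite set_itvoo0.
  - by rewrite -/A A0.
have lbA : lbound A a by move=> x [_ /=]; rewrite in_itv/= => /andP[/ltW].
have ubA : ubound A b by move=> x [_ /=]; rewrite in_itv/= => /andP[].
have hlA : has_lbound A by exists a.
have huA : has_ubound A by exists b.
have hiA : has_inf A by split.
have hsA : has_sup A by split.
have sub : A `<=` `]inf A, sup A].
  move=> x Ax /=; rewrite in_itv/= (ub_le_sup huA)// andbT.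
  move: (Ax) => [Ix]; rewrite /= in_itv/= => /andP[ax xb].
  have : \forall y \near x^'-, I y.
    apply: (@cvg_at_left_filter _ _ id x x) => //.
    by move: oI; rewrite openE; exact.
  move=> nI; near x^'- => y.
  have Ay : A y.
    split; first by near: y.
    rewrite /= in_itv/=; apply/andP; split; first by near: y; exact: nbhs_left_gt.
    by apply: ltW; apply: lt_le_trans xb; near: y; exact: nbhs_left_lt.
  by apply: le_lt_trans (ge_inf hlA Ay) _; near: y; exact: nbhs_left_lt.
exists (inf A, sup A); split => //=.
- rewrite /sub_itv /= lb_le_inf// ge_sup// andbT /=.
  by have [x /sub] := A0; rewrite /= in_itv/= => /andP[/ltW]; exact: le_trans.
- by right; have [x /sub] := A0; rewrite /= in_itv/= => /andP[]; exact: lt_le_trans.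
- move=> x /=; rewrite in_itv/= => /andP[ix xs].
  have [y [Iy _] yx] := inf_lt A0 ix.
  have [z [Iz _] xz] := sup_gt A0 xs.
  by apply: (iI y z) => //; rewrite !ltW.
Unshelve. all: by end_near. Qed.

(** A degenerate pair sits at [a], to the left of every other pair, and so never overlaps; otherwise
    the midpoint of the common part is a witness. *)
Lemma not_nonoverlap a (p q : R * R) :
  p = (a, a) \/ p.1 < p.2 -> q = (a, a) \/ q.1 < q.2 -> a <= p.1 -> a <= q.1 ->
  ~~ nonoverlap p q -> exists x, (x \in `]p.1, p.2[) /\ (x \in `]q.1, q.2[).
Proof.
move=> hp hq ap aq; rewrite /nonoverlap negb_or -!ltNge => /andP[no1 no2].
have hp' : p.1 < p.2 by case: hp no1 => [-> /=|//]; lra.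
have hq' : q.1 < q.2 by case: hq no2 => [-> /=|//]; lra.
exists ((Num.max p.1 q.1 + Num.min p.2 q.2) / 2); rewrite !in_itv /= maxEle minEle.
by case: ifP => h1; case: ifP => h2; split; lra.
Qed.

(** Radon-Nikodym for the Stieltjes measure of [H] restricted to ]a, b]. It dominates no null set:
    such a set lies in an open set of length below [d], whose components are disjoint intervals, and
    [seq_ac] bounds the increments of [H] over any finite number of them by [e]. *)
Lemma cumulative_density a b (H : cumulative R R) : a < b -> seq_ac a b H ->
  exists g : R -> R, mu.-integrable setT (EFin \o g) /\
    forall t, a <= t -> t <= b -> H t - H a = \int[mu]_(x in `]a, t]) g x.
Proof.
move=> ab acH.
pose nu0 := lebesgue_stieltjes_measure H.
have nu0E (s t : R) : s <= t -> nu0 `]s, t]%classic = (H t - H s)%:E.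
  move=> st; rewrite /nu0 /lebesgue_stieltjes_measure /measure_extension.
  rewrite measurable_mu_extE/=; last exact: is_ocitv.
  by rewrite wlength_itv_bnd.
have mab : measurable (`]a, b] : set (measurableTypeR R)) by exact: measurable_itv.
have nuoo : (nu0 `]a, b]%classic < +oo)%E by rewrite nu0E ?ltry// ltW.
pose nu := mfrestr mab nuoo.
have [] := @radon_nikodym_sigma_finite _ _ _ mu nu.
  apply/null_content_dominatesP => N mN N0.
  apply/eqP; rewrite eq_le measure_ge0 andbT; apply/lee_addgt0Pr => e e0; rewrite add0e.
  have [d d0 Hd] := acH e e0.
  have [|U [oU NU UN]] := @lebesgue_regularity_outer R N d mN _ d0; first by rewrite N0.
  have mU : measurable (U : set (measurableTypeR R)) by exact: measurable_realfun.open_measurable.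
  have Ud : (mu U < d%:E)%E.
    apply: le_lt_trans UN; rewrite -[leRHS]add0e -[X in (_ <= X + _)%E]N0.
    by rewrite -{1}(setDUK NU); apply: measureU2 => //; exact: measurableD.
  apply: (@le_trans _ _ (nu U)); first by apply: le_measure; rewrite ?inE.
  pose I := open_disjoint_itv oU.
  have [p Hp] := choice (fun q => open_interval_oc_hull ab
    (@open_disjoint_itv_open R U oU q) (@open_disjoint_itv_is_interval R U oU q)).
  have tI := @open_disjoint_itv_trivIset R U oU.
  have mI q : measurable (I q : set (measurableTypeR R)).
    by apply: measurable_realfun.open_measurable; exact: (@open_disjoint_itv_open R U oU q).
  have UI : U = \bigcup_q I q by exact: (open_disjoint_itv_bigcup oU).
  have part n : (\sum_(0 <= q < n) nu (I q) <= e%:E)%E.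
    apply: (@le_trans _ _ (\sum_(0 <= q < n) `|H (p q).2 - H (p q).1|)%:E).
      rewrite -sumEFin; apply: lee_sum => q _.
      have [/and3P[apq pq pb] _ _ sub] := Hp q.
      apply: (@le_trans _ _ (nu0 `](p q).1, (p q).2]%classic)).
        by apply: le_measure; rewrite ?inE//; exact: measurableI.
      by rewrite nu0E// lee_fin ler_norm.
    rewrite lee_fin -(big_map p xpredT (fun r => `|H r.2 - H r.1|)); apply: Hd.
      apply/andP; split.
        by apply/allP => _ /mapP[q _ ->]; have [] := Hp q.
      rewrite pairwise_map; apply/(pairwiseP 0%N) => i j.
      rewrite !inE size_iota subn0 => iN jN ij; rewrite !nth_iota ?subn0// !add0n /=.
      have [] := Hp i; have [] := Hp j.
      move=> /and3P[aj _ _] jj subj _ /and3P[ai _ _] ii subi _; apply/contraT => no.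
      have : I i `&` I j !=set0.
        have [x [xi xj]] := not_nonoverlap ii jj ai aj no.
        by exists x; split; [exact: subi|exact: subj].
      have /trivIsetP/(_ i j Logic.I Logic.I (negbT (ltn_eqF ij))) := tI.
      by move=> ->; case.
    rewrite big_map -lte_fin; apply: le_lt_trans Ud.
    apply: (@le_trans _ _ (\sum_(0 <= q < n) mu (I q))%E).
      rewrite -sumEFin; apply: lee_sum => q _; have [pq _ sub _] := Hp q.
      have pq' : (p q).1 <= (p q).2 by case/and3P: pq.
      apply: (@le_trans _ _ (mu `](p q).1, (p q).2[%classic)).
        by rewrite lebesgue_measure_itv/= lte_fin; case: ltP => // ?; rewrite lee_fin subr_le0.
      by apply: le_measure; rewrite ?inE//; exact: measurable_itv.
    rewrite UI measure_bigcup// (eq_eseriesl (Q := xpredT)); last by move=> q; rewrite in_setT.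
    exact: nneseries_lim_ge.
  apply: (@le_trans _ _ (\sum_(q <oo) nu (I q))%E).
    rewrite {1}UI; apply: measure_sigma_subadditive => //; exact: bigcupT_measurable.
  apply: lime_le; first exact: is_cvg_nneseries.
  exact: nearW.
move=> g [g0 gfin gint gE]; exists (fine \o g); split.
  by apply: eq_integrable gint => //= x _; rewrite /= fineK.
move=> t at_ tb.
have nuE : nu `]a, t]%classic = (H t - H a)%:E.
  rewrite -nu0E//; congr (nu0 _); apply: setIidl.
  by move=> x /=; rewrite !in_itv/= => /andP[->/=]/le_trans ->.
have gt : ((H t - H a)%:E = \int[mu]_(x in `]a, t]) g x)%E.
  by rewrite -nuE; apply: gE; exact: measurable_itv.
rewrite /Rintegral /=.
have -> : (\int[mu]_(x in `]a, t]) (fine (g x))%:E = \int[mu]_(x in `]a, t]) g x)%E.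
  by apply: eq_integral => x _; rewrite fineK.
by rewrite -gt.
Qed.

End density.

(** * Densities and derivatives of absolutely continuous functions *)

Section abs_continuous_FTC.
Context {R : realType}.
Local Notation mu := (@lebesgue_measure R).
Implicit Types (a b : R) (f h : R -> R).

Lemma eq_seq_ac a b f h : {in `[a, b], f =1 h} -> seq_ac a b f -> seq_ac a b h.
Proof.
move=> fh acf e e0; have [d d0 H] := acf e e0; exists d => // L fam Ld.
apply: le_trans (H L fam Ld); rewrite le_eqVlt; apply/orP; left; apply/eqP.
rewrite big_seq [RHS]big_seq; apply: eq_bigr => p pL.
have /and3P[ap pp pb] : sub_itv a b p by move: fam => /andP[/allP/(_ _ pL)].
by rewrite !fh // in_itv /= ?ap ?pb ?andbT ?(le_trans ap)//(le_trans pp).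
Qed.

(** Composition with the projection onto [a, b] makes [h] nondecreasing on the whole line, as a
    Stieltjes measure requires. The projection is 1-Lipschitz, so absolute continuity, applied to a
    single interval, gives right continuity. *)
Lemma nondecreasing_density a b h : a < b ->
  {in `[a, b] &, nondecreasing_fun h} -> seq_ac a b h ->
  exists g : R -> R, mu.-integrable setT (EFin \o g) /\
    forall t, a <= t -> t <= b -> h t - h a = \int[mu]_(x in `]a, t]) g x.
Proof.
move=> ab ndh ach; pose cl x := Num.max a (Num.min x b); pose H x := h (cl x).
have clin x : cl x \in `[a, b].
  rewrite in_itv /= /cl le_max lexx /= ge_max ge_min lexx orbT andbT; exact: ltW.
have clhomo x y : x <= y -> cl x <= cl y.
  by move=> xy; rewrite /cl; case: (leP x b) => xb; case: (leP y b) => yb;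
    rewrite !maxEle; do ?case: ifPn => ?; lra.
have clE x : a <= x -> x <= b -> cl x = x.
  by move=> ax xb; rewrite /cl (min_idPl xb) (max_idPr ax).
have HE : {in `[a, b], h =1 H}.
  by move=> x; rewrite in_itv/= => /andP[ax xb]; rewrite /H clE.
have acH : seq_ac a b H by exact: eq_seq_ac ach.
have cldist x y : x <= y -> cl y - cl x <= y - x.
  move=> xy; rewrite /cl; case: (leP x b) => xb; case: (leP y b) => yb.
  all: do ?[case: (leP a _) => ?]; try lra.

have Hnd : nondecreasing_fun H by move=> x y xy; apply: ndh; rewrite ?clin// clhomo.
have Hrc : right_continuous H.
  move=> x; apply/cvgrPdist_le => e e0.
  have [d d0 Hd] := ach e e0.
  near=> y; have xy : x <= y by near: y; exact: nbhs_right_ge.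
  have yd : y < x + d by near: y; apply: nbhs_right_lt; rewrite ltrDl.
  rewrite distrC; have := Hd [:: (cl x, cl y)]; rewrite !big_seq1; apply => /=.
    have := clin x; have := clin y; rewrite !in_itv /= => /andP[_ yb] /andP[xa _].
    by rewrite /itv_family /= /sub_itv /= xa yb clhomo.
  by have := cldist _ _ xy; lra.
pose Hc : cumulative R R := HB.pack H (isCumulative.Build R _ R H Hnd Hrc).
have [g [intg gE]] := @cumulative_density R a b Hc ab acH.
exists g; split => // t at_ tb; rewrite -gE //= /H !clE//; exact: ltW.
Unshelve. all: by end_near. Qed.

(** Jordan decomposition: the variation function V and V - f are both nondecreasing and absolutely
    continuous, and the density is the difference of theirs. *)
Theorem abs_continuous_density a b f : a < b -> abs_continuous a b f ->
  exists g : R -> R, mu.-integrable setT (EFin \o g) /\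
    forall t, a <= t -> t <= b -> f t = f a + \int[mu]_(x in `]a, t]) g x.
Proof.
move=> ab /abs_continuous_seq_ac acf.
pose V x := fine (total_variation a x f).
have acV : seq_ac a b V by exact: seq_ac_tv.
have Vfin x : a <= x -> x <= b -> total_variation a x f \is a fin_num.
  by move=> ax xb; exact: seq_ac_bounded_variation acf.
have Vinc x y : a <= x -> x <= y -> y <= b -> `|f y - f x| <= V y - V x.
  move=> ax xy yb; have fy := Vfin _ (le_trans ax xy) yb.
  rewrite /V; move: (fy); rewrite (total_variationD f ax xy) fin_numD => /andP[f1 f2].
  rewrite fineD// addrAC subrr add0r -lee_fin fineK//; exact: total_variation_ge.
have ndV : {in `[a, b] &, nondecreasing_fun V}.
  move=> x y; rewrite !in_itv/= => /andP[ax xb] /andP[ay yb] xy.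
  by rewrite -subr_ge0; apply: le_trans (Vinc _ _ ax xy yb).
have acN : seq_ac a b (fun x => - f x).
  move=> e e0; have [d d0 Hd] := acf e e0; exists d => // L Lf Ld.
  rewrite (eq_bigr (fun p => `|f p.2 - f p.1|)); first exact: Hd.
  by move=> p _; rewrite -opprD normrN.
have ndVf : {in `[a, b] &, nondecreasing_fun (fun x => V x + - f x)}.
  move=> x y; rewrite !in_itv/= => /andP[ax xb] /andP[ay yb] xy.
  have := Vinc _ _ ax xy yb; have := ler_norm (f y - f x); lra.
have [g1 [ig1 g1E]] := nondecreasing_density ab ndV acV.
have [g2 [ig2 g2E]] := nondecreasing_density ab ndVf (seq_acD acV acN).
exists (fun x => g1 x - g2 x); split; first exact: (integrableB _ ig1 ig2).
move=> t at_ tb; rewrite RintegralB//.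
- by rewrite -g1E// -g2E//; lra.
- exact: integrableS ig1.
- exact: integrableS ig2.
Qed.

(** Lebesgue differentiation of the primitive of [g], which agrees with [f] up to a constant near
    every interior point. *)
Lemma ae_is_derive_integral a b f g : a < b -> mu.-integrable setT (EFin \o g) ->
  (forall t, a <= t -> t <= b -> f t = f a + \int[mu]_(x in `]a, t]) g x) ->
  {ae mu, forall t, `]a, b[%classic t -> is_derive t 1 f (g t)}.
Proof.
move=> ab intg fE.
have intgI y : mu.-integrable `]a, y] (EFin \o g) by exact: integrableS intg.
have := @FTC1 R g (BRight a) intgI (open_integrable_locally openT intg).
apply: filterS; first exact: (ae_filter_ringOfSetsType mu).
move=> t + /=; rewrite in_itv/= => tF /andP[at_ tb].
have {tF} [dF F'] := tF at_.
apply: (@near_eq_is_derive _ _ _ (fun y => f a + \int[mu]_(x in `]a, y]) g x)).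
  near=> y; rewrite [RHS]fE //; apply: ltW; near: y.
    exact: lt_nbhsr.
  exact: lt_nbhsl.
rewrite -F' derive1E -[X in is_derive _ _ _ X]add0r.
apply: is_deriveD; exact: DeriveDef.
Unshelve. all: by end_near. Qed.

End abs_continuous_FTC.

(** * Test functions *)

Section smooth_functions.
Context {R : realType}.
Implicit Types (f g psi : R -> R) (p q : {poly R}).

Definition smooth f := forall n x, derivable (derive1n n f) x 1.

Lemma smooth_derivable f x : smooth f -> derivable f x 1.
Proof. by move=> /(_ 0%N x). Qed.

Lemma smooth_derive1 f : smooth f -> smooth (derive1 f).
Proof. by move=> sf n x; rewrite -derive1Sn; exact: sf. Qed.

Lemma smoothS f : (forall x, derivable f x 1) -> smooth (derive1 f) -> smooth f.
Proof. by move=> df sf [|n] x //; rewrite derive1Sn; exact: sf. Qed.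

Lemma smooth_continuous f : smooth f -> continuous f.
Proof.
by move=> sf x; apply/differentiable_continuous/derivable1_diffP/smooth_derivable.
Qed.

Lemma derive1nD n f g : smooth f -> smooth g ->
  derive1n n (fun x => f x + g x) = (fun x => derive1n n f x + derive1n n g x).
Proof.
elim: n f g => [//|n IH] f g sf sg; rewrite !derive1Sn -IH; last 2 first.
- exact: smooth_derive1.
- exact: smooth_derive1.
congr derive1n; apply/funext => x.
by rewrite !derive1E deriveD//; exact: smooth_derivable.
Qed.

Lemma smoothD f g : smooth f -> smooth g -> smooth (fun x => f x + g x).
Proof. by move=> sf sg n x; rewrite derive1nD//; apply: derivableD. Qed.

(** A class closed under derivation consists of smooth functions. Exhibiting such a class replaces
    explicit formulas for derivatives of order n. *)
Lemma smooth_ind (P : (R -> R) -> Prop) :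
  (forall f, P f -> (forall x, derivable f x 1) /\ P (derive1 f)) ->
  forall f, P f -> smooth f.
Proof.
by move=> H f Pf n; elim: n f Pf => [|n IH] f /H[df Pf'] x //; rewrite derive1Sn; exact: IH.
Qed.

(* Sums of products of smooth functions are stable under derivation. *)
Lemma smoothM f g : smooth f -> smooth g -> smooth (fun x => f x * g x).
Proof.
move=> sf sg; pose P h := exists L : seq ((R -> R) * (R -> R)),
  (forall a, List.In a L -> smooth a.1 /\ smooth a.2) /\
  h = (fun x => \sum_(a <- L) a.1 x * a.2 x).
apply: (@smooth_ind P); last first.
  exists [:: (f, g)]; split; first by move=> _ [<-|[]].
  by apply/funext => x; rewrite big_seq1.
move=> h [L [HL ->]].
suff : forall L : seq ((R -> R) * (R -> R)),
    (forall a, List.In a L -> smooth a.1 /\ smooth a.2) -> forall x : R,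
    is_derive x (1 : R) (fun x : R => \sum_(a <- L) a.1 x * a.2 x)
      (\sum_(a <- flatten [seq [:: (a.1, (derive1 a.2)); ((derive1 a.1), a.2)] | a <- L]) a.1 x * a.2 x).
  move=> D; split; first by move=> x; have [] := D _ HL x.
  exists (flatten [seq [:: (a.1, (derive1 a.2)); ((derive1 a.1), a.2)] | a <- L]); split.
    elim: L HL => [_ b []|a L IH HL b [<-|[<-|bL]]].
    - by have [s1 s2] := HL a (or_introl erefl); split; [exact: s1|exact: smooth_derive1].
    - by have [s1 s2] := HL a (or_introl erefl); split; [exact: smooth_derive1|exact: s2].
    - by apply: IH bL => c cL; apply: HL; right.
  by apply/funext => x; rewrite derive1E; have [_ ->] := D _ HL x.
elim=> [_ x|a {HL}L IH HL x].
  rewrite big_nil; under eq_fun do rewrite big_nil; exact: is_derive_cst.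
rewrite /= !big_cons addrA /=; under eq_fun do rewrite big_cons.
have [s1 s2] := HL a (or_introl erefl).
apply: is_deriveD; last by apply: IH => b bL; apply: HL; right.
have := @is_deriveM _ _ a.1 a.2 x 1 _ _ (derivableP (smooth_derivable (x := x) s1))
  (derivableP (smooth_derivable (x := x) s2)).
by rewrite /GRing.scale /= !derive1E [in X in _ -> is_derive _ _ _ X](mulrC _ (a.2 x)).
Qed.

Lemma smooth_cst c : smooth (fun=> c).
Proof.
apply: (@smooth_ind (fun f => exists c, f = fun=> c)); last by exists c.
move=> _ [d ->]; split => [x|]; first exact: derivable_cst.
by exists 0; apply/funext => x; rewrite derive1_cst.
Qed.

Lemma smooth_affine f a b : smooth f -> smooth (fun x => f (a * x + b)).
Proof.
move=> sf.
apply: (@smooth_ind (fun h => exists c f, smooth f /\ h = fun x => c * f (a * x + b))); last first.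
  by exists 1, f; split => //; apply/funext => x; rewrite mul1r.
move=> _ [c [{sf}f [sf ->]]].
have D (x : R) : is_derive x (1 : R) (fun x : R => c * f (a * x + b)) (c * a * (derive1 f) (a * x + b)).
  have d1 : is_derive x (1 : R) (fun x : R => a * x + b) a.
    have h1 : is_derive x (1 : R) (fun x : R => a *: x) (a *: (1 : R)).
      exact: (@is_deriveZ _ _ _ (@id R)).
    have h2 : is_derive x (1 : R) (fun _ : R => b) 0 by exact: is_derive_cst.
    by have := is_deriveD h1 h2; rewrite addr0 /GRing.scale /= mulr1.
  have d2 : is_derive (a * x + b) 1 f ((derive1 f) (a * x + b)).
    by rewrite derive1E; exact: (derivableP (smooth_derivable (x := a * x + b) sf)).
  have := @is_derive1_comp _ f (fun x => a * x + b) x _ _ d2 d1.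
  by move=> /(@is_deriveZ _ _ _ _ c); rewrite /GRing.scale /= => h; rewrite -mulrA (mulrC a).
split; first by move=> x; have [] := D x.
exists (c * a), (derive1 f); split; first exact: smooth_derive1.
by apply/funext => x; rewrite derive1E; have [_ ->] := D x.
Qed.

End smooth_functions.

(** * Flat functions and smooth bumps *)

Section flat_functions.
Context {R : realType}.
Implicit Types (P : {poly R}).

(** The polynomial factor closes the family under derivation: the derivative of P(1/x) exp(-1/x) is
    x^(-2) (P - P')(1/x) exp(-1/x). *)
Definition flat P (x : R) : R := if 0 < x then P.[x^-1] * expR (- x^-1) else 0.

Lemma exprn_le_expR n (y : R) : 0 <= y -> y ^+ n <= n`!%:R * expR y.
Proof.
case: n => [|n] y0; first by rewrite expr0 fact0 mul1r -expR0 ler_expR.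
have := expR_ge1Dxn n y0; have f0 : 0 < n.+1`!%:R :> R by rewrite ltr0n fact_gt0.
by move=> H; rewrite mulrC -ler_pdivrMr//; apply: le_trans H; rewrite lerDr.
Qed.

Lemma horner_le_expR P : exists C, forall y, 0 <= y -> `|P.[y]| <= C * expR y.
Proof.
(* Carrying the factor y^k makes the induction go through: the step from P to P X + c raises k by
   one. *)
suff H k : exists C, forall y, 0 <= y -> `|y ^+ k * P.[y]| <= C * expR y.
  by have [C HC] := H 0%N; exists C => y y0; have := HC y y0; rewrite expr0 mul1r.
elim/poly_ind: P k => [|P c IH] k.
  by exists 0 => y _; rewrite horner0 mulr0 normr0 mul0r.
have [C HC] := IH k.+1; exists (C + k`!%:R * `|c|) => y y0.
rewrite hornerMXaddC mulrDr mulrDl (le_trans (ler_normD _ _))// lerD//.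
  by have := HC y y0; rewrite exprSr -mulrA (mulrC y).
rewrite normrM mulrAC ler_wpM2r// ger0_norm ?exprn_ge0//; exact: exprn_le_expR.
Qed.

Lemma flat_is_derive P (x : R) : is_derive x (1 : R) (flat P) (flat ('X^2 * (P - P^`())) x).
Proof.
have [x0|x0|->] := ltgtP x 0.
- rewrite [X in is_derive _ _ _ X](_ : _ = 0); last by rewrite /flat ltNge (ltW x0).
  apply: (@near_eq_is_derive _ _ _ (fun=> 0)).
  near=> y; rewrite /flat ltNge ltW//=; near: y; exact: lt_nbhsl.
- rewrite [X in is_derive _ _ _ X](_ : _ = ('X^2 * (P - P^`())).[x^-1] * expR (- x^-1)); last by rewrite /flat x0.
  apply: (@near_eq_is_derive _ _ _ (fun x : R => P.[x^-1] * expR (- x^-1))).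
    by near=> y; rewrite /flat ifT//; near: y; exact: lt_nbhsr.
  have d1 : is_derive x (1 : R) (fun x : R => x^-1) (- x ^- 2).
    have := @is_deriveV _ id x 1 1 (lt0r_neq0 x0) (is_derive_id _ _).
    by rewrite /GRing.scale /= mulr1.
  have d2 : is_derive x (1 : R) (fun x : R => P.[x^-1]) (P^`().[x^-1] * - x ^- 2).
    exact: (@is_derive1_comp _ (horner P) (fun x : R => x^-1)).
  have d3 : is_derive x (1 : R) (fun x : R => expR (- x^-1)) (expR (- x^-1) * x ^- 2).
    have := is_deriveN d1; rewrite opprK => d4.
    exact: (@is_derive1_comp _ expR (fun x : R => - x^-1)).
  have := is_deriveM d2 d3; rewrite /GRing.scale /=.
  move=> h; apply: is_derive_eq h _.
  rewrite !hornerE /= exprVn; ring.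
(* At 0, the exponential bound for X^2 P instead of P supplies two spare powers of h, so the
   difference quotient is O(h). *)
- rewrite [X in is_derive _ _ _ X](_ : _ = 0); last by rewrite /flat ltxx.
  have [C HC] := horner_le_expR ('X^2 * P).
  have C0 : 0 <= C.
    by have := HC 0 (lexx _); rewrite expR0 mulr1; apply: le_trans.
  have b h : `|h^-1 * flat P h| <= C * `|h|.
    rewrite /flat; case: ifP => h0; last by rewrite mulr0 normr0 mulr_ge0.
    have := HC h^-1; rewrite invr_ge0 ltW// => /(_ isT).
    rewrite -(ler_pM2r (mulr_gt0 h0 (expR_gt0 (- h^-1)))) => H.
    rewrite (gtr0_norm h0); apply: le_trans (le_trans H _); last first.
      rewrite [leLHS](_ : _ = C * h * (expR h^-1 * expR (- h^-1))); last by ring.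
      by rewrite -expRD subrr expR0 mulr1.
    rewrite -(gtr0_norm (mulr_gt0 h0 (expR_gt0 _))) -normrM le_eqVlt.
    apply/orP; left; apply/eqP; congr (`|_|); rewrite !hornerE /=; field; exact: lt0r_neq0.
  have cv : (fun h : R => h^-1 *: (flat P (h *: (1 : R) + 0) - flat P 0)) @ 0^' --> (0 : R).
    apply/cvgrPdist_le => e e0; near=> h.
    rewrite sub0r normrN /GRing.scale /= mulr1 addr0 {2}/flat ltxx subr0.
    apply: le_trans (b h) _.
    rewrite (@le_trans _ _ ((C + 1) * `|h|))// ?ler_wpM2r//; first lra.
    rewrite mulrC -ler_pdivlMr; last lra.
    near: h; apply: dnbhs0_le; rewrite divr_gt0//; lra.
  apply: DeriveDef; first by apply/cvg_ex; exists 0; exact: cv.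
  exact/cvg_lim.
Unshelve. all: by end_near. Qed.

Lemma smooth_flat P : smooth (flat P).
Proof.
apply: (@smooth_ind _ (fun f => exists P, f = flat P)); last by exists P.
move=> _ [{}P ->]; split; first by move=> x; have [] := flat_is_derive P x.
exists ('X^2 * (P - P^`())); apply/funext => x.
by rewrite derive1E; have [_ ->] := flat_is_derive P x.
Qed.

(** On ]a, b[ this is exp(-1/(n (x - a))) exp(-1/(n (b - x))), which tends to 1; elsewhere it is 0.
    The arguments are expanded into the affine shape of [smooth_affine]. *)
Definition bump (a b : R) (n : nat) (x : R) : R :=
  flat 1 (n%:R * x + - (n%:R * a)) * flat 1 (- n%:R * x + n%:R * b).

Lemma smooth_bump a b n : smooth (bump a b n).
Proof. by apply: smoothM; apply: smooth_affine; exact: smooth_flat. Qed.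

Lemma flat1_itv (x : R) : 0 <= flat 1 x <= 1.
Proof.
rewrite /flat; case: ifPn => x0; last by rewrite lexx ler01.
rewrite hornerC mul1r expR_ge0 /= -expR0 ler_expR oppr_le0 invr_ge0; exact: ltW.
Qed.

Lemma bump_itv a b n x : 0 <= bump a b n x <= 1.
Proof.
have /andP[h1 h2] := flat1_itv (n%:R * x + - (n%:R * a)).
have /andP[h3 h4] := flat1_itv (- n%:R * x + n%:R * b).
by rewrite /bump mulr_ge0//= mulr_ile1.
Qed.

Lemma bump_out a b n x : ~ `]a, b[%classic x -> bump a b n x = 0.
Proof.
rewrite /= in_itv/= => /negP; rewrite negb_and -!leNgt => /orP[] h; rewrite /bump.
  by rewrite {1}/flat ifF ?mul0r//; apply/negbTE; rewrite -leNgt -mulrBr mulr_ge0_le0// subr_le0.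
rewrite {2}/flat ifF ?mulr0//; apply/negbTE.
by rewrite -leNgt mulNr addrC -mulrBr mulr_ge0_le0// subr_le0.
Qed.

Lemma bump_gt0 a b n x : (0 < n)%N -> `]a, b[%classic x -> 0 < bump a b n x.
Proof.
rewrite /= in_itv/= => n0 /andP[ax xb]; have n0' : 0 < n%:R :> R by rewrite ltr0n.
rewrite /bump /flat !ifT ?hornerC ?mul1r ?mulr_gt0 ?expR_gt0//.
  by rewrite mulNr addrC -mulrBr mulr_gt0// subr_gt0.
by rewrite -mulrBr mulr_gt0// subr_gt0.
Qed.

Lemma cvg_bump a b x : bump a b n x @[n --> \oo] --> (\1_(`]a, b[) x : R).
Proof.
rewrite indicE; case: (boolP (x \in _)) => xab; last first.
  apply: cvg_near_cst; near=> n; apply: bump_out => /mem_set h.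
  by rewrite h in xab.
move: xab; rewrite inE /= in_itv/= => /andP[ax xb].
have aux d : 0 < d -> flat 1 (n%:R * d) @[n --> \oo] --> (1 : R).
  move=> d0.
  have : expR (- (n%:R * d)^-1) @[n --> \oo] --> expR (- (0 : R)).
    apply: continuous_cvg; first exact: continuous_expR.
    apply: cvgN; apply/(gtr0_cvgV0 (f := fun n : nat => n%:R * d)).
      by near=> n; rewrite mulr_gt0// ltr0n; near: n; exact: nbhs_infty_gt.
    by apply/cvgryPge => A; near=> n; rewrite -ler_pdivrMr//; near: n; exact: nbhs_infty_ger.
  rewrite oppr0 expR0; apply: cvg_trans; apply: near_eq_cvg; near=> n.
  have nd : 0 < n%:R * d by rewrite mulr_gt0// ltr0n; near: n; exact: nbhs_infty_gt.
  by rewrite /flat nd hornerC mul1r.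
rewrite -[X in _ --> X]mulr1; apply: cvgM.
  rewrite (_ : (fun n => _) = (fun n : nat => flat 1 (n%:R * (x - a)))).
    by apply: aux; rewrite subr_gt0.
  by apply/funext => n; rewrite mulrBr.
rewrite (_ : (fun n => _) = (fun n : nat => flat 1 (n%:R * (b - x)))).
  by apply: aux; rewrite subr_gt0.
by apply/funext => n; rewrite mulrBr mulNr addrC.
Unshelve. all: by end_near. Qed.

End flat_functions.

Section test_functions.
Context {R : realType}.
Local Notation mu := (@lebesgue_measure R).
Local Notation RR := (measurableTypeR R).
Variables (l r : R).
Hypothesis lr : l < r.
Local Notation D := (`]l, r[%classic : set R).
Implicit Types (psi chi p q : R -> R).

(** An interval at positive distance from the ends is easier to enlarge and to combine than an
    arbitrary compact set; it is found halfway between the extrema of the compact set and the ends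
    of [D]. *)
Lemma test_functionP psi : test_function D psi <->
  smooth psi /\ exists a b, [/\ l < a, a < b, b < r &
    forall x, ~ `]a, b[%classic x -> psi x = 0].
Proof.
split=> [[sm [K [cK KD K0]]]|[sm [a [b [la ab br h]]]]]; last first.
  split => //; exists `[a, b]%classic; split.
  - exact: segment_compact.
  - move=> x /=; rewrite !in_itv/= => /andP[ax xb].
    by rewrite (lt_le_trans la ax) (le_lt_trans xb br).
  - move=> x xab; apply: h => /=; apply: contra_not xab => /=.
    by rewrite !in_itv/= => /andP[/ltW -> /ltW ->].
split => //.
have [K00|/set0P KN0] := eqVneq K set0.
  have lr' := lr; exists ((l + (l + r) / 2) / 2), (((l + r) / 2 + r) / 2); split; [lra..|].
  by move=> x _; apply: K0; rewrite K00.
have cid : {within K, continuous (@id R)} by apply: continuous_subspaceT => x; exact: cvg_id.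
have [c2 Kc2 H2] := compact_EVT_max KN0 cK cid.
have [c1 Kc1 H1] := compact_EVT_min KN0 cK cid.
have := KD _ (set_mem Kc1); have := KD _ (set_mem Kc2); rewrite /= !in_itv/= => /andP[lc2 c2r] /andP[lc1 c1r].
have c12 : c1 <= c2 by exact: H1.
exists ((l + c1) / 2), ((c2 + r) / 2); split; [lra..|].
move=> x xab; apply: K0 => Kx; apply: xab; rewrite /= in_itv/=.
by have := H1 _ (mem_set Kx); have := H2 _ (mem_set Kx); rewrite /=; lra.
Qed.

Lemma test_function_bump a b n : l < a -> a < b -> b < r -> test_function D (bump a b n).
Proof.
move=> la ab br; apply/test_functionP; split; first exact: smooth_bump.
by exists a, b; split => // x; exact: bump_out.
Qed.

Lemma test_function_derive1 psi : test_function D psi -> test_function D (derive1 psi).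
Proof.
move=> /test_functionP[sm [a [b [la ab br h]]]]; apply/test_functionP; split.
  exact: smooth_derive1.
(* At [a] and [b] the function is only known to vanish on one side. Outside a larger interval it
   vanishes in a whole neighbourhood. *)
have [a' /andP[la' a'a]] : exists a', l < a' < a.
  by exists ((l + a) / 2); lra.
have [b' /andP[bb' b'r]] : exists b', b < b' < r.
  by exists ((r + b) / 2); lra.
exists a', b'; split => //; first by lra.
move=> x; rewrite /= in_itv/= => /negP; rewrite negb_and -!leNgt => xab.
rewrite derive1E (near_eq_derive _ (g := fun=> 0)) ?derive_cst//.
near=> y; apply: h; rewrite /= in_itv/= => /andP[ay yb].
have : `|x - y| < Num.min (a - a') (b' - b).
  near: y; apply: cvgr_dist_lt; first exact: cvg_id.
  by rewrite lt_min !subr_gt0 a'a bb'.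
rewrite lt_min => /andP[]; rewrite !ltr_norml => /andP[h1 h2] /andP[h3 h4].
case/orP: xab; lra.
Unshelve. all: by end_near. Qed.

Lemma test_function_lin c psi chi : test_function D psi -> test_function D chi ->
  test_function D (fun x => psi x + c * chi x).
Proof.
move=> /test_functionP[s1 [a [b [la ab br h]]]] /test_functionP[s2 [a' [b' [la' ab' br' h']]]].
apply/test_functionP; split.
  by apply: (smoothD s1); apply: (smoothM _ s2); exact: smooth_cst.
exists (Num.min a a'), (Num.max b b'); split.
- by rewrite lt_min la.
- by rewrite gt_min lt_max ab.
- by rewrite gt_max br.
move=> x; rewrite /= in_itv/= gt_min lt_max => xab; rewrite h ?h' ?mulr0 ?addr0//=.
- by rewrite in_itv/= => /andP[h1 h2]; apply: xab; rewrite h1 h2 !orbT.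
- by rewrite in_itv/= => /andP[h1 h2]; apply: xab; rewrite h1 h2.
Qed.

Lemma test_function_bounded psi : test_function D psi -> exists M, forall x, `|psi x| <= M.
Proof.
move=> /test_functionP[sm [a [b [la ab br h]]]].
have cn : {within `[a, b], continuous (fun x => `|psi x|)}.
  apply: continuous_subspaceT => x; apply: continuous_comp; last exact: norm_continuous.
  exact: smooth_continuous.
have [c cab H] := EVT_max (ltW ab) cn; exists `|psi c| => x.
case: (pselect (x \in `]a, b[)) => xab.
  by apply: H; move: xab; rewrite !in_itv/= => /andP[/ltW-> /ltW->].
by rewrite h// normr0.
Qed.

Lemma test_function_integrableM p psi : mu.-integrable D (EFin \o p) ->
  test_function D psi -> mu.-integrable D (EFin \o (fun x => p x * psi x)).
Proof.
move=> ip tpsi; have [M HM] := test_function_bounded tpsi.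
have mpsi : measurable_fun D psi.
  apply: measurable_funTS; apply: continuous_measurable_fun; apply: smooth_continuous.
  by case/test_functionP: tpsi.
have bpsi : [bounded psi x | x in D].
  exists M; split; first exact: num_real.
  by move=> N MN x _; apply: le_trans (HM x) _; exact: ltW.
have mD : measurable (D : set RR) by exact: measurable_itv.
by have := integrableMl mD ip mpsi bpsi.
Qed.

Lemma integrable_test_function psi : test_function D psi ->
  mu.-integrable D (EFin \o psi).
Proof.
move=> tpsi; have [M HM] := test_function_bounded tpsi.
apply: measurable_bounded_integrable => //.
- by rewrite /= lebesgue_measure_itv/= lte_fin lr ltry.
- apply: measurable_funTS; apply: continuous_measurable_fun; apply: smooth_continuous.
  by case/test_functionP: tpsi.
- exists M; split; first exact: num_real.
  by move=> N MN x _; apply: le_trans (HM x) _; exact: ltW.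
Qed.

(** The bumps converge to the indicator of ]a, b[ with values in [0, 1], so |p| dominates. *)
Lemma test_function_orthogonal_itv p a b : mu.-integrable D (EFin \o p) ->
  (forall psi, test_function D psi -> \int[mu]_(x in D) (p x * psi x) = 0) ->
  l < a -> a < b -> b < r -> \int[mu]_(x in `]a, b[) p x = 0.
Proof.
move=> ip ort la ab br.
have mD : measurable (D : set RR) by exact: measurable_itv.
have mp := integrable_Rintegral_le ip.
have sub : `]a, b[ `<=` D.
  by move=> x /=; rewrite !in_itv/= => /andP[h1 h2]; rewrite (lt_trans la h1) (lt_trans h2 br).
have [] := @dominated_convergence _ _ _ mu D mD
  (fun n x => (p x * bump a b n x)%:E) (fun x => (p x * \1_(`]a, b[) x)%:E)
  (fun x => `|(p x)%:E|%E).
- by move=> n; apply: measurable_int (test_function_integrableM ip (test_function_bump n la ab br)).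
- by apply/measurable_EFinP; apply: measurable_funM => //; exact: measurable_indic.
- by apply: aeW => x _; apply: cvg_EFin; [exact: nearW|apply: cvgMr; exact: cvg_bump].
- exact: integrable_abse.
- apply: aeW => x n _; rewrite lee_fin normrM ler_piMr//.
  by have /andP[h1 h2] := bump_itv a b n x; rewrite ger0_norm.
move=> _ _; rewrite (_ : (fun n => _) = (fun=> 0%E)); last first.
  apply/funext => n; have := ort _ (test_function_bump n la ab br).
  rewrite /Rintegral => h; rewrite -[LHS]fineK ?h//.
  by apply: integrable_fin_num => //; exact: (test_function_integrableM ip (test_function_bump n la ab br)).
move=> /cvg_lim; rewrite lim_cst// => /(_ (@ereal_hausdorff R)) h.
rewrite -(setIidr sub) Rintegral_mkcondr /Rintegral.
rewrite (_ : (\int[mu]_(x in D) ((p \_ `]a, b[) x)%:E)%E =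
    (\int[mu]_(x in D) (p x * \1_(`]a, b[) x)%:E)%E) -?h//.
by rewrite h; apply: eq_integral => x _; rewrite patchE indicE; case: ifP; rewrite ?mulr1 ?mulr0.
Qed.

(** Integrate from minus infinity; the mean value zero is exactly what makes the primitive vanish
    again to the right of the support. *)
Lemma test_function_primitive theta : test_function D theta ->
  \int[mu]_(x in D) theta x = 0 ->
  exists Theta, test_function D Theta /\ derive1 Theta = theta.
Proof.
move=> tt; have it := integrable_test_function tt.
case/test_functionP: (tt) => sm [a [b [la ab br h]]] t0.
have eT : theta = theta \_ D.
  apply/funext => x; rewrite patchE; case: ifPn => // xD; apply: h.
  apply: contraNnot xD; rewrite !inE/= !in_itv/= => /andP[h1 h2].
  by rewrite (lt_trans la h1) (lt_trans h2 br).
have iT : mu.-integrable setT (EFin \o theta).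
  have mD : measurable (D : set RR) by exact: measurable_itv.
  rewrite eT; have := (integrable_mkcond _ mD).1 it.
  by apply: eq_integrable => // x _; rewrite /= !patchE; case: ifP.
pose Th x := \int[mu]_(t in `]-oo, x]) theta t.
have dTh x : derivable Th x 1 /\ derive1 Th x = theta x.
  have x1 : x < x + 1 by rewrite ltrDl.
  apply: (continuous_FTC1 x1) => //.
  - exact: integrableS iT.
  - by rewrite ltNyr.
  - exact: smooth_continuous.
have dTh' : derive1 Th = theta by apply/funext => x; have [] := dTh x.
exists Th; split => //; apply/test_functionP; split.
  by apply: smoothS; [move=> x; have [] := dTh x|rewrite dTh'].
exists a, b; split => // x; rewrite /= in_itv/= => /negP; rewrite negb_and -!leNgt => /orP[xa|bx].
  transitivity (\int[mu]_(t in `]-oo, x]) (0 : R)); last by rewrite /Rintegral integral0.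
  apply: eq_Rintegral => y; rewrite inE/= in_itv/= => yx; apply: h.
  rewrite /= in_itv/= => /andP[ay _].
  by have := lt_le_trans ay (le_trans yx xa); rewrite ltxx.
rewrite -t0 /Th Rintegral_mkcond [RHS]Rintegral_mkcond -eT; apply: eq_Rintegral => y _.
rewrite patchE; case: ifPn => // yx; rewrite h//=.
apply: contraNnot yx; rewrite inE/= !in_itv/= => /andP[_ yb]; exact: ltW (lt_le_trans yb bx).
Qed.

Lemma test_function_mean_one : exists chi, test_function D chi /\ \int[mu]_(x in D) chi x = 1.
Proof.
have lr' := lr; pose a := (l + (l + r) / 2) / 2; pose b := ((l + r) / 2 + r) / 2.
have la : l < a by rewrite /a; lra.
have ab : a < b by rewrite /a /b; lra.
have br : b < r by rewrite /b; lra.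
pose B := bump a b 1; have tB : test_function D B by exact: test_function_bump.
have iB := integrable_test_function tB.
have B0 x : 0 <= B x by have /andP[] := bump_itv a b 1 x.
(* A vanishing integral would force the nonnegative bump to vanish almost everywhere, yet it is
   positive on an interval of positive length. *)
have Ipos : \int[mu]_(x in D) B x != 0.
  apply/eqP => I0.
  have mD : measurable (D : set RR) by exact: measurable_itv.
  have : (\int[mu]_(x in D) `|(B x)%:E| = 0)%E.
    rewrite (_ : (\int[mu]_(x in D) `|(B x)%:E| = \int[mu]_(x in D) (B x)%:E)%E).
      rewrite -[LHS]fineK; first by move: I0; rewrite /Rintegral /= => ->.
      exact: (integrable_fin_num mD iB).
    by apply: eq_integral => x _; rewrite gee0_abs// lee_fin.
  move/(ae_eq_integral_abs mu mD (measurable_int _ iB)).1 => [N [mN N0 sN]].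
  have : (mu `]a, b[%classic <= mu N)%E.
    have mI : measurable (`]a, b[%classic : set RR) by exact: measurable_itv.
    apply: le_measure; rewrite ?inE//.
    move=> x xab; apply: sN => /= => H.
    have : (B x)%:E = 0%E.
      apply: H; move: xab; rewrite /= !in_itv/= => /andP[h1 h2].
      by rewrite (lt_trans la h1) (lt_trans h2 br).
    move=> BE; have B0' : B x = 0 by case: BE.
    by have := bump_gt0 (n := 1) isT xab; rewrite -/B B0' ltxx.
  by rewrite N0 lebesgue_measure_itv/= lte_fin ab -EFinB lee_fin leNgt subr_gt0 ab.
exists (fun x => 0 + (\int[mu]_(x in D) B x)^-1 * B x); split.
  apply: (@test_function_lin _ (fun=> 0)) => //; apply/test_functionP; split.
    exact: smooth_cst.
  by exists a, b.
under eq_Rintegral do rewrite add0r.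
by rewrite RintegralZl// mulVf.
Qed.

End test_functions.

(** * Integral representation of H^2 functions with zero Cauchy data *)

Section weak_second_derivative.
Context {R : realType}.
Local Notation mu := (@lebesgue_measure R).
Local Notation RR := (measurableTypeR R).

Lemma smooth_FTC (psi : R -> R) (s t : R) : smooth psi -> s < t ->
  psi t = psi s + \int[mu]_(x in `]s, t[) derive1 psi x.
Proof.
move=> sm st.
have cd := smooth_continuous (smooth_derive1 sm).
have cp := smooth_continuous sm.
have dp : derivable_oo_LRcontinuous psi s t.
  split.
  - by move=> x _; exact: smooth_derivable.
  - exact: cvg_at_right_filter (cp s).
  - exact: cvg_at_left_filter (cp t).
have h := continuous_FTC2 st (continuous_subspaceT cd) dp (fun _ _ => erefl).
rewrite (_ : \int[mu]_(x in `]s, t[) derive1 psi x = psi t - psi s); first by lra.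
rewrite /Rintegral -(@integral_itv_bndoo _ s t _ true false)//.
  by rewrite h.
by apply/measurable_EFinP; apply: measurable_funTS; exact: continuous_measurable_fun.
Qed.

Variables (l r : R).
Hypothesis lr : l < r.
Local Notation D := (`]l, r[%classic : set R).

Let mD : measurable (D : set RR). Proof. exact: measurable_itv. Qed.

Lemma test_function_ends psi : test_function D psi -> psi l = 0 /\ psi r = 0.
Proof.
move=> /test_functionP[] // _ [a [b [la ab br h]]]; split; apply: h => /=; rewrite in_itv/=.
  by rewrite ltNge (ltW la).
by rewrite andbC ltNge (ltW br).
Qed.

(** By continuity w(x) is the derivative at x of a primitive that is constant near x. *)
Lemma continuous_integral_itv0 (w : R -> R) : mu.-integrable D (EFin \o w) ->
  (forall x, D x -> {for x, continuous w}) ->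
  (forall a b, l < a -> a < b -> b < r -> \int[mu]_(x in `]a, b[) w x = 0) ->
  forall x, D x -> w x = 0.
Proof.
move=> iw cw w0 x Dx; move: (Dx); rewrite /= in_itv/= => /andP[lx xr].
pose a := (l + x) / 2; pose b := (x + r) / 2.
have la : l < a by rewrite /a; lra.
have ax : a < x by rewrite /a; lra.
have xb : x < b by rewrite /b; lra.
have br : b < r by rewrite /b; lra.
have subD (c d : R) : l < c -> d < r -> `]c, d] `<=` D.
  move=> lc dr y /=; rewrite !in_itv/= => /andP[cy yd].
  by rewrite (lt_trans lc cy) (le_lt_trans yd dr).
have iwab : mu.-integrable `]a, b] (EFin \o w) by apply: integrableS iw => //; exact: subD.
have [_ <-] := continuous_FTC1 xb iwab ax (cw _ Dx).
rewrite derive1E (near_eq_derive _ (g := fun=> 0)) ?derive_cst//.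
near=> y.
have ay : a < y by near: y; exact: lt_nbhsr.
have yr : y < r by near: y; exact: lt_nbhsl.
rewrite -Rintegral_itv_bndo_bndc; first exact: w0.
apply: integrableS iw => //; apply: subset_trans (subD _ _ la yr).
by move=> z /=; rewrite !in_itv/= => /andP[-> /ltW].
Unshelve. all: by end_near. Qed.

(** The du Bois-Reymond argument, applied twice. A test function minus its mean times [chi] is the
    derivative of a test function, so the hypothesis on second derivatives determines the pairing of
    [q] with first derivatives, and that in turn determines [q]. *)
Lemma weak_second_derivative0_affine (q : R -> R) : mu.-integrable D (EFin \o q) ->
  (forall x, D x -> {for x, continuous q}) ->
  (forall psi, test_function D psi ->
     \int[mu]_(x in D) (q x * derive1 (derive1 psi) x) = 0) ->
  exists A B, forall x, D x -> q x = A * x + B.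
Proof.
move=> iq cq q0.
have iqt := fun psi => @test_function_integrableM R l r lr q psi iq.
have [chi [tchi chi1]] := test_function_mean_one lr.
have ichi := integrable_test_function lr tchi.
have centre psi : test_function D psi -> exists Theta, test_function D Theta /\
    derive1 Theta = (fun x => psi x + (- \int[mu]_(x in D) psi x) * chi x).
  move=> tpsi; apply: test_function_primitive => //; first exact: test_function_lin.
  have ip := integrable_test_function lr tpsi.
  rewrite RintegralD//; last exact: (integrableZl mD _ ichi).
  by rewrite RintegralZl// chi1 mulr1 subrr.
(* The weak derivative of [q] will be the constant [- A], so that of [w1] below is zero. *)
pose A := \int[mu]_(x in D) (q x * derive1 chi x).
have q1 psi : test_function D psi ->
    \int[mu]_(x in D) (q x * derive1 psi x) = (\int[mu]_(x in D) psi x) * A.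
  move=> tpsi; have [Th [tTh dTh]] := centre _ tpsi.
  have := q0 _ tTh; rewrite dTh.
  set m := \int[mu]_(x in D) psi x.
  have -> : derive1 (fun x => psi x + - m * chi x) = (fun x => derive1 psi x + - m * derive1 chi x).
    apply/funext => x; rewrite !derive1E.
    have /test_functionP[//|sp _] := tpsi; have /test_functionP[//|sc _] := tchi.
    have dc := smooth_derivable (x := x) sc.
    rewrite deriveD; last 2 first.
    - exact: smooth_derivable.
    - by apply: (@derivableZ _ _ _ chi).
    by rewrite (@deriveZ _ _ _ chi).
  have i1 := iqt _ (test_function_derive1 lr tpsi).
  have i2 := iqt _ (test_function_derive1 lr tchi).
  under eq_Rintegral do rewrite mulrDr mulrCA.
  rewrite RintegralD//; last exact: (integrableZl mD _ i2).
  rewrite RintegralZl// -/A; lra.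
have iD1 : mu.-integrable D (EFin \o cst 1).
  apply: measurable_bounded_integrable => //.
    by rewrite /= lebesgue_measure_itv/= lte_fin lr ltry.
  by exists 1; split; [exact: num_real|move=> N MN x _; rewrite /= normr1 ltW].
have iid : mu.-integrable D (EFin \o (@id R)).
  apply: measurable_bounded_integrable => //.
    by rewrite /= lebesgue_measure_itv/= lte_fin lr ltry.
  exists (`|l| + `|r|); split; first exact: num_real.
  move=> N MN x; rewrite /= in_itv/= => /andP[lx xr]; apply: le_trans (ltW MN).
  by have := normr_ge0 l; have := normr_ge0 r; have := ler_norm r; have := ler_norm (- l); rewrite normrN ler_norml; lra.
have xpsi psi : test_function D psi ->
    \int[mu]_(x in D) (x * derive1 psi x) = - \int[mu]_(x in D) psi x.
  move=> tpsi; have [pl pr] := test_function_ends tpsi.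
  have /test_functionP[//|sp _] := tpsi.
  have := @integration_by_parts_density R l r psi (derive1 psi) id (cst 1) lr
    (integrable_test_function lr (test_function_derive1 lr tpsi)) iD1 _ _.
  rewrite pl pr !mul0r subrr sub0r => h.
  under eq_Rintegral do rewrite mulrC.
  rewrite h.
  - by congr (- _); apply: eq_Rintegral => x _; rewrite mulr1.
  - by move=> t lt tr; rewrite -pl; exact: smooth_FTC.
  - move=> t lt tr; rewrite Rintegral_cst; last exact: measurable_itv.
    by rewrite mul1r /= lebesgue_measure_itv/= lte_fin lt /=; lra.
pose w1 x := q x + A * x.
have iw1 : mu.-integrable D (EFin \o w1).
  exact: (integrableD mD iq (integrableZl mD A iid)).
have iw1t := fun psi => @test_function_integrableM R l r lr w1 psi iw1.
have w10 psi : test_function D psi -> \int[mu]_(x in D) (w1 x * derive1 psi x) = 0.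
  move=> tpsi; have t' := test_function_derive1 lr tpsi.
  have i1 := iqt _ t'.
  have i2 := test_function_integrableM lr iid t'.
  rewrite /w1; under eq_Rintegral do rewrite mulrDl -mulrA.
  rewrite RintegralD//; last exact: (integrableZl mD A i2).
  by rewrite RintegralZl// q1// xpsi// mulrN mulrC subrr.
pose B := \int[mu]_(x in D) (w1 x * chi x).
have w1B psi : test_function D psi ->
    \int[mu]_(x in D) ((w1 x - B) * psi x) = 0.
  move=> tpsi; have [Th [tTh dTh]] := centre _ tpsi.
  have := w10 _ tTh; rewrite dTh.
  have ip := integrable_test_function lr tpsi.
  have i1 := iw1t _ tpsi.
  have i2 := iw1t _ tchi.
  under eq_Rintegral do rewrite mulrDr mulrCA.
  rewrite RintegralD//; last exact: (integrableZl mD _ i2).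
  rewrite RintegralZl// -/B => h.
  under eq_Rintegral do rewrite mulrDl mulNr -mulrN.
  under eq_Rintegral do rewrite mulrN -mulNr.
  rewrite RintegralD//; last exact: (integrableZl mD _ ip).
  rewrite RintegralZl//; lra.
exists (- A), B => x Dx.
have iwB : mu.-integrable D (EFin \o (fun x => w1 x - B)).
  by have := integrableB mD iw1 (integrableZl mD B iD1); apply: eq_integrable => // y _; rewrite /= mulr1.
have : w1 x - B = 0.
  apply: (@continuous_integral_itv0 (fun x => w1 x - B)) => //.
    move=> y Dy; apply: continuousB; last exact: cst_continuous.
    apply: continuousD; first exact: cq.
    by apply: continuousM; [exact: cst_continuous|exact: cvg_id].
  by move=> a b la ab br; exact: (test_function_orthogonal_itv lr iwB).
rewrite /w1; lra.
Qed.

End weak_second_derivative.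

(** * Double primitives and zero Cauchy data *)

Section H2_representation.
Context {R : realType}.
Local Notation mu := (@lebesgue_measure R).
Local Notation RR := (measurableTypeR R).
Local Notation D := (`]0, 1[%classic : set R).

Let mD : measurable (D : set RR). Proof. exact: measurable_itv. Qed.
Let D01 : 0 < 1 :> R. Proof. exact: ltr01. Qed.

Lemma integrable_itv_cst (a b c : R) : mu.-integrable (`]a, b[%classic : set RR) (EFin \o cst c).
Proof.
apply: measurable_bounded_integrable => //.
  by rewrite /= lebesgue_measure_itv/=; case: ifP => _; rewrite ?ltry.
by exists `|c|; split; [exact: num_real|move=> N MN z _; rewrite /= ltW].
Qed.

Lemma integrable_primitive (v : R -> R) : mu.-integrable D (EFin \o v) ->
  mu.-integrable D (EFin \o (fun y => \int[mu]_(z in `]0, y[) v z)).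
Proof.
move=> iv; have i1 := integrable_itv_cst 0 1 1.
have [] // := @fubini_triangle R 0 1 (fun _ y => v y) (cst 1) (fun y => `|v y|) _ i1 _ _.
- have := measurable_fun_prod_mul mD mD (integrable_Rintegral_le i1) (integrable_Rintegral_le iv).
  by apply: eq_measurable_fun => z _ /=; rewrite mul1r.
- exact: integrable_norm.
- by move=> *; rewrite mul1r.
Qed.

(** Integration by parts against x - y; one boundary factor vanishes at each end. *)
Lemma Rintegral_itv_double_primitive (v : R -> R) x : mu.-integrable D (EFin \o v) -> D x ->
  \int[mu]_(y in `]0, x[) ((x - y) * v y) =
  \int[mu]_(y in `]0, x[) (\int[mu]_(z in `]0, y[) v z).
Proof.
move=> iv; rewrite /= in_itv/= => /andP[x0 x1].
have sub : `]0, x[ `<=` D by apply: subset_itvl; rewrite bnd_simp ltW.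
have ivx : mu.-integrable `]0, x[ (EFin \o v) by exact: integrableS iv.
pose V y := \int[mu]_(z in `]0, y[) v z.
have iVx : mu.-integrable `]0, x[ (EFin \o V).
  by apply: integrableS (integrable_primitive iv).
have V0 : V 0 = 0 by rewrite /V set_itvoo0 Rintegral_set0.
have := @integration_by_parts_density R 0 x V v (fun y => x - y) (cst (-1)) x0 ivx
  (integrable_itv_cst _ _ _) _ _.
rewrite V0 subrr mulr0 mul0r !sub0r oppr0 sub0r => h.
transitivity (\int[mu]_(y in `]0, x[) (v y * (x - y))).
  by apply: eq_Rintegral => y _; rewrite mulrC.
rewrite h.
- transitivity (- (-1 * \int[mu]_(y in `]0, x[) V y)); last by rewrite mulN1r opprK.
  by rewrite -RintegralZl//; congr (- _); apply: eq_Rintegral => y _; rewrite mulrC.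
- by move=> t t0 tx; rewrite add0r.
- move=> t t0 tx; rewrite Rintegral_cst; last exact: measurable_itv.
  by rewrite /= lebesgue_measure_itv/= lte_fin t0 /=; lra.
Qed.

Lemma primitive_regular (w : R -> R) : mu.-integrable D (EFin \o w) ->
  (forall x, D x -> (\int[mu]_(z in `]0, y[) w z) @[y --> x] --> \int[mu]_(z in `]0, x[) w z) /\
  ((\int[mu]_(z in `]0, y[) w z) @[y --> 0^'+] --> (0 : R)).
Proof.
move=> iw; have iw' := (integrable_mkcond _ mD).1 iw.
have iw1 : mu.-integrable setT (EFin \o (w \_ D)).
  by apply: eq_integrable iw' => // x _; rewrite /= !patchE; case: ifP.
have WE y : D y -> \int[mu]_(z in `]0, y[) w z = \int[mu]_(z in `[0, y]) (w \_ D) z.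
  rewrite /= in_itv/= => /andP[y0 y1].
  rewrite -Rintegral_itv_bndo_bndc; last exact: integrableS iw1.
  rewrite [LHS]Rintegral_mkcond [RHS]Rintegral_mkcond.
  apply: eq_Rintegral => z _.
  rewrite !patchE !mem_setE !in_itv/=.
  by case: (ltgtP 0 z) => [z0|z0|<-] //=; case: ltP => // zy; rewrite ?(lt_trans zy) ?ltxx.
have iw01 : mu.-integrable `[0, 1] (EFin \o (w \_ D)) by exact: integrableS iw1.
split.
  move=> x Dx; have := parameterized_integral_continuous (ltW D01) iw01.
  move/(continuous_within_itvP _ D01) => [/(_ x Dx) + _ _].
  rewrite /continuous_at /parameterized_integral -(WE _ Dx).
  apply: cvg_trans; apply: near_eq_cvg.
  move: Dx; rewrite /= in_itv/= => /andP[x0 x1].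
  near=> y; rewrite WE// /= in_itv/=; apply/andP; split; near: y.
    exact: lt_nbhsr.
  exact: lt_nbhsl.
have := parameterized_integral_cvg_left D01 iw01.
move/cvg_at_right_filter; apply: cvg_trans; apply: near_eq_cvg.
near=> y; rewrite WE// /= in_itv/=; apply/andP; split; near: y.
  exact: nbhs_right_gt.
exact: nbhs_right_lt.
Unshelve. all: by end_near. Qed.

(** [f] and the double primitive [H] of [v] have the same weak second derivative and hence differ by
    an affine function. The value at 0 kills its constant term, the one-sided derivative at 0 its
    slope. *)
Lemma weak_second_derivative_repr (f v : R -> R) :
  {within `[0, 1], continuous f} -> mu.-integrable D (EFin \o v) ->
  (forall psi, test_function D psi ->
     \int[mu]_(x in D) (f x * derive1 (derive1 psi) x) = \int[mu]_(x in D) (v x * psi x)) ->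
  f 0 = 0 -> h^-1 * (f h - f 0) @[h --> 0^'+] --> (0 : R) ->
  forall x, D x -> f x = \int[mu]_(y in `]0, x[) ((x - y) * v y).
Proof.
move=> cf iv fv f0 f'0.
pose V y := \int[mu]_(z in `]0, y[) v z.
pose H y := \int[mu]_(z in `]0, y[) V z.
have iV := integrable_primitive iv.
have iH := integrable_primitive iV.
have [cH Hc0] := primitive_regular iV.
move/(continuous_within_itvP _ D01) : (cf) => [cf1 cf0 _].
have iF : mu.-integrable D (EFin \o f).
  apply: integrableS (continuous_compact_integrable (@segment_compact _ 0 1) cf) => //.
  exact: subset_itv_oo_cc.
pose q x := f x - H x.
have iq : mu.-integrable D (EFin \o q) by exact: (integrableB mD iF iH).
have cq x : D x -> {for x, continuous q}.
  move=> Dx; have : f y - H y @[y --> x] --> f x - H x by apply: cvgB; [exact: cf1|exact: cH].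
  by [].
have Hweak psi : test_function D psi ->
    \int[mu]_(x in D) (H x * derive1 (derive1 psi) x) = \int[mu]_(x in D) (v x * psi x).
  move=> t0; have t1 := test_function_derive1 D01 t0; have t2 := test_function_derive1 D01 t1.
  have /test_functionP[//|s0 _] := t0; have /test_functionP[//|s1 _] := t1.
  have [e00 e01] := test_function_ends D01 t0; have [e10 e11] := test_function_ends D01 t1.
  have V0 : V 0 = 0 by rewrite /V set_itvoo0 Rintegral_set0.
  have H0 : H 0 = 0 by rewrite /H set_itvoo0 Rintegral_set0.
  have p1 := @integration_by_parts_density R 0 1 V v psi (derive1 psi) D01 iv
    (integrable_test_function D01 t1).
  have p2 := @integration_by_parts_density R 0 1 H V (derive1 psi) (derive1 (derive1 psi)) D01 iV
    (integrable_test_function D01 t2).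
  rewrite e00 e01 V0 !mulr0 subrr sub0r in p1; rewrite e10 e11 H0 !mulr0 subrr sub0r in p2.
  rewrite p1 ?p2 ?opprK//.
  - by move=> t ? ?; rewrite add0r.
  - by move=> t t0' ?; rewrite -[X in X + _]e10; exact: smooth_FTC.
  - by move=> t ? ?; rewrite add0r.
  - by move=> t t0' ?; rewrite -[X in X + _]e00; exact: smooth_FTC.
have [A [B qAB]] : exists A B, forall x, D x -> q x = A * x + B.
  apply: (weak_second_derivative0_affine D01 iq cq) => psi tpsi.
  have t2 := test_function_derive1 D01 (test_function_derive1 D01 tpsi).
  under eq_Rintegral do rewrite mulrBl.
  rewrite RintegralB//; first by rewrite fv// Hweak// subrr.
  - exact: (test_function_integrableM D01 iF t2).
  - exact: (test_function_integrableM D01 iH t2).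
have iav : mu.-integrable D (EFin \o (fun y => `|v y|)) by exact: integrable_norm.
have [_ av0] := primitive_regular iav.
(* This makes H(x) = o(x), because the integral of |v| over ]0, x[ tends to 0. *)
have Hx x : D x -> `|H x| <= x * \int[mu]_(y in `]0, x[) `|v y|.
  move=> Dx; rewrite /H -Rintegral_itv_double_primitive//.
  move: (Dx); rewrite /= in_itv/= => /andP[x0 x1].
  have sub : `]0, x[ `<=` D by apply: subset_itvl; rewrite bnd_simp ltW.
  have ivx : mu.-integrable `]0, x[ (EFin \o v) by exact: integrableS iv.
  have iavx : mu.-integrable `]0, x[ (EFin \o (fun y => `|v y|)) by exact: integrableS iav.
  have mx : measurable (`]0, x[%classic : set RR) by exact: measurable_itv.
  have ixv : mu.-integrable `]0, x[ (EFin \o (fun y => (x - y) * v y)).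
    apply: (le_integrable mx) (integrableZl mx x iavx).
      apply/measurable_EFinP; apply: measurable_funM; last exact: integrable_Rintegral_le.
      by apply: measurable_funB.
    move=> y; rewrite /= in_itv/= => /andP[y0 yx].
    rewrite lee_fin !normrM normr_id ler_wpM2r// !gtr0_norm//; lra.
  apply: le_trans (le_normr_Rintegral mx ixv) _.
  rewrite -RintegralZl//; apply: le_Rintegral => //.
  - exact: integrable_norm.
  - exact: (integrableZl mx x iavx).
  - move=> y; rewrite /= in_itv/= => /andP[y0 yx].
    by rewrite normrM ler_wpM2r// gtr0_norm; lra.
have D_near : \forall h \near 0^'+, D h.
  near=> h; rewrite /= in_itv/=; apply/andP; split; near: h.
    exact: nbhs_right_gt.
  exact: nbhs_right_lt.
have H'0 : h^-1 * H h @[h --> 0^'+] --> (0 : R).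
  apply/norm_cvg0P; apply: (squeeze_cvgr _ (cvg_cst 0) av0).
  near=> h; rewrite normr_ge0/=.
  have Dh : D h by near: h.
  have h0 : 0 < h by move: Dh; rewrite /= in_itv/= => /andP[].
  by rewrite normrM gtr0_norm ?invr_gt0// ler_pdivrMl//; exact: Hx.
have B0 : B = 0.
  have q0 : q h @[h --> 0^'+] --> (0 : R).
    have h := cvgB cf0 Hc0; rewrite f0 subrr in h.
    exact: h.
  have qB : q h @[h --> 0^'+] --> B.
    have : A * h + B @[h --> 0^'+] --> A * 0 + B.
      by apply: cvgD; [apply: cvgM; [exact: cvg_cst|apply: cvg_at_right_filter; exact: cvg_id]|exact: cvg_cst].
    rewrite mulr0 add0r; apply: cvg_trans; apply: near_eq_cvg.
    by near=> h; rewrite -qAB//; near: h.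
  by apply: cvg_unique qB q0.
have A0 : A = 0.
  have q0 : h^-1 * (f h - f 0) - h^-1 * H h @[h --> 0^'+] --> (0 : R).
    rewrite -[X in _ --> X](subrr 0); exact: cvgB.
  have qA : h^-1 * (f h - f 0) - h^-1 * H h @[h --> 0^'+] --> A.
    apply: cvg_near_cst; near=> h.
    have Dh : D h by near: h.
    have h0 : 0 < h by move: Dh; rewrite /= in_itv/= => /andP[].
    rewrite f0 subr0 -mulrBr -/(q h) (qAB _ Dh) B0 addr0 mulrCA mulVf; last exact: lt0r_neq0.
    by rewrite mulr1.
  by apply: cvg_unique qA q0.
move=> x Dx; rewrite Rintegral_itv_double_primitive// -/(H x).
by have := qAB _ Dx; rewrite A0 B0 /q; lra.
Unshelve. all: by end_near. Qed.

End H2_representation.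

(** * Bounds drawn from the H^2 norm *)

Section H2_weak.
Context {R : realType}.
Local Notation mu := (@lebesgue_measure R).
Local Notation RR := (measurableTypeR R).
Local Notation D := (`]0, 1[%classic : set R).

Lemma weak_derivativeP (f g : R -> R) : is_weak_derivative D f g ->
  is_weak_derivative D f (weak_derivative D f).
Proof. by move=> fg; rewrite /weak_derivative; case: xgetP => [h _ //|/(_ g)]. Qed.

(** The derivative picked by [weak_derivative] need not be the witness [g], but both have the same
    pairings with test functions. Hence the weak derivative [h] of [g] is also one of the picked
    function. *)
Lemma H2_weak_second_derivative (f : R -> R) : H2 D f ->
  let v := weak_derivative D (weak_derivative D f) in
  measurable_fun D v /\
  forall psi, test_function D psi ->
    \int[mu]_(x in D) (f x * derive1 (derive1 psi) x) = \int[mu]_(x in D) (v x * psi x).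
Proof.
move=> [_ [g [h [fg _ gh _]]]] /=; set g0 := weak_derivative D f.
have [_ [_ _ _] fg0] : is_weak_derivative D f g0 by exact: weak_derivativeP fg.
have [_ lg0 fg0'] : is_weak_derivative D f g0 by exact: weak_derivativeP fg.
have g0h : is_weak_derivative D g0 h.
  have [_ _ fg'] := fg; have [_ lh gh'] := gh; split => // psi tpsi.
  have t1 := test_function_derive1 ltr01 tpsi.
  by rewrite -gh'// -[LHS]opprK -fg0'// fg'// opprK.
have [_ [mv _ _] g0v] := weak_derivativeP g0h.
split => // psi tpsi; have t1 := test_function_derive1 ltr01 tpsi.
by rewrite fg0'// g0v// opprK.
Qed.

Lemma L2norm_le_H2norm (f : R -> R) :
  (L2norm D (weak_derivative D (weak_derivative D f)) <= H2norm D f)%E.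
Proof.
rewrite /H2norm; set a := L2norm D f; set c := L2norm D (weak_derivative D (weak_derivative D f)).
set b := L2norm D _.
have c0 : (0 <= c)%E by exact: Lnorm_ge0.
rewrite [leLHS](_ : c = ((c `^ 2) `^ 2^-1)%E); last by rewrite -poweRrM mulfV// poweRe1.
apply: gt0_ler_poweR; rewrite ?in_itv/= ?leey ?andbT ?poweR_ge0 ?adde_ge0 ?poweR_ge0//.
by rewrite leeDr// adde_ge0// poweR_ge0.
Qed.

(** The pointwise inequality |v| <= 1 + v^2 on an interval of length 1 is sharp enough here; it is
    the origin of the bound 1 + M0^2 in the theorem. *)
Lemma L1_le_L2norm (v : R -> R) (M : R) : measurable_fun D v -> (L2norm D v <= M%:E)%E ->
  (\int[mu]_(x in D) `|(v x)%:E| <= (1 + M ^+ 2)%:E)%E.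
Proof.
move=> mv vM.
have mD : measurable (D : set RR) by exact: measurable_itv.
have M0 : 0 <= M by rewrite -lee_fin; apply: le_trans vM; exact: Lnorm_ge0.
have e : (\int[mu]_(x in D) ((v x) ^+ 2)%:E <= (M ^+ 2)%:E)%E.
  have : (L2norm D v `^ 2 <= M%:E `^ 2)%E.
    by apply: gt0_ler_poweR => //; rewrite ?in_itv/= ?leey ?andbT ?lee_fin ?Lnorm_ge0.
  rewrite poweR_EFin -powR_mulrn// /L2norm poweR_Lnorm//.
  congr (_ <= _)%E; rewrite [RHS]integral_mkcond; apply: eq_integral => x _.
  rewrite /= !patchE; case: ifP => _.
    by rewrite powR_mulrn// real_normK// num_real.
  by rewrite normr0 powR0.
apply: (@le_trans _ _ (\int[mu]_(x in D) (1 + ((v x) ^+ 2)%:E))%E).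
  apply: ge0_le_integral => //.
  - by apply: measurableT_comp => //; exact/measurable_EFinP.
  - by apply: emeasurable_funD => //; apply/measurable_EFinP; exact: measurable_funX.
  - move=> x _; rewrite -EFinD lee_fin -real_normK ?num_real//.
    have := sqr_ge0 (`|v x| - 1); rewrite sqrrB; have := normr_ge0 (v x); nra.
rewrite ge0_integralD//.
- rewrite EFinD leeD// integral_cst// mul1e.
  by rewrite /= lebesgue_measure_itv/= lte_fin ltr01 -EFinB subr0.
- by move=> x _; rewrite lee_fin sqr_ge0.
- by apply/measurable_EFinP; exact: measurable_funX.
Qed.

End H2_weak.

(** * The Laplace transform of the Caputo derivative *)

Section affine_substitution.
Context {R : realType}.
Local Notation mu := (@lebesgue_measure R).
Local Notation RR := (measurableTypeR R).

(** The pushforward of Lebesgue measure under x -> s x + c, multiplied by s, agrees with Lebesgue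
    measure on half-open intervals, hence everywhere. *)
Lemma ge0_integral_affine (s c : R) (f : R -> \bar R) : 0 < s ->
  measurable_fun (setT : set RR) f -> (forall x, 0 <= f x)%E ->
  (\int[mu]_x f x = s%:E * \int[mu]_x f (s * x + c)%R)%E.
Proof.
move=> s0 mf f0.
have mF : measurable_fun (setT : set RR) (fun x : RR => s * x + c : RR).
  apply: continuous_measurable_fun => x.
  by apply: cvgD; [apply: cvgM; [exact: cvg_cst|exact: cvg_id]|exact: cvg_cst].
pose nu := pushforward mu (fun x : RR => s * x + c : RR).
pose s' : {nonneg R} := NngNum (ltW s0).
have E X : ocitv X -> mu X = mscale s' nu X.
  move=> /ocitvP[->|[[a b] /= ab ->]]; first by rewrite !measure0.
  rewrite /mscale /= /nu /pushforward.
  rewrite (_ : _ @^-1` _ = `](a - c) / s, (b - c) / s]%classic); last first.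
    apply/seteqP; split => x /=; rewrite !in_itv/= ltr_pdivrMr// ler_pdivlMr// ltrBlDr lerBrDr;
      by rewrite (mulrC s).
  rewrite /= !lebesgue_measure_itv/= !lte_fin ab ltr_pM2r ?invr_gt0// ltrD2r ab.
  rewrite -!EFinB -EFinM; congr EFin; field; exact: lt0r_neq0.
have muE := lebesgue_measure_unique (E mF).
rewrite (eq_measure_integral (mscale s' nu)); last by move=> A mA _; exact: muE.
rewrite ge0_integral_mscale//= ge0_integral_pushforward//.
Qed.

End affine_substitution.

(** * The power kernel and its Laplace transform *)

Section power_kernel.
Context {R : realType}.
Local Notation mu := (@lebesgue_measure R).
Local Notation RR := (measurableTypeR R).
Variable alpha : R.
Hypothesis alpha_gt0 : 0 < alpha.
Hypothesis alpha_lt1 : alpha < 1.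

(** With the value 0 for r <= 0, a convolution over ]0, t[ can be written over a fixed interval, and
    translates can be integrated over the whole line. *)
Definition kern (r : R) : R := if 0 < r then r `^ (- alpha) else 0.

Lemma kern_ge0 r : 0 <= kern r.
Proof. by rewrite /kern; case: ifP => // _; exact: powR_ge0. Qed.

Lemma measurable_kern : measurable_fun (setT : set RR) kern.
Proof.
apply: measurable_fun_if => //.
- by apply: measurable_fun_ltr.
- by apply: measurable_funTS; exact: measurable_powR.
Qed.

Lemma kernZ s r : 0 < s -> kern (s * r) = s `^ (- alpha) * kern r.
Proof.
move=> s0; rewrite /kern pmulr_rgt0//; case: ifP => r0; last by rewrite mulr0.
by rewrite powRM// ltW.
Qed.

Let kernexp s r := kern r * expR (- (s * r)).

Let kernexp_ge0 s r : 0 <= kernexp s r.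
Proof. by rewrite mulr_ge0 ?kern_ge0 ?expR_ge0. Qed.

Lemma measurable_kern_expR s : measurable_fun (setT : set RR) (fun r => kern r * expR (- (s * r))).
Proof.
apply: measurable_funM; first exact: measurable_kern.
apply: continuous_measurable_fun => x; apply: continuous_comp; last exact: continuous_expR.
by apply: cvgN; apply: cvgM; [exact: cvg_cst|exact: cvg_id].
Qed.

(** Exhaustion by [1/(n+1), 1]: on each of them the explicit antiderivative gives at most 1/(1 -
    alpha). *)
Lemma integral_kern01_lty : (\int[mu]_(r in `]0%R, 1%R]) (kern r)%:E < +oo)%E.
Proof.
have a1 : 0 < 1 - alpha by rewrite subr_gt0.
pose F n := `[(n.+1%:R : R)^-1, 1]%classic : set RR.
have UF : `]0, 1]%classic = \bigcup_n F n.
  apply/seteqP; split => x /=; rewrite ?in_itv/=.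
    move=> /andP[x0 x1]; exists (Num.truncn x^-1) => //=.
    rewrite /F /= in_itv/= x1 andbT -[leRHS]invrK lef_pV2 ?posrE ?invr_gt0//.
    by apply: ltW; rewrite truncnS_gt.
  move=> [n _]; rewrite /F /= in_itv/= => /andP[nx ->]; rewrite andbT.
  by apply: lt_le_trans nx; rewrite invr_gt0 ltr0n.
have mk (i : nat) : measurable_fun (F i) (fun r : RR => (kern r)%:E).
  by apply/measurable_EFinP; apply: measurable_funTS; exact: measurable_kern.
have cv := @ge0_nondecreasing_set_cvg_integral _ _ R F (fun r => (kern r)%:E) mu _ _ mk _.
rewrite UF; apply: (@le_lt_trans _ _ (1 - alpha)^-1%:E); last exact: ltry.
apply: (cvge_to_le (cv _ _ _)).
- apply/nondecreasing_seqP => n; rewrite subsetEset /F => x /=; rewrite !in_itv/= => /andP[h ->].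
  by rewrite andbT (le_trans _ h)// lef_pV2 ?posrE// ler_nat.
- by move=> i; exact: measurable_itv.
- by move=> i x _; rewrite lee_fin kern_ge0.
near=> n; rewrite {1}/F; set e := (n.+1%:R)^-1.
have e0 : 0 < e by rewrite invr_gt0.
have [e1|e1] := ltP e 1; last first.
  rewrite /F (_ : `[_, 1]%classic = if e == 1 then [set 1] else set0).
    by case: ifP => _; rewrite ?integral_set1 ?integral_set0 lee_fin ltW// invr_gt0.
  case: eqVneq => [e1'|e1'].
    by rewrite -/e e1' set_itv1.
  by rewrite -/e set_itv_ge// -leNgt bnd_simp lt_neqAle eq_sym e1' e1.
pose G x := (1 - alpha)^-1 * x `^ (1 - alpha).
have dG (x : R) : 0 < x -> is_derive x (1 : R) G (x `^ (- alpha)).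
  move=> x0; have h := is_derive1_powR (1 - alpha) x0.
  have := is_deriveZ (1 - alpha)^-1 h; rewrite /GRing.scale /= mulrA mulVf ?mul1r; last exact: lt0r_neq0.
  by rewrite addrAC subrr add0r.
have cG (x : R) : 0 < x -> {for x, continuous G}.
  by move=> x0; apply/differentiable_continuous/derivable1_diffP; have [] := dG _ x0.
have ck : {within `[e, 1], continuous (fun x : R => x `^ (- alpha))}.
  apply: continuous_in_subspaceT => x; rewrite inE/= in_itv/= => /andP[ex _].
  apply/differentiable_continuous/derivable1_diffP; apply: derivable_powR.
  by rewrite in_itv/= andbT (lt_le_trans e0).
have dp : derivable_oo_LRcontinuous G e 1.
  split.
  - by move=> x; rewrite in_itv/= => /andP[ex _]; have [] := dG _ (lt_trans e0 ex).
  - by apply: cvg_at_right_filter; exact: cG.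
  - by apply: cvg_at_left_filter; exact: cG.
have F'g : {in `]e, 1[, derive1 G =1 (fun x : R => x `^ (- alpha))}.
  move=> x; rewrite in_itv/= => /andP[ex _]; rewrite derive1E.
  by have [_ ->] := dG _ (lt_trans e0 ex).
have -> : (\int[mu]_(x in `[e, 1%R]) (kern x)%:E =
    \int[mu]_(x in `[e, 1%R]) (x `^ (- alpha))%:E)%E.
  apply: eq_integral => x; rewrite inE/= in_itv/= => /andP[ex _].
  by rewrite /kern (lt_le_trans e0 ex).
rewrite (continuous_FTC2 e1 ck dp F'g) -EFinB lee_fin /G powR1 mulr1 lerBlDr lerDl.
by rewrite mulr_ge0 ?powR_ge0 ?invr_ge0 ?ltW.
Unshelve. all: by end_near. Qed.

Lemma integral_expRN_lty : (\int[mu]_(r in `]0%R, +oo[) (expR (- r))%:E < +oo)%E.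
Proof.
have cexp : continuous (fun r : R => expR (- r)).
  by move=> x; apply: continuous_comp; [apply: cvgN; exact: cvg_id|exact: continuous_expR].
have dE (x : R) : is_derive x (1 : R) (fun r => - expR (- r)) (expR (- x)).
  have h1 : is_derive x (1 : R) (fun r : R => - r) (- 1) by exact: is_deriveNid.
  have h2 := @is_derive1_comp _ expR (fun r : R => - r) x _ _ (is_derive_expR _) h1.
  by have := is_deriveN h2; rewrite mulrN1 opprK.
have mexp : measurable_fun (`]0%R, +oo[%classic : set RR) (fun r : R => (expR (- r))%:E).
  by apply/measurable_EFinP; apply: measurable_funTS; exact: continuous_measurable_fun.
rewrite integral_itv_obnd_cbnd//.
rewrite (@ge0_continuous_FTC2y _ _ (fun r : R => - expR (- r)) 0 0).
- by rewrite -EFinB ltry.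
- by move=> x _; exact: expR_ge0.
- exact: continuous_subspaceT.
- rewrite -[X in _ --> X]oppr0; apply: cvgN; exact: cvgr_expR.
- by move=> x _; have [] := dE x.
- apply: cvg_at_right_filter; apply: cvgN; exact: cexp.
- by move=> x _; rewrite derive1E; have [_ ->] := dE x.
Qed.

(** Up to 1 the exponential is at most 1 and the singularity is integrable; beyond 1 the power is at
    most 1 and the exponential is integrable. *)
Lemma kern_expR1_lty : (\int[mu]_r (kernexp 1 r)%:E < +oo)%E.
Proof.
have mk : measurable_fun (setT : set RR) (fun r : RR => (kernexp 1 r)%:E).
  by apply/measurable_EFinP; exact: measurable_kern_expR.
have e1 : `]0, 1]%classic `|` `]1, +oo[%classic = `]0, +oo[%classic :> set R.
  apply/seteqP; split => x /=; rewrite !in_itv/= ?andbT.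
    by move=> [/andP[]//|]; exact: lt_trans.
  by move=> x0; case: (leP x 1) => x1; [left; rewrite x0|right].
rewrite (_ : (\int[mu]_r (kernexp 1 r)%:E = \int[mu]_(r in `]0%R, +oo[) (kernexp 1 r)%:E)%E); last first.
  rewrite [RHS]integral_mkcond; apply: eq_integral => r _; rewrite patchE mem_setE in_itv/= andbT.
  by case: ifPn => // r0; rewrite /kernexp /kern (negbTE r0) mul0r.
rewrite -e1 ge0_integral_setU//=; first last.
- apply/disj_setPS => x /= []; rewrite !in_itv/= andbT => /andP[_ x1] /(le_lt_trans x1).
  by rewrite ltxx.
- by move=> x _; rewrite lee_fin kernexp_ge0.
- exact: measurable_funTS.
apply: lte_add_pinfty.
  apply: le_lt_trans integral_kern01_lty; apply: ge0_le_integral => //.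
  - by move=> x _; rewrite lee_fin kernexp_ge0.
  - exact: measurable_funTS.
  - by apply/measurable_EFinP; apply: measurable_funTS; exact: measurable_kern.
  - move=> x; rewrite /= in_itv/= => /andP[x0 _]; rewrite lee_fin ler_piMr ?kern_ge0//.
    by rewrite mul1r -expR0 ler_expR oppr_le0 ltW.
have mexp (A : set RR) : measurable_fun A (fun r : R => (expR (- r))%:E).
  apply/measurable_EFinP; apply: measurable_funTS; apply: continuous_measurable_fun.
  by move=> x; apply: continuous_comp; [apply: cvgN; exact: cvg_id|exact: continuous_expR].
apply: le_lt_trans integral_expRN_lty.
apply: (@le_trans _ _ (\int[mu]_(r in `]1%R, +oo[) (expR (- r))%:E)%E).
  apply: ge0_le_integral => //.
  - by move=> x _; rewrite lee_fin kernexp_ge0.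
  - exact: measurable_funTS.
  - move=> x; rewrite /= in_itv/= andbT => x1; rewrite lee_fin /kernexp mul1r ler_piMl ?expR_ge0//.
    rewrite /kern (lt_trans ltr01 x1) powRN invf_le1; last by rewrite powR_gt0// (lt_trans ltr01).
    by rewrite -[leLHS](powRr0 x) ler_powR// ltW.
apply: ge0_subset_integral => //.
by apply: subset_itvr; rewrite bnd_simp.
Qed.

(** Substitution of s r for r: the Jacobian contributes s and the homogeneity of the kernel
    s^(-alpha). *)
Lemma kern_expR_scale s : 0 < s ->
  (\int[mu]_r (kernexp s r)%:E = (s `^ (alpha - 1))%:E * \int[mu]_r (kernexp 1 r)%:E)%E.
Proof.
move=> s0; have sa0 : 0 < s `^ (- alpha) by exact: powR_gt0.
have mk t : measurable_fun (setT : set RR) (fun r : RR => (kernexp t r)%:E).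
  by apply/measurable_EFinP; exact: measurable_kern_expR.
rewrite (@ge0_integral_affine R s 0 (fun r => (kernexp 1 r)%:E)) //; last first.
  by move=> x; rewrite lee_fin kernexp_ge0.
have -> : (\int[mu]_r (kernexp 1 (s * r + 0))%:E =
    \int[mu]_r ((s `^ (- alpha))%:E * (kernexp s r)%:E))%E.
  by apply: eq_integral => r _; rewrite -EFinM /kernexp addr0 kernZ// mul1r mulrA.
rewrite ge0_integralZl//; last first.
- by rewrite lee_fin ltW.
- by move=> x _; rewrite lee_fin kernexp_ge0.
rewrite !muleA -!EFinM -mulrA -[X in X * (_ * _)]/(powR s (alpha - 1)).
rewrite (_ : _ * _ = 1) ?mul1e//.
rewrite -{2}(powRr1 (ltW s0)) -powRD; last by rewrite (lt0r_neq0 s0) implybT.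
rewrite -powRD; last by rewrite (lt0r_neq0 s0) implybT.
by rewrite (_ : _ + _ = 0) ?powRr0//; ring.
Qed.

Lemma integrable_kern_expR s : 0 < s ->
  mu.-integrable (setT : set RR) (EFin \o (fun r => kern r * expR (- (s * r)))).
Proof.
move=> s0; apply/integrableP; split; first by apply/measurable_EFinP; exact: measurable_kern_expR.
have -> : (\int[mu]_r `|(kern r * expR (- (s * r)))%:E| = \int[mu]_r (kernexp s r)%:E)%E.
  by apply: eq_integral => r _; rewrite gee0_abs// lee_fin kernexp_ge0.
by rewrite kern_expR_scale// lte_mul_pinfty ?lee_fin ?powR_ge0// kern_expR1_lty.
Qed.

Lemma Rintegral_kern_expR s : 0 < s ->
  \int[mu]_r (kern r * expR (- (s * r))) = s `^ (alpha - 1) * Gamma (1 - alpha).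
Proof.
move=> s0; rewrite /Rintegral kern_expR_scale// fineM//; last first.
  by rewrite ge0_fin_numE ?kern_expR1_lty// integral_ge0// => x _; rewrite lee_fin kernexp_ge0.
congr (_ * fine _); rewrite [RHS]integral_mkcond; apply: eq_integral => r _.
rewrite patchE mem_setE in_itv/= andbT /kernexp /kern mul1r.
by case: ifPn => r0; [rewrite addrAC subrr add0r|rewrite mul0r].
Qed.

(** On ]0, 1[ the power is at least 1 and the exponential at least exp(-1). Positivity is what
    allows the factor 1/Gamma in [caputo] to be cleared. *)
Lemma Gamma_gt0 : 0 < Gamma (1 - alpha).
Proof.
have := Rintegral_kern_expR ltr01; rewrite powR1 mul1r => <-.
have fin : (\int[mu]_r (kernexp 1 r)%:E)%E \is a fin_num.
  by rewrite ge0_fin_numE ?kern_expR1_lty// integral_ge0// => x _; rewrite lee_fin kernexp_ge0.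
rewrite -lte_fin /Rintegral fineK//.
apply: (@lt_le_trans _ _ (expR (-1))%:E); first by rewrite lte_fin expR_gt0.
apply: (@le_trans _ _ (\int[mu]_(r in `]0%R, 1%R[) (expR (-1))%:E)%E).
  rewrite integral_cst//.
  by rewrite /= lebesgue_measure_itv/= lte_fin ltr01 -EFinB -EFinM subr0 mulr1.
apply: (@le_trans _ _ (\int[mu]_(r in `]0%R, 1%R[) (kernexp 1 r)%:E)%E).
  apply: ge0_le_integral => //.
  - by apply/measurable_EFinP; apply: measurable_funTS; exact: measurable_kern_expR.
  - move=> x; rewrite /= in_itv/= => /andP[x0 x1]; rewrite lee_fin /kernexp mul1r.
    apply: (@le_trans _ _ (expR (- x))); first by rewrite ler_expR lerN2 ltW.
    rewrite ler_peMl ?expR_ge0// /kern x0 powRN invf_ge1 ?powR_gt0//.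
    by rewrite -[leRHS](powRr0 x); apply: ger_powR; [rewrite x0 ltW|exact: ltW].
apply: ge0_subset_integral => //.
- by apply/measurable_EFinP; exact: measurable_kern_expR.
- by move=> x _; rewrite lee_fin kernexp_ge0.
Qed.

End power_kernel.

(** * Truncated Laplace transforms *)

Section caputo_laplace.
Context {R : realType}.
Local Notation mu := (@lebesgue_measure R).
Local Notation RR := (measurableTypeR R).
Variables (alpha T M : R) (w phi : R -> R).
Hypothesis alpha_gt0 : 0 < alpha.
Hypothesis alpha_lt1 : alpha < 1.
Hypothesis T_gt0 : 0 < T.
Hypothesis iphi : mu.-integrable `]0, T[ (EFin \o phi).
Hypothesis wE : forall t, 0 < t -> t <= T -> w t = w 0 + \int[mu]_(x in `]0, t[) phi x.
Hypothesis wC : {within `[0, T], continuous w}.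
Hypothesis wM : forall t, 0 <= t -> t <= T -> `|w t| <= M.

Let k := kern alpha.

(* Integrating by parts against the increasing weight [kern (t - .)] moves the derivative
   off [w], so that only the sup norm of [w] enters. *)
Lemma convolution_tail_le t : T < t ->
  `|\int[mu]_(x in `]0, T[) (phi x * k (t - x))| <= 2 * M * k (t - T).
Proof.
move=> Tt; have t0 : 0 < t := lt_trans T_gt0 Tt.
have mI := measurable_itvoo 0 T.
pose p x := alpha * (t - x) `^ (- alpha - 1).
have dP (x : R) : x < t -> is_derive x (1 : R) (fun x => k (t - x)) (p x).
  move=> xt; apply: (@near_eq_is_derive _ _ _ (fun x => (t - x) `^ (- alpha))).
    near=> y; rewrite /k /kern ifT// subr_gt0; near: y; exact: lt_nbhsl.
  have h1 : is_derive x (1 : R) (fun x => t - x) (- 1).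
    by have := is_deriveB (is_derive_cst t x (1 : R)) (is_derive_id x (1 : R)); rewrite sub0r.
  have tx : 0 < t - x by rewrite subr_gt0.
  have h0 := is_derive1_powR (- alpha) tx.
  have h2 := @is_derive1_comp R (fun z : R => z `^ (- alpha)) (fun x => t - x) x _ _
    h0 h1.
  by apply: is_derive_eq h2 _; rewrite /p; ring.
have cp : {within `[0, T], continuous p}.
  apply: continuous_in_subspaceT => x; rewrite inE/= in_itv/= => /andP[_ xT].
  apply: (@continuousM R R (fun=> alpha) (fun x => (t - x) `^ (- alpha - 1)) x); first exact: cst_continuous.
  apply: (@continuous_comp _ _ _ (fun x => t - x) (fun z : R => z `^ (- alpha - 1))).
    by apply: cvgB; [exact: cvg_cst|exact: cvg_id].
  apply/differentiable_continuous/derivable1_diffP; apply: derivable_powR.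
  by rewrite in_itv/= andbT subr_gt0 (le_lt_trans xT).
have PE y : 0 < y -> y <= T -> k (t - y) = k (t - 0) + \int[mu]_(x in `]0, y[) p x.
  move=> y0 yT; have -> : \int[mu]_(x in `]0, y[) p x = k (t - y) - k (t - 0).
    apply: (@Rintegral_FTC R p (fun x => k (t - x)) 0 y y0).
    - by apply: continuous_subspaceW cp; apply: subset_itvl; rewrite bnd_simp.
    - move=> x _ xy; apply: dP; exact: le_lt_trans xy (le_lt_trans yT Tt).
  by rewrite addrCA subrr addr0.
have ip := integrable_within_continuous cp.
(* Subtracting [w T] removes the boundary term at T. What remains is bounded by 2 M k(t) and 2 M
   (k(t - T) - k(t)), whose sum is exactly the claimed bound. *)
have wTE y : 0 < y -> y <= T -> w y - w T = (w 0 - w T) + \int[mu]_(x in `]0, y[) phi x.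
  by move=> y0 yT; rewrite (wE y0 yT); ring.
have := integration_by_parts_density T_gt0 iphi ip wTE PE.
rewrite subrr mul0r sub0r => ->.
have p0 x : 0 <= p x by rewrite /p mulr_ge0 ?powR_ge0 ?ltW.
have M0 : 0 <= M by apply: le_trans (wM (lexx 0) (ltW T_gt0)).
have w2 x : 0 <= x -> x <= T -> `|w x - w T| <= 2 * M.
  move=> x0 xT; apply: le_trans (ler_normB _ _) _.
  by have := wM x0 xT; have := wM (ltW T_gt0) (lexx T); lra.
have iwp : mu.-integrable `]0, T[ (EFin \o (fun x => (w x - w T) * p x)).
  apply: integrable_within_continuous => x.
  apply: (@continuousM R (subspace `[0, T]) (fun x => w x - w T) p x); last exact: cp.
  by apply: cvgB; [exact: wC|exact: cvg_cst].
have ip2 : mu.-integrable `]0, T[ (EFin \o (fun x => 2 * M * p x)).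
  exact: (integrableZl mI (2 * M) ip).
have int_le : `|\int[mu]_(x in `]0, T[) ((w x - w T) * p x)| <= 2 * M * (k (t - T) - k (t - 0)).
  rewrite (PE T)// addrAC subrr add0r -RintegralZl//.
  apply: le_trans (le_normr_Rintegral mI iwp) _.
  apply: le_Rintegral => //; first exact: integrable_norm.
  move=> x; rewrite /= in_itv/= => /andP[/ltW x0 /ltW xT].
  by rewrite normrM (ger0_norm (p0 x)) ler_wpM2r// w2.
have bnd : `|(w 0 - w T) * k (t - 0)| <= 2 * M * k (t - 0).
  by rewrite normrM (ger0_norm (kern_ge0 _ _)) ler_wpM2r ?kern_ge0// w2// ltW.
apply: le_trans (ler_normB _ _) _; rewrite normrN.
by apply: le_trans (lerD bnd int_le) _; rewrite -mulrDr addrCA subrr addr0.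
Unshelve. all: by end_near. Qed.


Lemma translated_kern_integral (s x : R) : 0 < s ->
  mu.-integrable setT (EFin \o (fun t => k (t - x) * expR (- (s * t)))) /\
  \int[mu]_t (k (t - x) * expR (- (s * t))) =
    expR (- (s * x)) * (s `^ (alpha - 1) * Gamma (1 - alpha)).
Proof.
move=> s0; pose f r := k r * expR (- (s * r)).
have f0 r : 0 <= f r by rewrite mulr_ge0 ?kern_ge0 ?expR_ge0.
have If := integrable_kern_expR alpha_gt0 alpha_lt1 s0.
have mf := measurable_kern_expR alpha s.
have fE t : k (t - x) * expR (- (s * t)) = expR (- (s * x)) * f (1 * t + - x).
  by rewrite /f mul1r mulrCA -expRD; congr (_ * expR _); ring.
have mfx : measurable_fun (setT : set RR) (fun t => f (1 * t + - x)).
  have mg : measurable_fun (setT : set RR) (fun t : RR => 1 * t + - x : RR) by apply: measurable_funD => //; apply: measurable_funM.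
  exact: (measurableT_comp mf mg).
have tE : (\int[mu]_t (f (1 * t + - x))%:E = \int[mu]_t (f t)%:E)%E.
  rewrite (@ge0_integral_affine R 1 (- x) (EFin \o f))//= ?mul1e//.
  by apply/measurable_EFinP.
have ifx : mu.-integrable setT (EFin \o (fun t => f (1 * t + - x))).
  apply/integrableP; split; first exact/measurable_EFinP.
  have -> : (\int[mu]_t `|(f (1 * t + - x)%R)%:E| = \int[mu]_t (f t)%:E)%E.
    rewrite -tE; apply: eq_integral => t _ /=; rewrite ger0_norm//.
  have /integrableP[_] := If; apply: le_lt_trans; rewrite le_eqVlt; apply/orP; left; apply/eqP.
  by apply: eq_integral => t _ /=; rewrite ger0_norm//; exact: f0.
split.
  have := integrableZl measurableT (expR (- (s * x))) ifx.
  by apply: eq_integrable => // t _ /=; rewrite fE.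
rewrite -(Rintegral_kern_expR alpha_gt0 alpha_lt1 s0).
have -> : \int[mu]_t (k (t - x) * expR (- (s * t))) =
    \int[mu]_t (expR (- (s * x)) * f (1 * t + - x)) by apply: eq_Rintegral => t _; exact: fE.
have := RintegralZl (expR (- (s * x))) measurableT ifx; move=> ->.
by rewrite /Rintegral tE.
Qed.

Variables (s : R) (c : R -> R).
Hypothesis s_gt0 : 0 < s.
Hypothesis ic : mu.-integrable `]0, T[ (EFin \o c).
Hypothesis cE : {ae mu, forall t, `]0, T[%classic t ->
  c t = (Gamma (1 - alpha))^-1 * \int[mu]_(x in `]0, t[) (phi x * kern alpha (t - x))}.

Let e t := expR (- (s * t)).
Let F x t := phi x * (k (t - x) * e t).
Let K := s `^ (alpha - 1) * Gamma (1 - alpha).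

Let K_ge0 : 0 <= K.
Proof. by rewrite mulr_ge0 ?powR_ge0 ?ltW ?Gamma_gt0. Qed.

(** Integrating in t first gives K |phi x| exp(-s x), which is at most K |phi x|. *)
Let integrable_F : (mu \x mu)%E.-integrable (`]0, T[ `*` setT) (fun z => (F z.1 z.2)%:E).
Proof.
have mI := measurable_itvoo 0 T.
have mphi : measurable_fun (`]0, T[ : set RR) phi by have /measurable_EFinP := measurable_int _ iphi.
apply: (integrable_rectP (m1 := mu) (m2 := mu) mI measurableT (F := F)).
  apply: measurable_funM.
    apply: (@measurable_comp _ _ _ _ _ _ (`]0, T[ : set RR) phi _ fst) => //.
    + by move=> _ [z [? _] <-].
    + by apply: measurable_funTS; exact: measurable_fst.
  apply: measurable_funTS; apply: measurable_funM.
    apply: (measurableT_comp (measurable_kern alpha)).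
    by apply: measurable_funB; [exact: measurable_snd|exact: measurable_fst].
  apply: (measurableT_comp (@measurable_expR R)); apply: measurableT_comp => //.
  by apply: measurable_funM => //; exact: measurable_snd.
have -> : (\int[mu]_(x in `]0%R, T[) \int[mu]_t `|(F x t)%:E| =
   \int[mu]_(x in `]0%R, T[) (K%:E * (`|phi x| * e x)%:E))%E.
  apply: eq_integral => x _.
  have [ik kE] := translated_kern_integral x s_gt0.
  have -> : (\int[mu]_t `|(F x t)%:E| = \int[mu]_t (`|phi x|%:E * (k (t - x) * e t)%:E))%E.
    apply: eq_integral => t _; rewrite -EFinM /F abse_EFin normrM; congr (_ * _)%:E.
    by rewrite ger0_norm// mulr_ge0 ?kern_ge0 ?expR_ge0.
  rewrite (integralZl measurableT ik) -(fineK (integrable_fin_num measurableT ik)).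
  have := kE; rewrite /Rintegral => ->; rewrite -!EFinM; congr EFin.
  by rewrite /K /e; ring.
have iph : mu.-integrable `]0, T[ (EFin \o (fun x => `|phi x| * e x)).
  apply: (@le_integrable _ _ _ mu _ mI _ (EFin \o phi)); last exact: iphi.
    apply/measurable_EFinP; apply: measurable_funM; first exact: measurableT_comp.
    by apply: measurable_funTS; apply: (measurableT_comp (@measurable_expR R)); apply: measurableT_comp => //; exact: measurable_funM.
  move=> x; rewrite /= in_itv/= => /andP[x0 _]; rewrite lee_fin normrM normr_id.
  rewrite ler_piMr// ger0_norm ?expR_ge0// /e -expR0 ler_expR oppr_le0.
  by rewrite mulr_ge0// ltW.
rewrite (integralZl mI iph) lte_mul_pinfty//.
rewrite -(fineK (integrable_fin_num mI iph)) ltey//.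
Qed.

(** The Laplace transform of a convolution factorizes only on an infinite horizon. So [phi] is
    extended by 0 beyond T and t runs over the whole line: Fubini gives the exact product, ]0, T[
    contributes Gamma times the transform of [c], and the part beyond T is the error, bounded by
    [convolution_tail_le]. The transform of [phi] is reduced to that of [w] by parts. *)
Lemma caputo_laplace :
  `|\int[mu]_(t in `]0, T[) (expR (- (s * t)) * c t) -
    s `^ (alpha - 1) * (s * \int[mu]_(t in `]0, T[) (expR (- (s * t)) * w t)
       - w 0 + expR (- (s * T)) * w T)| <= 2 * M * (s `^ (alpha - 1) * expR (- (s * T))).
Proof.
have mI := measurable_itvoo 0 T.
have me : measurable_fun (setT : set RR) e.
  by apply: (measurableT_comp (@measurable_expR R)); apply: measurableT_comp => //; exact: measurable_funM.
have G0 : 0 < Gamma (1 - alpha) by exact: Gamma_gt0.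
have e_gt0 t : 0 < e t by exact: expR_gt0.
have [_ iH HE [_ aeF]] := fubini_rect (m1 := mu) (m2 := mu) mI measurableT integrable_F.
pose H t := \int[mu]_(x in `]0, T[) F x t.
have ieM g : mu.-integrable `]0, T[ (EFin \o g) -> mu.-integrable `]0, T[ (EFin \o (fun x => e x * g x)).
  move=> ig; apply: integrable_continuousM ig => x.
  apply: (@continuous_comp _ _ _ (fun x => - (s * x)) expR); last exact: continuous_expR.
  by apply: cvgN; apply: cvgM; [exact: cvg_cst|exact: cvg_id].
have LE : \int[mu]_(x in `]0, T[) \int[mu]_t F x t = K * \int[mu]_(x in `]0, T[) (e x * phi x).
  have ieph := ieM _ iphi.
  transitivity (\int[mu]_(x in `]0, T[) (K * (e x * phi x))); last exact: RintegralZl.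
  apply: eq_Rintegral => x _; have [ik kE] := translated_kern_integral x s_gt0.
  have -> : \int[mu]_t F x t = phi x * \int[mu]_t (k (t - x) * e t) by exact: RintegralZl.
  by rewrite kE /K /e; ring.
have de x : is_derive x (1 : R) e (- s * e x).
  have h1 : is_derive x (1 : R) (fun x => - (s * x)) (- s).
    by apply: is_derive_eq; rewrite /GRing.scale/=; ring.
  have h2 := @is_derive1_comp R expR (fun x => - (s * x)) x _ _ (is_derive_expR _) h1.
  by apply: is_derive_eq h2 _; rewrite mulrC.
have iw : mu.-integrable `]0, T[ (EFin \o w) by exact: integrable_within_continuous.
have ce : {within `[0, T], continuous (fun x => - s * e x)}.
  apply: continuous_subspaceT => x; apply: cvgM; first exact: cvg_cst.
  apply/differentiable_continuous/derivable1_diffP; by have [] := de x.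
have phiE : \int[mu]_(x in `]0, T[) (e x * phi x) =
    s * \int[mu]_(t in `]0, T[) (e t * w t) - w 0 + e T * w T.
  have ide := integrable_within_continuous ce.
  have eE t : 0 < t -> t <= T -> e t = e 0 + \int[mu]_(x in `]0, t[) (- s * e x).
    move=> t0 tT; have ce' : {within `[0, t], continuous (fun x => - s * e x)}.
      by apply: continuous_subspaceW ce; apply: subset_itvl; rewrite bnd_simp.
    have de' x : 0 <= x -> x <= t -> is_derive x (1 : R) e (- s * e x) by move=> _ _; exact: de.
    have h := Rintegral_FTC t0 ce' de'.
    rewrite h.
    by rewrite addrCA subrr addr0.
  have := integration_by_parts_density T_gt0 iphi ide wE eE.
  have -> : \int[mu]_(t in `]0, T[) (phi t * e t) = \int[mu]_(t in `]0, T[) (e t * phi t).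
    by apply: eq_Rintegral => t _; rewrite mulrC.
  move=> ->.
  have -> : \int[mu]_(t in `]0, T[) (w t * (- s * e t)) = - s * \int[mu]_(t in `]0, T[) (e t * w t).
    have <- := RintegralZl (- s) mI (ieM _ iw).
    by apply: eq_Rintegral => t _; ring.
  have -> : e 0 = 1 by rewrite /e mulr0 oppr0 expR0.
  ring.
have H0 t : t <= 0 -> H t = 0.
  move=> t0; transitivity (\int[mu]_(x in `]0, T[) (cst 0 x)); last by rewrite Rintegral_cst ?mul0r.
  apply: eq_Rintegral => x; rewrite inE/= in_itv/= => /andP[x0 _].
  by rewrite /F /k /kern subr_gt0 ltNge (le_trans t0 (ltW x0))/= mul0r mulr0.
pose Q t := \int[mu]_(x in `]0, T[) (phi x * k (t - x)).
have cancel3 (a b d : R) : d != 0 -> d^-1 * (a * (b * d)) = a * b by move=> d0; field.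
(* Pulling exp(-s t) out of the integral requires an integrable slice, which Fubini provides for
   almost every t. *)
have HQ : {ae mu, forall t, H t = e t * Q t}.
  apply: (@filterS _ _ (ae_filter_ringOfSetsType mu) _ _ _ aeF) => t /(_ I) iFt.
  have iQ : mu.-integrable `]0, T[ (EFin \o (fun x => phi x * k (t - x))).
    apply: (eq_integrable mI _ _ _ (integrableZl mI (e t)^-1 iFt)) => x _.
    change (((e t)^-1 * (phi x * (k (t - x) * e t)))%:E = (phi x * k (t - x))%:E).
    by rewrite (cancel3 _ _ _ (lt0r_neq0 (e_gt0 t))).
  rewrite /H /Q; have <- := RintegralZl (e t) mI iQ.
  by apply: eq_Rintegral => x _; rewrite /F; ring.
have Hle : {ae mu, forall t, `]T, +oo[%classic t -> `|H t| <= 2 * M * (k (t - T) * e t)}.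
  apply: (@filterS _ _ (ae_filter_ringOfSetsType mu) _ _ _ HQ) => t HQt.
  rewrite /= in_itv/= andbT => Tt.
  rewrite HQt normrM (gtr0_norm (e_gt0 t)) (mulrC (e t)) [leRHS]mulrA.
  by apply: ler_wpM2r; [exact: ltW (e_gt0 t)|exact: convolution_tail_le Tt].
have Hc : {ae mu, forall t, `]0, T[%classic t -> H t = Gamma (1 - alpha) * (e t * c t)}.
  have hc := cE.
  apply: (@filterS2 _ _ (ae_filter_ringOfSetsType mu) _ _ _ _ hc HQ) => t ct HQt tI.
  rewrite HQt (ct tI) [RHS](mulrCA _ (e t)) [X in _ = _ * X]mulrA (mulfV (lt0r_neq0 G0)) mul1r; congr (_ * _).
  rewrite [LHS]Rintegral_mkcond [RHS]Rintegral_mkcond; apply: eq_Rintegral => x _.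
  move: tI; rewrite /= !patchE in_itv/= => /andP[t0 tT].
  case: ifPn => xT; case: ifPn => xt.
  - by [].
  - have -> : k (t - x) = 0; last by rewrite mulr0.
    move: xt; rewrite notin_setE/= => xt; rewrite /k /kern.
    suff -> : (0 < t - x) = false by [].
    apply/negbTE; rewrite subr_gt0; apply/negP => xt'; apply: xt.
    by move: xT; rewrite inE/= !in_itv/= xt' andbT => /andP[].
  - move: xT; rewrite notin_setE/= => xT; exfalso; apply: xT.
    by move: xt; rewrite inE/= !in_itv/= => /andP[-> xt]; exact: lt_trans tT.
  - by [].
have iH' : mu.-integrable setT (EFin \o H) := iH.
have HE' : \int[mu]_(x in `]0, T[) \int[mu]_t F x t = \int[mu]_t H t := HE.
clear iH HE HQ; clearbody H.
have iHS (S : set RR) : measurable S -> mu.-integrable S (EFin \o H).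
  by move=> mS; exact: (integrableS measurableT mS (@subsetT _ _) iH').
have split1 : \int[mu]_t H t = \int[mu]_(t in `]0, T]) H t + \int[mu]_(t in `]T, +oo[) H t.
  have -> : \int[mu]_t H t = \int[mu]_(t in `]0, +oo[) H t.
    rewrite [RHS]Rintegral_mkcond; apply: eq_Rintegral => t _; rewrite patchE.
    case: ifPn; first by [].
    rewrite notin_setE/= in_itv/= andbT => /negP; rewrite -leNgt.
    exact: H0.
  have E : `]0, +oo[%classic = `]0, T] `|` `]T, +oo[ :> set R.
    by rewrite -itv_bndbnd_setU// bnd_simp// ltW.
  rewrite E Rintegral_setU//; first by rewrite -E; exact: iHS.
  apply/disj_set2P/seteqP; split => // t []; rewrite /= !in_itv/= andbT => /andP[_ tT].
  by rewrite ltNge tT.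
have mid : \int[mu]_(t in `]0, T]) H t = Gamma (1 - alpha) * \int[mu]_(t in `]0, T[) (e t * c t).
  rewrite -Rintegral_itv_bndo_bndc; last exact: iHS.
  have iec := ieM _ ic.
  have <- := RintegralZl (Gamma (1 - alpha)) mI iec.
  apply: (congr1 fine); apply: ae_eq_integral; first exact: mI.
  - exact: measurable_int (iHS _ mI).
  - exact: measurable_int (integrableZl mI (Gamma (1 - alpha)) iec).
  - apply: (@filterS _ _ (ae_filter_ringOfSetsType mu) _ _ _ Hc) => t h tI.
    by rewrite h.
have tail : `|\int[mu]_(t in `]T, +oo[) H t| <= 2 * M * (e T * K).
  have [ik kE] := translated_kern_integral T s_gt0.
  have M0 : 0 <= M by apply: le_trans (wM (lexx 0) (ltW T_gt0)).
  have mJ : measurable (`]T, +oo[%classic : set RR) by [].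
  have iKJ := integrableS measurableT mJ (@subsetT _ _) ik.
  apply: le_trans (le_normr_Rintegral mJ (iHS _ mJ)) _.
  move: kE; rewrite -/(e T) -/K => <-.
  have mnH : measurable_fun (`]T, +oo[%classic : set RR) (fun t => `|H t|).
    by apply: measurableT_comp => //; have /measurable_EFinP := measurable_int _ (iHS _ mJ).
  apply: (@le_trans _ _ (\int[mu]_(t in `]T, +oo[) (2 * M * (k (t - T) * e t)))).
    have i2 := integrableZl mJ (2 * M) iKJ.
    apply: fine_le; [exact: (integrable_fin_num mJ (integrable_norm (iHS _ mJ)))|exact: (integrable_fin_num mJ i2)|].
    apply: ae_ge0_le_integral => //.
    - exact/measurable_EFinP.
    - move=> t _; rewrite lee_fin; apply: mulr_ge0; first by apply: mulr_ge0.
      by apply: mulr_ge0; [exact: kern_ge0|exact: ltW (e_gt0 t)].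
    - exact: measurable_int i2.
  have -> := RintegralZl (2 * M) mJ iKJ; rewrite ler_wpM2l ?mulr_ge0// /Rintegral.
  apply: fine_le; [exact: (integrable_fin_num mJ iKJ)|exact: (integrable_fin_num measurableT ik)|].
  apply: ge0_subset_integral => //; first exact: measurable_int ik.
  by move=> t _; rewrite lee_fin; apply: mulr_ge0; [exact: kern_ge0|exact: ltW (e_gt0 t)].
(* The exact transform, split at T. *)
have main : K * \int[mu]_(x in `]0, T[) (e x * phi x) = Gamma (1 - alpha) * \int[mu]_(t in `]0, T[) (e t * c t) + \int[mu]_(t in `]T, +oo[) H t.
  by rewrite -LE HE' -mid -split1.
rewrite -(ler_pM2l G0) -[X in X * `|_|](gtr0_norm G0) -normrM.
rewrite phiE in main.
have -> : Gamma (1 - alpha) * (\int[mu]_(t in `]0, T[) (expR (- (s * t)) * c t) -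
    s `^ (alpha - 1) * (s * \int[mu]_(t in `]0, T[) (expR (- (s * t)) * w t)
       - w 0 + expR (- (s * T)) * w T)) = - \int[mu]_(t in `]T, +oo[) H t.
  move: main; rewrite /K /e; set a1 := Rintegral _ _ _; set a2 := Rintegral _ _ _; set a3 := Rintegral _ _ _.
  by move=> h; rewrite mulrBr mulrA (mulrC (Gamma _) (s `^ _)) h; ring.
by rewrite normrN (le_trans tail)// /K /e le_eqVlt; apply/orP; left; apply/eqP; ring.
Qed.

End caputo_laplace.

(** * Mikusinski's theorem *)

Section mikusinski.
Context {R : realType}.
Local Notation mu := (@lebesgue_measure R).
Local Notation RR := (measurableTypeR R).

Lemma series_exp_coeff_le (z : R) m : 0 <= z -> series (exp_coeff z) m <= expR z.
Proof.
move=> z0; apply: nondecreasing_cvgn_le; last exact: is_cvg_series_exp_coeff.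
by apply: nondecreasing_series => n _ _; exact: exp_coeff_ge0.
Qed.

Lemma normr_series_exp_coeff_le (z : R) m : `|series (exp_coeff z) m| <= expR `|z|.
Proof.
apply: le_trans (series_exp_coeff_le m (normr_ge0 z)).
rewrite /series /=; apply: le_trans (ler_norm_sum _ _ _) _.
by apply: ler_sum => k _; rewrite /exp_coeff /= normrM normrX [`|_^-1|]ger0_norm// invr_ge0.
Qed.

Lemma cvg_expR_natM_lt0 (d : R) : d < 0 -> expR (n%:R * d) @[n --> \oo] --> (0 : R).
Proof.
move=> d0.
have h : n%:R * - d @[n --> \oo] --> +oo.
  by apply/cvgryPge => A; near=> n; rewrite -ler_pdivrMr ?oppr_gt0//; near: n; exact: nbhs_infty_ger.
have := cvg_comp _ _ h (@cvgr_expR R); apply: cvg_trans; apply: near_eq_cvg.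
by near=> n; rewrite /= mulrN opprK.
Unshelve. all: by end_near. Qed.

Variables (L : R) (f : R -> R).
Hypothesis L0 : 0 < L.
Hypothesis cf : {within `[0, L], continuous f}.

Let I (s : R) := \int[mu]_(x in `]0, L[) (expR (s * x) * f x).

Let iexp (s c : R) : continuous (fun x : R => expR (s * x + c)).
Proof.
move=> x; apply: continuous_comp; last exact: continuous_expR.
apply: cvgD; last exact: cvg_cst.
by apply: cvgM; [exact: cvg_cst|exact: cvg_id].
Qed.

Let ifL : mu.-integrable `]0, L[ (EFin \o f).
Proof. exact: integrable_within_continuous. Qed.

(** Partial sums of the series of exp(-z) with z = exp(n (x - t)). *)
Let partial (n : R) (t : R) m x := series (exp_coeff (- expR (n * x - n * t))) m.

Let partial_cts n t m : continuous (partial n t m).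
Proof.
move=> x; rewrite /partial; elim: m => [|m IH].
  rewrite /series /=; under eq_fun do rewrite big_geq//; exact: cvg_cst.
have E y : series (exp_coeff (- expR (n * y - n * t))) m.+1 =
    series (exp_coeff (- expR (n * y - n * t))) m + exp_coeff (- expR (n * y - n * t)) m.
  by rewrite seriesSr.
rewrite /continuous_at E; under eq_fun do rewrite E.
apply: cvgD; first exact: IH.
apply: cvgM; last exact: cvg_cst.
apply: (@continuous_comp _ _ _ (fun x => - expR (n * x - n * t)) (fun z => z ^+ m)).
  by apply: cvgN; exact: iexp.
exact: exprn_continuous.
Qed.

(** The k-th power of exp(n x) is exp(k n x), so integration term by term produces moments at
    multiples of n only. *)
Let partial_integral n t m :
  \int[mu]_(x in `]0, L[) (partial n t m x * f x) =
  \sum_(0 <= k < m) (- expR (- n * t)) ^+ k / k`!%:R * I (k%:R * n).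
Proof.
elim: m => [|m IH].
  rewrite big_geq// (_ : (fun x => _) = cst 0); first by rewrite /Rintegral integral0.
  by apply/funext => x; rewrite /partial /series /= big_geq// mul0r.
rewrite big_nat_recr//= -IH.
transitivity (\int[mu]_(x in `]0, L[) (partial n t m x * f x +
    (- expR (- n * t)) ^+ m / m`!%:R * (expR (m%:R * n * x) * f x))).
  apply: eq_Rintegral => x _; rewrite /partial seriesSr mulrDl; congr (_ + _).
  have -> : expR (m%:R * n * x) = expR (n * x) ^+ m by rewrite -mulrA expRM_natl.
  have -> : n * x - n * t = - n * t + n * x by ring.
  by rewrite /exp_coeff /= expRD -mulNr exprMn; ring.
have i1 := integrable_continuousM (@partial_cts n t m) ifL.
have i2 : mu.-integrable `]0, L[ (EFin \o (fun x => expR (m%:R * n * x) * f x)).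
  have := integrable_continuousM (@iexp (m%:R * n) 0) ifL.
  by apply: eq_integrable => // x _; rewrite /= addr0.
rewrite RintegralD//; last exact: (integrableZl (measurable_itvoo 0 L) _ i2).
by rewrite RintegralZl.
Qed.

(* [1 - exp (- z)] with [z = exp (n (x - t))] tends to the indicator of [x > t]. *)
Let J (n t : R) := \int[mu]_(x in `]0, L[) ((expR (- expR (n * x - n * t)) - 1) * f x).

Let mf : measurable_fun `]0, L[ f.
Proof. exact: integrable_Rintegral_le. Qed.

(** The series of absolute values dominates the partial sums. Taking m + 1 terms guarantees the term
    k = 0, which [- I 0] removes, so only positive multiples of n remain to be bounded. *)
Let partial_cvg n t : 0 <= n ->
  \int[mu]_(x in `]0, L[) (partial n t m.+1 x * f x) - I 0 @[m --> \oo] --> J n t.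
Proof.
move=> n0.
have iabs : mu.-integrable `]0, L[ (EFin \o (fun x => `|f x|)) by exact: integrable_norm.
have cee : continuous (fun x : R => expR (expR (n * x - n * t))).
  by move=> x; apply: continuous_comp; [exact: iexp|exact: continuous_expR].
have cee' : continuous (fun x : R => expR (- expR (n * x - n * t))).
  by move=> x; apply: continuous_comp; [apply: cvgN; exact: iexp|exact: continuous_expR].
have [||||_ cv] := @dominated_cvg_Rintegral R `]0, L[ (fun m x => partial n t m.+1 x * f x)
  (fun x => expR (- expR (n * x - n * t)) * f x) (fun x => expR (expR (n * x - n * t)) * `|f x|)
  (measurable_itvoo 0 L).
- move=> m; apply: measurable_funM => //.
  by apply: measurable_funTS; apply: continuous_measurable_fun; exact: partial_cts.
- move=> x _; apply: cvgM; last exact: cvg_cst.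
  have := is_cvg_series_exp_coeff (- expR (n * x - n * t)).
  by rewrite -(cvg_shiftS (series _)).
- exact: integrable_continuousM.
- move=> m x _; rewrite normrM ler_wpM2r//.
  by apply: le_trans (normr_series_exp_coeff_le _ _) _; rewrite normrN gtr0_norm ?expR_gt0.
have -> : J n t = \int[mu]_(x in `]0, L[) (expR (- expR (n * x - n * t)) * f x) - I 0.
  rewrite /J /I -RintegralB//.
  - by apply: eq_Rintegral => x _; rewrite mul0r expR0 mulrBl.
  - exact: integrable_continuousM.
  - by apply: eq_integrable ifL => // x _; rewrite /= mul0r expR0 mul1r.
by apply: cvgB cv _; exact: cvg_cst.
Qed.

(** The bound on the moments turns the k-th term into C exp(n (e - t))^k / k!, and these sum to an
    exponential without its constant term. *)
Let J_bound n t C e : 0 < e -> 0 <= C -> 0 < n ->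
  (forall k, (0 < k)%N -> `|I (k%:R * n)| <= C * expR (e * (k%:R * n))) ->
  `|J n t| <= C * (expR (expR (n * (e - t))) - 1).
Proof.
move=> e0 C0 n0 HI.
have cv : `|\int[mu]_(x in `]0, L[) (partial n t m.+1 x * f x) - I 0| @[m --> \oo] --> `|J n t|.
  by apply: cvg_norm; apply: partial_cvg; exact: ltW.
apply: (cvgr_to_le cv); near=> m.
rewrite partial_integral big_nat_recl//= expr0 fact0 divr1 mul1r mul0r addrAC subrr add0r.
apply: (@le_trans _ _ (C * \sum_(0 <= k < m) (expR (n * (e - t))) ^+ k.+1 / k.+1`!%:R)).
  rewrite mulr_sumr; apply: le_trans (ler_norm_sum _ _ _) _.
  apply: ler_sum => k _; rewrite !normrM normrX normrN normfV.
  rewrite [`|expR _|]gtr0_norm ?expR_gt0// [`|_%:R|]ger0_norm//.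
  apply: le_trans (ler_wpM2l _ (HI k.+1 isT)) _.
    by rewrite mulr_ge0// ?exprn_ge0 ?expR_ge0.
  rewrite le_eqVlt; apply/orP; left; apply/eqP.
  have -> : expR (n * (e - t)) ^+ k.+1 = expR (- n * t) ^+ k.+1 * expR (e * (k.+1%:R * n)).
    have -> : e * (k.+1%:R * n) = k.+1%:R * (n * e) by ring.
    by rewrite expRM_natl -exprMn -expRD; congr (expR _ ^+ _); ring.
  ring.
apply: ler_wpM2l => //.
have := series_exp_coeff_le m.+1 (expR_ge0 (n * (e - t))).
rewrite /series /= big_nat_recl// /exp_coeff /= expr0 fact0 divr1; lra.
Unshelve. all: by end_near. Qed.

Let J_cvg t : 0 < t -> t < L ->
  J n%:R t @[n --> \oo] --> - \int[mu]_(x in `]t, L[) f x.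
Proof.
move=> t0 tL.
(* The pointwise limit; its odd value at x = t is that of exp(-1) - 1, the same for every n. *)
pose G x : R := if x < t then 0 else if t < x then - f x else (expR (-1) - 1) * f x.
have iabs : mu.-integrable `]0, L[ (EFin \o (fun x => `|f x|)) by exact: integrable_norm.
have [||||iG cv] := @dominated_cvg_Rintegral R `]0, L[
  (fun n x => (expR (- expR (n%:R * x - n%:R * t)) - 1) * f x) G (fun x => `|f x|)
  (measurable_itvoo 0 L).
- move=> n; apply: measurable_funM => //.
  apply: measurable_funTS; apply: continuous_measurable_fun => x.
  apply: cvgB; last exact: cvg_cst.
  by apply: continuous_comp; [apply: cvgN; exact: iexp|exact: continuous_expR].
- move=> x _; rewrite /G.
  rewrite (_ : (fun n => _) = (fun n : nat => (expR (- expR (n%:R * (x - t))) - 1) * f x)); last first.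
    by apply/funext => n; rewrite mulrBr.
  have [xt|xt|->] := ltgtP x t.
  + rewrite -[X in _ --> X](mul0r (f x)); apply: cvgM; last exact: cvg_cst.
    rewrite -[X in _ --> X](subrr 1); apply: cvgB; last exact: cvg_cst.
    rewrite -[X in _ --> X](expR0 R) -[X in expR X]oppr0.
    apply: continuous_cvg; first exact: continuous_expR.
    by apply: cvgN; apply: cvg_expR_natM_lt0; rewrite subr_lt0.
  + rewrite -[X in _ --> X]mulN1r; apply: cvgM; last exact: cvg_cst.
    rewrite -[X in _ --> X]sub0r; apply: cvgB; last exact: cvg_cst.
    have := @cvg_expR_natM_lt0 (t - x); rewrite subr_lt0 => /(_ xt) h.
    apply: (squeeze_cvgr _ (cvg_cst 0) h); near=> n; rewrite expR_ge0/= ler_expR.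
    by have := expR_ge1Dx (n%:R * (x - t)); lra.
  + rewrite (_ : (fun n => _) = cst ((expR (-1) - 1) * f t)); first exact: cvg_cst.
    by apply/funext => n; rewrite subrr mulr0 expR0.
- exact: iabs.
- move=> n x _; rewrite normrM ler_piMl// distrC.
  have h1 : expR (- expR (n%:R * x - n%:R * t)) <= 1.
    by rewrite -expR0 ler_expR oppr_le0 expR_ge0.
  have h2 := expR_ge0 (- expR (n%:R * x - n%:R * t)).
  by rewrite ger0_norm; lra.
have -> : - (\int[mu]_(x in `]t, L[) f x) = \int[mu]_(x in `]0, L[) G x.
  have sub1 : `]t, L[ `<=` `]0, L[ by apply: subset_itvr; rewrite bnd_simp ltW.
  have sub2 : `]0, t[ `<=` `]0, L[ by apply: subset_itvl; rewrite bnd_simp ltW.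
  have iGt : mu.-integrable `]0, t[ (EFin \o G) by exact: integrableS iG.
  have := @Rintegral_itvB R G (BRight 0) (BLeft L) t iG (ltW t0) tL.
  rewrite -Rintegral_itv_bndo_bndc//.
  rewrite (_ : (\int[mu]_(x in `]0, t[) G x) = 0) ?subr0 => [->|]; last first.
    rewrite (_ : (\int[mu]_(x in `]0, t[) G x) = \int[mu]_(x in `]0, t[) 0); first by rewrite /Rintegral integral0.
    by apply: eq_Rintegral => x; rewrite inE/= in_itv/= /G => /andP[_ ->].
  rewrite -mulN1r -RintegralZl//; last by apply: integrableS ifL.
  apply: eq_Rintegral => x; rewrite inE/= in_itv/= /G => /andP[tx _].
  by rewrite ltNge ltW//= tx mulN1r.
exact: cv.
Unshelve. all: by end_near. Qed.

(** Phragmen's double exponential: [J n t] tends to minus the integral of [f] over ]t, L[, while its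
    expansion in moments tends to 0 as soon as the growth rate e is below t. All these tail
    integrals vanish, hence so does the continuous function [f]. *)
Theorem mikusinski :
  (forall e : R, 0 < e -> exists (C : R) (n0 : nat), forall n, (n0 <= n)%N ->
    `|\int[mu]_(x in `]0, L[) (expR (n%:R * x) * f x)| <= C * expR (e * n%:R)) ->
  forall t, 0 < t -> t < L -> f t = 0.
Proof.
move=> H.
have tail0 t : 0 < t -> t < L -> \int[mu]_(x in `]t, L[) f x = 0.
  (* The rate t / 2 makes n (t / 2 - t) tend to minus infinity. *)
  move=> t0 tL; have t20 : 0 < t / 2 by rewrite divr_gt0.
  have [C [n0 HC]] := H _ t20.
  have cJ := J_cvg t0 tL.
  suff J0 : J n%:R t @[n --> \oo] --> (0 : R).
    by apply/eqP; rewrite -oppr_eq0; apply/eqP; exact: cvg_unique cJ J0.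
  have : `|C| * (expR (expR (n%:R * (t / 2 - t))) - 1) @[n --> \oo] --> `|C| * (expR 0 - 1).
    apply: cvgM; first exact: cvg_cst.
    apply: cvgB; last exact: cvg_cst.
    apply: continuous_cvg; first exact: continuous_expR.
    by apply: cvg_expR_natM_lt0; lra.
  rewrite expR0 subrr mulr0 => B0.
  apply/norm_cvg0P; apply: (squeeze_cvgr _ (cvg_cst 0) B0); near=> n.
  rewrite normr_ge0/=; apply: J_bound => //.
    by rewrite ltr0n; near: n; exact: nbhs_infty_gt.
  move=> k k0; rewrite -natrM; apply: (le_trans (HC _ _)).
    apply: (@leq_trans n); first by near: n; exact: nbhs_infty_ge.
    by rewrite leq_pmull.
  by rewrite ler_wpM2r ?expR_ge0// ler_norm.
move=> t t0 tL; apply: (continuous_integral_itv0 ifL) => //.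
- by move/(continuous_within_itvP _ L0) : cf => [h _ _] x Dx; exact: h.
- move=> a b a0 ab bL; have aL := lt_trans ab bL.
  have iaL : mu.-integrable `]a, L[ (EFin \o f).
    by apply: integrableS ifL => //; apply: subset_itvr; rewrite bnd_simp ltW.
  have := @Rintegral_itvB R f (BRight a) (BLeft L) b iaL (ltW ab) bL.
  rewrite (tail0 a)// (tail0 b)//; last exact: lt_trans ab.
  rewrite -Rintegral_itv_bndo_bndc; first by lra.
  by apply: integrableS iaL => //; apply: subset_itvl; rewrite bnd_simp ltW.
- by rewrite /= in_itv/= t0.
Unshelve. all: by end_near. Qed.

End mikusinski.

(** * Variation of constants *)

Section sinh_kernel.
Context {R : realType}.
Local Notation mu := (@lebesgue_measure R).
Local Notation RR := (measurableTypeR R).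

Definition sinhR (x : R) : R := (expR x - expR (- x)) / 2.

Lemma is_derive_expR_affine (a b x : R) :
  is_derive x (1 : R) (fun x : R => expR (a * x + b)) (a * expR (a * x + b)).
Proof.
have h1 : is_derive x (1 : R) (fun x : R => a *: x) (a *: (1 : R)).
  exact: (@is_deriveZ _ _ _ (@id R)).
have h2 : is_derive x (1 : R) (fun _ : R => b) 0 by exact: is_derive_cst.
have h3 := is_deriveD h1 h2; rewrite addr0 /GRing.scale /= mulr1 in h3.
rewrite mulrC; exact: (@is_derive1_comp _ expR (fun x : R => a * x + b)).
Qed.

Lemma continuous_sinh_affine (m X : R) : continuous (fun x : R => sinhR (m * (X - x))).
Proof.
move=> x; apply: cvgM; last exact: cvg_cst.
have c : continuous (fun x : R => m * (X - x)).
  by move=> z; apply: cvgM; [exact: cvg_cst|apply: cvgB; [exact: cvg_cst|exact: cvg_id]].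
apply: cvgB; apply: continuous_comp; try exact: continuous_expR; first exact: c.
by apply: cvgN; exact: c.
Qed.

Lemma sinhR_bound (x : R) : 0 <= x -> 0 <= sinhR x <= expR x.
Proof.
move=> x0; have h1 := expR_ge0 (- x); have h2 : expR (- x) <= expR x by rewrite ler_expR; lra.
rewrite /sinhR; apply/andP; split; lra.
Qed.

(** Taylor's formula with integral remainder for sinh, which equals its own second derivative; the
    linear part will reproduce [m * W X]. *)
Lemma integral_sinh_taylor (m X y : R) : m != 0 -> y < X ->
  \int[mu]_(x in `]y, X[) (m ^+ 2 * sinhR (m * (X - x)) * (x - y)) =
  sinhR (m * (X - y)) - m * (X - y).
Proof.
move=> m0 yX.
pose E1 x := expR (- m * x + m * X); pose E2 x := expR (m * x + - (m * X)).
have EE1 x : expR (m * (X - x)) = E1 x by rewrite /E1; congr expR; ring.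
have EE2 x : expR (- (m * (X - x))) = E2 x by rewrite /E2; congr expR; ring.
(* (y - x) m cosh(m (X - x)) - sinh(m (X - x)), found by parts. *)
pose F x := (y - x) * (m / 2 * (E1 x + E2 x)) - 2^-1 * (E1 x - E2 x).
have cs := @continuous_sinh_affine m X.
pose K x := m ^+ 2 * sinhR (m * (X - x)) * (x - y).
suff dF : forall x : R, is_derive x (1 : R) F (K x).
  rewrite (@Rintegral_FTC _ K F _ _ yX _ (fun x _ _ => dF x)).
    by rewrite /F /sinhR !EE1 !EE2 -(EE1 X) -(EE2 X) subrr mulr0 oppr0 expR0; lra.
  apply: continuous_subspaceT => x; apply: cvgM; first by apply: cvgM; [exact: cvg_cst|exact: cs].
  by apply: cvgB; [exact: cvg_id|exact: cvg_cst].
move=> x; have d1 : is_derive x (1 : R) E1 (- m * E1 x) := is_derive_expR_affine (- m) (m * X) x.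
have d2 : is_derive x (1 : R) E2 (m * E2 x) := is_derive_expR_affine m (- (m * X)) x.
have d3 : is_derive x (1 : R) (fun x => y - x) (- 1).
  by have := is_deriveB (is_derive_cst y x (1 : R)) (is_derive_id x (1 : R)); rewrite sub0r.
have d4 := is_deriveD d1 d2; have d5 := is_deriveB d1 d2.
have d6 := is_deriveZ (m / 2) d4; have d7 := is_deriveZ (2^-1) d5.
have d8 := is_deriveB (is_deriveM d3 d6) d7.
have {}d8 : is_derive x (1 : R) F _ := d8.
apply: is_derive_eq d8 _.
rewrite /K /sinhR EE1 EE2.
change ((y - x) * (m / 2 * (- m * E1 x + m * E2 x)) + (m / 2 * (E1 x + E2 x)) * -1 -
  2^-1 * (- m * E1 x - m * E2 x) = m ^+ 2 * ((E1 x - E2 x) / 2) * (x - y)).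
by ring.
Qed.

(* [W] solves [W'' = c] with zero Cauchy data: pairing with [sinh (m (X - x))], which solves
   [psi'' = m^2 psi], gives the variation of constants formula. *)
Lemma sinh_pairing (m X : R) (W c : R -> R) : m != 0 -> 0 < X ->
  mu.-integrable `]0, X[ (EFin \o c) ->
  mu.-integrable `]0, X[ (EFin \o W) ->
  {ae mu, forall x, `]0, X[%classic x -> W x = \int[mu]_(y in `]0, x[) ((x - y) * c y)} ->
  W X = \int[mu]_(y in `]0, X[) ((X - y) * c y) ->
  m * W X = \int[mu]_(y in `]0, X[) (sinhR (m * (X - y)) * (c y - m ^+ 2 * W y)).
Proof.
move=> m0 X0 ic iW Wae WX.
have mI := measurable_itvoo 0 X.
pose K x := m ^+ 2 * sinhR (m * (X - x)).
have cK : continuous K by move=> x; apply: cvgM; [exact: cvg_cst|exact: continuous_sinh_affine].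
have [MK HMK] := continuous_bounded_itv (@continuous_subspaceT _ _ `[0, X] _ cK).
have mX : measurable_fun `]0, X[ c by exact: integrable_Rintegral_le.
have cK' y : continuous (fun x => K x * (x - y)).
  by move=> x; apply: cvgM; [exact: cK|apply: cvgB; [exact: cvg_id|exact: cvg_cst]].
(* Integrating m^2 sinh(m (X - x)) W(x) with W replaced by its double primitive and exchanging the
   order leaves, for each y, the Taylor remainder above times c(y). *)
have [] := @fubini_triangle R 0 X (fun x y => K x * (x - y) * c y) (cst (MK * X))
  (fun y => `|c y|) _ _ _ _.
- have mK1 : measurable_fun `]0, X[ (fun x => K x * x).
    apply: measurable_funTS; apply: continuous_measurable_fun => x.
    by apply: cvgM; [exact: cK|exact: cvg_id].
  have mK2 : measurable_fun `]0, X[ K by apply: measurable_funTS; exact: continuous_measurable_fun.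
  have m1 := measurable_fun_prod_mul mI mI mK1 mX.
  have m2 := measurable_fun_prod_mul mI mI mK2 (measurable_funM (@measurable_id _ _ _) mX).
  have := measurable_funB m1 m2; apply: eq_measurable_fun => z _ /=; ring.
- apply: measurable_bounded_integrable => //.
    by rewrite /= lebesgue_measure_itv/= lte_fin X0 ltry.
  by exists `|MK * X|; split; [exact: num_real|move=> N MN z _; rewrite /= ltW].
- exact: integrable_norm.
- move=> x y y0 yx xX; rewrite normrM ler_wpM2r// normrM.
  apply: ler_pM => //.
    by apply: HMK; rewrite in_itv/= (ltW xX) (ltW (lt_trans y0 yx)).
  by rewrite gtr0_norm; lra.
move=> i1 i2 e.
have sub y : 0 < y -> `]y, X[ `<=` `]0, X[.
  by move=> y0; apply: subset_itvr; rewrite bnd_simp ltW.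
have E2 y : y \in `]0, X[%classic -> \int[mu]_(x in `]y, X[) (K x * (x - y) * c y) =
    sinhR (m * (X - y)) * c y - m * ((X - y) * c y).
  rewrite inE/= in_itv/= => /andP[y0 yX].
  rewrite RintegralZr//.
    by rewrite integral_sinh_taylor//; ring.
  apply: integrable_within_continuous; exact: continuous_subspaceT.
have ips : mu.-integrable `]0, X[ (EFin \o (fun y => sinhR (m * (X - y)) * c y)).
  by apply: integrable_continuousM => //; exact: continuous_sinh_affine.
have iXc : mu.-integrable `]0, X[ (EFin \o (fun y => (X - y) * c y)).
  apply: (@integrable_continuousM _ 0 X (fun y => X - y)) => // y.
  by apply: cvgB; [exact: cvg_cst|exact: cvg_id].
have {}e : \int[mu]_(x in `]0, X[) (\int[mu]_(y in `]0, x[) (K x * (x - y) * c y)) =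
    \int[mu]_(y in `]0, X[) (sinhR (m * (X - y)) * c y) - m * W X.
  rewrite e WX -RintegralZl// -RintegralB//; last exact: (integrableZl mI m iXc).
  by apply: eq_Rintegral => y yX; rewrite E2.
have iKW : mu.-integrable `]0, X[ (EFin \o (fun x => K x * W x)).
  exact: integrable_continuousM.
have eW : \int[mu]_(x in `]0, X[) (\int[mu]_(y in `]0, x[) (K x * (x - y) * c y)) =
    \int[mu]_(x in `]0, X[) (K x * W x).
  congr fine; apply: ae_eq_integral => //.
  - exact: measurable_int i1.
  - exact: measurable_int iKW.
  apply: (@filterS _ _ (ae_filter_ringOfSetsType mu) _ _ _ Wae) => x Wx xX; rewrite (Wx xX); congr EFin.
  rewrite -RintegralZl//.
    by apply: eq_Rintegral => y _; rewrite mulrA.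
  apply: (@integrable_continuousM _ 0 x (fun y => x - y)).
    by move=> y; apply: cvgB; [exact: cvg_cst|exact: cvg_id].
  apply: integrableS ic => //; apply: subset_itvl; rewrite bnd_simp.
  by move: xX; rewrite /= in_itv/= => /andP[_ /ltW].
transitivity (\int[mu]_(y in `]0, X[) (sinhR (m * (X - y)) * c y - K y * W y)); last first.
  by apply: eq_Rintegral => y _; rewrite /K; ring.
by rewrite RintegralB// -eW e opprB addrCA subrr addr0.
Qed.

End sinh_kernel.

(** * Joint measurability *)

Section ae_eq_integral.
Local Open Scope ereal_scope.
Context d (T : measurableType d) (R : realType) (mu : {measure set T -> \bar R}).
Implicit Types (D : set T) (f g : T -> \bar R).

Import HBNNSimple.

(* The integral of a function without measurability assumptions is a supremum over simple
   functions below it, so changing the function on a null set is still harmless. *)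
Lemma ge0_integral_ae_le (N : set T) f g : measurable N -> mu N = 0 ->
  (forall x, 0 <= f x) -> (forall x, 0 <= g x) -> (forall x, ~ N x -> f x <= g x) ->
  \int[mu]_x f x <= \int[mu]_x g x.
Proof.
move=> mN N0 f0 g0 fg; rewrite !ge0_integralTE//.
apply: ge_ereal_sup => _ [h /= hf <-].
pose h' : {nnsfun T >-> R} := proj_nnsfun h (measurableC mN).
have h'E x : h' x = (h x * \1_(~` N) x)%R by [].
have -> : sintegral mu h = sintegral mu h'.
  rewrite -!integralT_nnsfun; apply: ge0_ae_eq_integral; first by [].
  - by apply/measurable_EFinP.
  - by apply/measurable_EFinP.
  - by move=> x _; rewrite lee_fin.
  - by move=> x _; rewrite lee_fin.
  exists N; split => // x /not_implyP[_]; apply: contra_notP => Nx.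
  by rewrite h'E indicE mem_set//= mulr1.
apply: ereal_sup_ubound; exists h' => // x; rewrite h'E indicE.
have [Nx|Nx] := pselect (N x); first by rewrite memNset ?mulr0//; apply.
by rewrite mem_set//= mulr1; exact: le_trans (hf x) (fg x Nx).
Qed.

(** No measurability is assumed, because the integrand of [caputo] takes arbitrary values where the
    function is not derivable. *)
Lemma integral_ae_eq D f g : {ae mu, forall x, D x -> f x = g x} ->
  \int[mu]_(x in D) f x = \int[mu]_(x in D) g x.
Proof.
move=> [N [mN N0 fgN]].
have E x : ~ N x -> (f \_ D) x = (g \_ D) x.
  move=> Nx; rewrite !patchE; case: ifPn => // /set_mem Dx.
  have : ~ ~ (D x -> f x = g x) by apply: contra_not Nx => /fgN.
  by move/contrapT; apply.
rewrite [LHS]integral_mkcond [RHS]integral_mkcond [LHS]integralE [RHS]integralE.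
have Ep x : ~ N x -> (f \_ D)^\+ x = (g \_ D)^\+ x by move=> Nx; rewrite !funeposE E.
have En x : ~ N x -> (f \_ D)^\- x = (g \_ D)^\- x by move=> Nx; rewrite !funenegE E.
congr (_ - _); apply/eqP; rewrite eq_le; apply/andP; split;
  apply: (ge0_integral_ae_le mN N0) => // x Nx; by rewrite ?Ep ?En.
Qed.

Lemma ge0_le_integral_ae D f g : (forall x, D x -> 0 <= f x) -> (forall x, D x -> 0 <= g x) ->
  {ae mu, forall x, D x -> f x <= g x} -> \int[mu]_(x in D) f x <= \int[mu]_(x in D) g x.
Proof.
move=> f0 g0 [N [mN N0 fgN]]; rewrite [leLHS]integral_mkcond [leRHS]integral_mkcond.
apply: (ge0_integral_ae_le mN N0) => x.
- by rewrite patchE; case: ifPn => // xD; apply: f0; exact: set_mem xD.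
- by rewrite patchE; case: ifPn => // xD; apply: g0; exact: set_mem xD.
- move=> Nx; rewrite !patchE; case: ifPn => // /set_mem Dx.
  have : ~ ~ (D x -> f x <= g x) by apply: contra_not Nx => /fgN.
  by move/contrapT; apply.
Qed.

End ae_eq_integral.

(** * Measurability of the function, its derivative and a convolution in both variables *)

Section joint_measurability.
Context {R : realType}.
Local Notation mu := (@lebesgue_measure R).
Local Notation RR := (measurableTypeR R).

(* Sampling [f x] on the grid of step [1 / n] gives jointly measurable functions
   with pointwise limit [f]. *)
Lemma measurable_caratheodory (f : R -> R -> R) :
  (forall t, measurable_fun (setT : set RR) (f ^~ t)) ->
  (forall x, continuous (f x)) ->
  measurable_fun (setT : set (RR * RR)) (fun z : RR * RR => f z.1 z.2).
Proof.
move=> mf cf.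
pose tau (n : nat) (t : R) : R := (Num.floor (t * n.+1%:R))%:~R / n.+1%:R.
have n0 n : 0 < n.+1%:R :> R by rewrite ltr0n.
have ctau t : tau n t @[n --> \oo] --> t.
  apply/cvgrPdist_lt => e e0; near=> n.
  have /andP[h1 h2] := floor_itv (t * n.+1%:R).
  have -> : t - tau n t = (t * n.+1%:R - (Num.floor (t * n.+1%:R))%:~R) / n.+1%:R.
    by rewrite mulrBl mulfK// lt0r_neq0.
  rewrite ger0_norm; last by rewrite divr_ge0 ?subr_ge0// ltW.
  apply: (@le_lt_trans _ _ n.+1%:R^-1); last by near: n; exact: near_infty_natSinv_lt (PosNum e0).
  rewrite -[leRHS]mul1r ler_pM2r ?invr_gt0//.
  by move: h2; rewrite intrD => h2; rewrite lerBlDl ltW.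
apply: (@measurable_fun_cvg _ _ _ setT (fun n (z : RR * RR) => f z.1 (tau n z.2))); last first.
  by move=> [x t] _ /=; apply: cvg_comp (ctau t) _; exact: cf.
move=> n _ B mB; rewrite setTI.
(* The preimage is a countable union of strips, on each of which the sampled time is constant. *)
rewrite [X in measurable X](_ : _ = \bigcup_(k in @setT int)
   (((f ^~ (k%:~R / n.+1%:R)) @^-1` B) `*` `[k%:~R / n.+1%:R, (k + 1)%:~R / n.+1%:R[%classic)); last first.
  have E (k : int) (t : R) : `[k%:~R / n.+1%:R, (k + 1)%:~R / n.+1%:R[%classic t <-> Num.floor (t * n.+1%:R) = k.
    rewrite /= in_itv/= ler_pdivrMr// ltr_pdivlMr// -floor_eq; split => [/eqP//|->//].
  apply/seteqP; split => [[x t] /= Bx|[x t] [k _] [/= Bx /E kE]].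
    exists (Num.floor (t * n.+1%:R)) => //; split => //.
    exact/E.
  by rewrite /tau kE.
apply: countable_bigcupT_measurable => // k; apply: measurableX; last by [].
by rewrite -[X in measurable X]setTI; exact: mf.
Unshelve. all: by end_near. Qed.

(** A limit superior of a sequence of difference quotients inherits joint measurability from the
    function and equals the derivative wherever that exists; [fine] sends infinite values to 0. *)
Definition upper_derivative (f : R -> R) (t : R) : R :=
  fine (limn_esup (fun n => (n.+1%:R * (f (t + n.+1%:R^-1) - f t))%:E)).

Lemma upper_derivativeE (f : R -> R) t l : is_derive t (1 : R) f l -> upper_derivative f t = l.
Proof.
move=> [df dl]; rewrite /upper_derivative.
suff h : (fun n => (n.+1%:R * (f (t + n.+1%:R^-1) - f t))%:E) @ \oo --> l%:E.
  by have [_ ->] := cvg_limn_einf_sup h.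
apply: cvg_EFin; first by near=> n.
have c0 : (fun n => n.+1%:R^-1 : R) @ \oo --> 0^'.
  have c : (fun n => n.+1%:R^-1 : R) @ \oo --> (0 : R) by exact: cvg_harmonic.
  move=> A hA; have hA' : \forall n \near \oo, (n.+1%:R^-1 : R) != 0 -> A n.+1%:R^-1 := c _ hA.
  change (\forall n \near \oo, A (n.+1%:R^-1)); apply: filterS hA' => n; apply.
  by rewrite invr_eq0 pnatr_eq0.
have dc : h^-1 *: ((f \o shift t) (h *: 1) - f t) @[h --> 0^'] --> l by rewrite -dl; exact: df.
have := cvg_comp _ _ c0 dc; apply: cvg_trans; apply: near_eq_cvg; near=> n => /=.
by rewrite invrK /GRing.scale/= mulr1 (addrC t).
Unshelve. all: by end_near. Qed.

Lemma measurable_upper_derivative (f : R -> R -> R) :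
  measurable_fun (setT : set (RR * RR)) (fun z : RR * RR => f z.1 z.2) ->
  measurable_fun (setT : set (RR * RR)) (fun z : RR * RR => upper_derivative (f z.1) z.2).
Proof.
move=> mf; apply: (measurableT_comp (fine_measurable measurableT)).
apply: measurable_fun_limn_esup => n; apply/measurable_EFinP.
apply: measurable_funM => //; apply: measurable_funB => //.
have mg : measurable_fun (setT : set (RR * RR)) (fun z : RR * RR => (z.1, z.2 + n.+1%:R^-1 : RR)).
  apply: measurable_fun_pair; first exact: measurable_fst.
  by apply: measurable_funD => //; exact: measurable_snd.
exact: (measurableT_comp mf mg).
Qed.

(** Integrability in s may fail for some parameters, so the positive and negative parts are treated
    separately by Tonelli; their difference is measurable in all cases. *)
Lemma measurable_convolution (A : set RR) (d : R -> R -> R) (k : R -> R) : measurable A ->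
  measurable_fun (setT : set (RR * RR)) (fun z : RR * RR => d z.1 z.2) ->
  measurable_fun (setT : set RR) k ->
  measurable_fun (setT : set (RR * RR))
    (fun z : RR * RR => \int[mu]_(s in A) (d z.1 s * k (z.2 - s))).
Proof.
move=> mA md mk; rewrite /Rintegral; apply: (measurableT_comp (fine_measurable measurableT)).
pose F (z : (RR * RR) * RR) : \bar R := ((\1_A z.2 * (d z.1.1 z.2 * k (z.1.2 - z.2)))%R)%:E.
have mF : measurable_fun setT F.
  apply/measurable_EFinP; apply: measurable_funM.
    by apply: (measurableT_comp (measurable_indic mA)); exact: measurable_snd.
  apply: measurable_funM.
    have mg : measurable_fun (setT : set (RR * RR * RR)) (fun z : RR * RR * RR => (z.1.1, z.2)).
      apply: measurable_fun_pair; last exact: measurable_snd.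
      by apply: (measurableT_comp measurable_fst); exact: measurable_fst.
    exact: (measurableT_comp md mg).
  apply: (measurableT_comp mk); apply: measurable_funB; last exact: measurable_snd.
  by apply: (measurableT_comp measurable_snd); exact: measurable_fst.
have E z : (\int[mu]_(s in A) (d z.1 s * k (z.2 - s))%:E = \int[mu]_s F^\+ (z, s) - \int[mu]_s F^\- (z, s))%E.
  transitivity (\int[mu]_s F (z, s))%E.
    rewrite integral_mkcond; apply: eq_integral => s _; rewrite patchE /F indicE/=.
    by case: ifP => /=; rewrite ?mul1r ?mul0r.
  rewrite integralE; congr (_ - _)%E; apply: eq_integral => s _.
    by rewrite !funeposE.
  by rewrite !funenegE.
apply: (eq_measurable_fun (fun z => \int[mu]_s F^\+ (z, s) - \int[mu]_s F^\- (z, s))%E) => [z _|]; first by rewrite E.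
apply: emeasurable_funB.
- have h := @measurable_fun_fubini_tonelli_F _ _ (RR * RR)%type RR R mu (F^\+)%E.
  apply: h; first exact: measurable_funepos.
  by move=> z; exact: funepos_ge0.
- have h := @measurable_fun_fubini_tonelli_F _ _ (RR * RR)%type RR R mu (F^\-)%E.
  apply: h; first exact: measurable_funeneg.
  by move=> z; exact: funeneg_ge0.
Qed.

End joint_measurability.

(** * Uniqueness *)

Section reflection.
Context {R : realType}.
Local Notation mu := (@lebesgue_measure R).
Local Notation RR := (measurableTypeR R).

Lemma continuous_within_reflection (L : R) (g : R -> R) :
  {within `[0, L], continuous g} -> {within `[0, L], continuous (fun x => g (L - x))}.
Proof.
move=> cg; apply/subspace_continuousP => x; rewrite /= in_itv/= => /andP[x0 xL].
have /subspace_continuousP/(_ (L - x)) := cg.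
have xI : `[0, L]%classic (L - x) by rewrite /= in_itv/= subr_ge0 xL/= gerBl.
move=> /(_ xI) h; move=> A /h; rewrite /= /within/= => hA.
have c : (L - y) @[y --> x] --> L - x by apply: cvgB; [exact: cvg_cst|exact: cvg_id].
have {c}hA' : \forall y \near x, `[0, L]%classic (L - y) -> A (g (L - y)) := c _ hA.
change (\forall y \near x, `[0, L]%classic y -> A (g (L - y))).
apply: filterS hA' => y h'; rewrite /= in_itv/= => /andP[y0 yL].
by apply: h'; rewrite /= in_itv/= subr_ge0 yL/= gerBl.
Qed.

Lemma Rintegral_reflection (L : R) (g : R -> R) : 0 < L -> {within `[0, L], continuous g} ->
  \int[mu]_(x in `]0, L[) g x = \int[mu]_(x in `]0, L[) g (L - x).
Proof.
move=> L0 cg; have cg' := continuous_within_reflection cg.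
have ig := integrable_within_continuous cg; have ig' := integrable_within_continuous cg'.
have D1 : derive1 (fun x : R => L - x) = cst (- 1).
  apply/funext => x; rewrite derive1E.
  by have := is_deriveB (is_derive_cst L x (1 : R)) (is_derive_id x (1 : R)); rewrite sub0r => -[].
have cF : continuous (fun x : R => L - x) by move=> x; apply: cvgB; [exact: cvg_cst|exact: cvg_id].
rewrite /Rintegral; congr fine.
rewrite -(@integral_itv_bndoo _ 0 L (EFin \o g) true false); last exact: measurable_int ig.
rewrite -(@integral_itv_bndoo _ 0 L (EFin \o (fun x => g (L - x))) true false); last exact: measurable_int ig'.
have := @integration_by_substitution_decreasing R (fun x => L - x) g 0 L (ltW L0).
rewrite subr0 subrr D1 => -> //.
- by apply: eq_integral => x _; rewrite !fctE opprK mulr1.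
- by move=> x y _ _ xy; exact: ler_ltB.
- by move=> x _; exact: cvg_cst.
- exact: is_cvg_cst.
- exact: is_cvg_cst.
- split.
  + by move=> x _; exact: derivableB.
  + by apply: cvg_at_right_filter; exact: cF.
  + by apply: cvg_at_left_filter; exact: cF.
Qed.

(** A Laplace transform over ]0, L[ at n, multiplied by exp(n L), is an exponential moment of the
    reflected function. *)
Lemma mikusinski_reflected (L : R) (f : R -> R) : 0 < L -> {within `[0, L], continuous f} ->
  (forall e : R, 0 < e -> exists (C : R) (n0 : nat), forall n, (n0 <= n)%N ->
    `|\int[mu]_(x in `]0, L[) (expR (n%:R * (L - x)) * f x)| <= C * expR (e * n%:R)) ->
  forall t, 0 < t -> t < L -> f t = 0.
Proof.
move=> L0 cf H t t0 tL.
have cf' := continuous_within_reflection cf.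
have := @mikusinski R L (fun x => f (L - x)) L0 cf' _ (L - t).
rewrite subr_gt0 ltrBlDl ltrDr subKr; apply => // e e0.
have [C [n0 h]] := H e e0; exists C, n0 => n /h.
rewrite (Rintegral_reflection L0); last first.
  move=> x; apply: (@continuousM R (subspace `[0, L]) (fun x => expR (n%:R * (L - x))) f x); last exact: cf.
  apply: continuous_subspaceT => {}x.
  apply: (@continuous_comp _ _ _ (fun x => n%:R * (L - x)) expR); last exact: continuous_expR.
  by apply: cvgM; [exact: cvg_cst|apply: cvgB; [exact: cvg_cst|exact: cvg_id]].
apply: le_trans; rewrite le_eqVlt; apply/orP; left; apply/eqP; congr `|_|.
by apply: eq_Rintegral => x _; rewrite subKr.
Qed.

End reflection.

(** * Caputo derivatives of absolutely continuous functions *)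

Section caputo_of_abs_continuous.
Context {R : realType}.
Local Notation mu := (@lebesgue_measure R).
Local Notation RR := (measurableTypeR R).
Variable T : R.
Hypothesis T_gt0 : 0 < T.

(** Composition with this projection extends a function of t constantly beyond [0, T], so that it is
    continuous on the line and its difference quotients are defined everywhere. *)
Definition clamp (t : R) : R := Num.max 0 (Num.min t T).

Lemma clamp_itv t : 0 <= clamp t <= T.
Proof.
by rewrite /clamp le_max lexx/= ge_max ge_min lexx orbT andbT ltW.
Qed.

Lemma clampE t : 0 <= t -> t <= T -> clamp t = t.
Proof. by move=> t0 tT; rewrite /clamp (min_idPl tT) (max_idPr t0). Qed.

Lemma clamp_lipschitz s t : `|clamp s - clamp t| <= `|s - t|.
Proof.
wlog st : s t / s <= t.
  by move=> h; case: (leP s t) => [/h//|/ltW/h]; rewrite distrC (distrC t).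
have T0 := T_gt0.
have /andP[c1 c2] : clamp s <= clamp t <= clamp s + (t - s).
  rewrite /clamp; case: (leP s T) => h1; case: (leP t T) => h2;
  case: (leP 0 s) => h3; case: (leP 0 t) => h4; case: (leP 0 T) => hT; apply/andP; split; lra.
by rewrite distrC (distrC s) !ger0_norm ?subr_ge0// lerBlDl.
Qed.

Lemma abs_continuous_clamp w : abs_continuous 0 T w -> continuous (w \o clamp).
Proof.
move=> ac t; apply/cvgrPdist_lt => e e0; have [d d0 H] := ac e e0.
near=> s; rewrite /=.
have ds : `|t - s| < d by near: s; exact: (@cvgr_dist_lt).
pose l := Num.min (clamp t) (clamp s); pose r := Num.max (clamp t) (clamp s).
have /andP[t0 tT] := clamp_itv t; have /andP[s0 sT] := clamp_itv s.
have := H 1%N (fun=> l) (fun=> r); rewrite !big_ord1.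
have rl : r - l = `|clamp t - clamp s|.
  by rewrite /r /l; case: leP => h; [rewrite distrC ger0_norm// subr_ge0|rewrite ger0_norm// subr_ge0 ltW].
have wrl : `|w r - w l| = `|w (clamp t) - w (clamp s)|.
  by rewrite /r /l; case: leP => h //; rewrite distrC.
rewrite rl wrl; apply.
- by move=> _ _; rewrite le_min t0 s0 ge_max tT sT; split=> //; rewrite -subr_ge0 rl.
- by move=> i j /=; rewrite !ltnS !leqn0 => /eqP-> /eqP->.
- by apply: le_lt_trans ds; exact: clamp_lipschitz.
Unshelve. all: by end_near. Qed.

Lemma abs_continuous_within w : abs_continuous 0 T w -> {within `[0, T], continuous w}.
Proof.
move=> /abs_continuous_clamp cw.
apply: (@subspace_eq_continuous _ _ _ (w \o clamp)).
  by move=> t; rewrite inE/= in_itv/= => /andP[t0 tT]; rewrite /= clampE.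
exact: continuous_subspaceT.
Qed.

Variable alpha : R.

(** Two formulas for two purposes. The density [phi] is chosen separately for each function and
    serves the analysis at fixed x; the formula with [upper_derivative] involves no choice and
    serves joint measurability in x and t. *)
Lemma caputo_abs_continuous w : abs_continuous 0 T w ->
  exists phi : R -> R, [/\ mu.-integrable `]0, T[ (EFin \o phi),
   forall t, 0 < t -> t <= T -> w t = w 0 + \int[mu]_(x in `]0, t[) phi x,
   forall t, 0 < t -> t <= T -> caputo alpha w t =
     (Gamma (1 - alpha))^-1 * \int[mu]_(x in `]0, t[) (phi x * kern alpha (t - x)) &
   forall t, 0 < t -> t <= T -> caputo alpha w t =
     (Gamma (1 - alpha))^-1 *
     \int[mu]_(x in `]0, T[) (upper_derivative (w \o clamp) x * kern alpha (t - x))].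
Proof.
move=> ac; have [phi [iphi wE]] := abs_continuous_density T_gt0 ac.
have ae := ae_is_derive_integral T_gt0 iphi wE.
have iS (A : set RR) : measurable A -> mu.-integrable A (EFin \o phi).
  by move=> mA; exact: (integrableS measurableT mA (@subsetT _ _) iphi).
exists phi; split.
- by apply: iS; exact: measurable_itvoo.
- move=> t t0 tT; rewrite Rintegral_itv_bndo_bndc; first exact: wE (ltW t0) tT.
  by apply: iS; exact: measurable_itvoo.
- move=> t t0 tT; rewrite /caputo; congr (_ * fine _); apply: integral_ae_eq.
  apply: (@filterS _ _ (ae_filter_ringOfSetsType mu) _ _ _ ae) => x h.
  rewrite /= in_itv/= => /andP[x0 xt].
  have [_] : is_derive x 1 w (phi x) by apply: h; rewrite /= in_itv/= x0 (lt_le_trans xt).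
  by rewrite derive1E => ->; rewrite /kern subr_gt0 xt powRN.
- move=> t t0 tT; rewrite /caputo; congr (_ * fine _).
  transitivity (\int[mu]_(x in `]0%R, t[) (upper_derivative (w \o clamp) x * kern alpha (t - x))%:E)%E.
    apply: integral_ae_eq.
    apply: (@filterS _ _ (ae_filter_ringOfSetsType mu) _ _ _ ae) => x h.
    rewrite /= in_itv/= => /andP[x0 xt].
    have dw : is_derive x 1 w (phi x) by apply: h; rewrite /= in_itv/= x0 (lt_le_trans xt).
    have dwc : is_derive x 1 (w \o clamp) (phi x).
      apply: (@near_eq_is_derive _ _ _ w) => //; near=> y; rewrite /= clampE//; apply: ltW; near: y.
        exact: lt_nbhsr.
      by apply: lt_nbhsl; exact: lt_le_trans tT.
    rewrite (upper_derivativeE dwc); have [_] := dw; rewrite derive1E => ->.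
    by rewrite /kern subr_gt0 xt powRN.
  rewrite [LHS]integral_mkcond [RHS]integral_mkcond; apply: eq_integral => x _; rewrite !patchE.
  case: ifPn => xt; case: ifPn => xT; first by [].
  + move: xT; rewrite notin_setE/= => xT; exfalso; apply: xT.
    by move: xt; rewrite inE/= !in_itv/= => /andP[-> xt]; exact: lt_le_trans tT.
  + have -> : kern alpha (t - x) = 0; last by rewrite mulr0.
    move: xt; rewrite notin_setE/= => xt; rewrite /kern.
    suff -> : (0 < t - x) = false by [].
    apply/negbTE; rewrite subr_gt0; apply/negP => xt'; apply: xt.
    by move: xT; rewrite inE/= !in_itv/= xt' andbT => /andP[].
  + by [].
Unshelve. all: by end_near. Qed.

End caputo_of_abs_continuous.

(* [u] is meant to be modified for [x] outside the full-measure set [P] and extended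
   constantly in time, so as to be jointly measurable; [u0] is the continuous initial value. *)
Section lateral_cauchy.
Context {R : realType}.
Local Notation mu := (@lebesgue_measure R).
Local Notation RR := (measurableTypeR R).

Lemma Rintegral_le_cst (X K : R) (f : R -> R) : 0 < X -> 0 <= K ->
  mu.-integrable `]0, X[ (EFin \o f) ->
  {ae mu, forall x, `]0, X[%classic x -> `|f x| <= K} ->
  `|\int[mu]_(x in `]0, X[) f x| <= K * X.
Proof.
move=> X0 K0 intf fK; have mI := measurable_itvoo 0 X.
have iK := integrable_itv_cst 0 X K.
apply: le_trans (le_normr_Rintegral mI intf) _.
have -> : K * X = \int[mu]_(x in `]0, X[) K.
  by rewrite Rintegral_cst//= lebesgue_measure_itv/= lte_fin X0/= subr0.
apply: fine_le; [exact: (integrable_fin_num mI (integrable_norm intf))|exact: (integrable_fin_num mI iK)|].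
apply: ge0_le_integral_ae.
- by move=> x _; rewrite lee_fin.
- by move=> x _; rewrite lee_fin.
- apply: (@filterS _ _ (ae_filter_ringOfSetsType mu) _ _ _ fK) => x h xI.
  by rewrite lee_fin h.
Qed.

Variables (alpha T M : R) (P : set R) (u c : R -> R -> R) (u0 : R -> R).
Hypothesis alpha_gt0 : 0 < alpha.
Hypothesis alpha_lt1 : alpha < 1.
Hypothesis T_gt0 : 0 < T.
Hypothesis M_ge0 : 0 <= M.
Hypothesis aeP : {ae mu, forall x, `]0, 1[%classic x -> P x}.
Hypothesis P01 : P `<=` `]0, 1[.
Hypothesis mu_ : measurable_fun (setT : set (RR * RR)) (fun z : RR * RR => u z.1 z.2).
Hypothesis mc : measurable_fun (setT : set (RR * RR)) (fun z : RR * RR => c z.1 z.2).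
Hypothesis cM : {ae mu, forall t, `]0, T[%classic t ->
  (\int[mu]_(y in `]0%R, 1%R[) `|(c y t)%:E| <= M%:E)%E /\
  forall x, P x -> u x t = \int[mu]_(y in `]0, x[) ((x - y) * c y t)}.
Hypothesis uM : forall x t, P x -> 0 <= t -> t <= T -> `|u x t| <= M.
Hypothesis uC : forall x, P x -> {within `[0, T], continuous (u x)}.
Hypothesis u_phi : forall x, P x -> exists phi : R -> R,
  [/\ mu.-integrable `]0, T[ (EFin \o phi),
   forall t, 0 < t -> t <= T -> u x t = u x 0 + \int[mu]_(y in `]0, t[) phi y &
   forall t, 0 < t -> t <= T -> c x t =
     (Gamma (1 - alpha))^-1 * \int[mu]_(y in `]0, t[) (phi y * kern alpha (t - y))].
Hypothesis u0C : {within `[0, 1], continuous u0}.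
Hypothesis u0E : forall x, P x -> u x 0 = u0 x.

Let e (s t : R) : R := expR (- (s * t)).

Let e_ge0 s t : 0 <= e s t. Proof. exact: expR_ge0. Qed.

Let e_le1 s t : 0 <= s -> 0 < t -> e s t <= 1.
Proof. by move=> s0 t0; rewrite /e -expR0 ler_expR oppr_le0 mulr_ge0// ltW. Qed.

Let me s : measurable_fun (setT : set RR) (e s).
Proof.
apply: (measurableT_comp (@measurable_expR R)); apply: measurableT_comp => //.
Qed.

Let ce s : continuous (e s).
Proof.
move=> x; apply: (@continuous_comp _ _ _ (fun x => - (s * x)) expR); last exact: continuous_expR.
by apply: cvgN; apply: cvgM; [exact: cvg_cst|exact: cvg_id].
Qed.

Let mcy t : measurable_fun (setT : set RR) (c ^~ t).
Proof.
have mg : measurable_fun (setT : set RR) (fun y : RR => (y, t : RR)).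
  by apply: measurable_fun_pair => //.
exact: (measurableT_comp mc mg).
Qed.

(** The double integral of |c| is at most M T. The weight [m] will be exp(-s t), with or without the
    factor x - y. *)
Let integrable_weighted (m : R -> R -> R) (X : R) : X <= 1 ->
  measurable_fun (setT : set (RR * RR)) (fun z : RR * RR => m z.1 z.2) ->
  (forall t y, 0 < t -> t < T -> 0 < y -> y < 1 -> `|m t y| <= 1) ->
  (mu \x mu)%E.-integrable (`]0, T[ `*` `]0, X[) (fun z => (m z.1 z.2 * c z.2 z.1)%:E).
Proof.
move=> X1 mm m1; have mT := measurable_itvoo 0 T; have mX := measurable_itvoo 0 X.
have m01 := measurable_itvoo (0 : R) 1.
have mF : measurable_fun (setT : set (RR * RR)) (fun z : RR * RR => m z.1 z.2 * c z.2 z.1).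
  apply: measurable_funM; first exact: mm.
  have mg : measurable_fun (setT : set (RR * RR)) (fun z : RR * RR => (z.2, z.1)).
    by apply: measurable_fun_pair; [exact: measurable_snd|exact: measurable_fst].
  exact: (measurableT_comp mc mg).
apply: (integrable_rectP (m1 := mu) (m2 := mu) mT mX (F := fun t y => m t y * c y t)).
  exact: measurable_funTS.
have iM := integrable_itv_cst 0 T M.
apply: (@le_lt_trans _ _ (\int[mu]_(t in `]0%R, T[) M%:E)%E); last first.
  by rewrite -(fineK (integrable_fin_num mT iM)) ltey.
apply: ge0_le_integral_ae.
- by move=> t _; apply: integral_ge0 => y _; exact: abse_ge0.
- by move=> t _; rewrite lee_fin.
apply: (@filterS _ _ (ae_filter_ringOfSetsType mu) _ _ _ cM) => t h tT.
have [cMt _] := h tT; apply: le_trans cMt.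
have sub : `]0, X[ `<=` `]0, 1[ by apply: subset_itvl; rewrite bnd_simp.
have mabs (A : set RR) : measurable_fun A (fun y : RR => `|(c y t)%:E|%E).
  apply: measurable_funTS; apply: measurableT_comp => //; apply/measurable_EFinP; exact: mcy.
apply: (@le_trans _ _ (\int[mu]_(y in `]0%R, X[) `|(c y t)%:E|)%E); last first.
  by apply: ge0_subset_integral => //; exact: mabs.
apply: ge0_le_integral_ae.
- by move=> y _; exact: abse_ge0.
- by move=> y _; exact: abse_ge0.
apply: aeW => y yX; rewrite /= normrM lee_fin ler_piMl//.
have := sub _ yX; move: tT; rewrite /= !in_itv/= => /andP[t0 tT] /andP[y0 y1].
exact: m1.
Qed.

Let W s x := \int[mu]_(t in `]0, T[) (e s t * u x t).
Let chat s y := \int[mu]_(t in `]0, T[) (e s t * c y t).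

Let mfst (g : R -> R) : measurable_fun (setT : set RR) g ->
  measurable_fun (setT : set (RR * RR)) (fun z : RR * RR => g z.1).
Proof. by move=> mg; apply: (measurableT_comp mg); exact: measurable_fst. Qed.

Let chat_integrable s : 0 <= s -> mu.-integrable `]0, 1[ (EFin \o chat s) /\
  {ae mu, forall y, `]0, 1[%classic y -> mu.-integrable `]0, T[ (EFin \o (fun t => e s t * c y t))}.
Proof.
move=> s0; have mT := measurable_itvoo 0 T; have m01 := measurable_itvoo (0 : R) 1.
have h : (mu \x mu)%E.-integrable (`]0, T[ `*` `]0, 1[) (fun z => (e s z.1 * c z.2 z.1)%:E).
  apply: (@integrable_weighted (fun t _ => e s t) 1 (lexx _)); first exact: mfst (me s).
  by move=> t y t0 _ _ _; rewrite ger0_norm// e_le1.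
have [_ h1 _ [_ h2]] := fubini_rect (m1 := mu) (m2 := mu) (F := fun t y => e s t * c y t) mT m01 h.
by split.
Qed.

(** The null set of times in [cM] does not depend on x, so the identity holds at every x of [P] and
    not merely at almost every one; the formula at the end point X relies on this. *)
Let W_repr s x : 0 <= s -> P x -> W s x = \int[mu]_(y in `]0, x[) ((x - y) * chat s y).
Proof.
move=> s0 Px; have := P01 Px; rewrite /= in_itv/= => /andP[x0 x1].
have mT := measurable_itvoo 0 T; have mX := measurable_itvoo 0 x.
have sub : `]0, x[ `<=` `]0, 1[ by apply: subset_itvl; rewrite bnd_simp ltW.
have h : (mu \x mu)%E.-integrable (`]0, T[ `*` `]0, x[) (fun z => (e s z.1 * (x - z.2) * c z.2 z.1)%:E).
  apply: (@integrable_weighted (fun t y => e s t * (x - y)) x (ltW x1)).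
    apply: measurable_funM; first exact: mfst (me s).
    by apply: measurable_funB => //; exact: measurable_snd.
  move=> t y t0 _ y0 y1; rewrite normrM (ger0_norm (e_ge0 _ _)).
  by apply: mulr_ile1 => //; [exact: e_le1|rewrite ler_norml; lra].
have [_ _ E _] := fubini_rect (m1 := mu) (m2 := mu) (F := fun t y => e s t * (x - y) * c y t) mT mX h.
transitivity (\int[mu]_(t in `]0, T[) \int[mu]_(y in `]0, x[) (e s t * (x - y) * c y t)).
  congr fine; apply: integral_ae_eq.
  apply: (@filterS _ _ (ae_filter_ringOfSetsType mu) _ _ _ cM) => t ht tT.
  have [cMt uE] := ht tT; congr EFin; rewrite (uE x Px).
  have ic1 : mu.-integrable `]0, 1[ (EFin \o (c ^~ t)).
    apply/integrableP; split; last by apply: le_lt_trans cMt _; exact: ltry.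
    by apply: measurable_funTS; apply/measurable_EFinP; exact: mcy.
  have icx : mu.-integrable `]0, x[ (EFin \o (c ^~ t)) by exact: integrableS ic1.
  have ixc : mu.-integrable `]0, x[ (EFin \o (fun y => (x - y) * c y t)).
    by apply: integrable_continuousM icx => z; apply: cvgB; [exact: cvg_cst|exact: cvg_id].
  have <- := RintegralZl (e s t) mX ixc.
  by apply: eq_Rintegral => y _; rewrite mulrA.
rewrite E; congr fine; apply: integral_ae_eq.
have [_ aei] := chat_integrable s0.
apply: (@filterS _ _ (ae_filter_ringOfSetsType mu) _ _ _ aei) => y hy yx; congr EFin.
have <- := RintegralZl (x - y) mT (hy (sub _ yx)).
by apply: eq_Rintegral => t _; rewrite mulrA (mulrC (e s t)).
Qed.

Let W_integrable s : 0 <= s -> mu.-integrable `]0, 1[ (EFin \o W s).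
Proof.
move=> s0; have mT := measurable_itvoo 0 T; have m01 := measurable_itvoo (0 : R) 1.
have h : (mu \x mu)%E.-integrable (`]0, 1[ `*` `]0, T[) (fun z => (e s z.2 * u z.1 z.2)%:E).
  apply: (integrable_rectP (m1 := mu) (m2 := mu) m01 mT (F := fun x t => e s t * u x t)).
    apply: measurable_funTS; apply: measurable_funM; last exact: mu_.
    by apply: (measurableT_comp (me s)); exact: measurable_snd.
  have iM := integrable_itv_cst 0 T M.
  set K := (\int[mu]_(t in `]0%R, T[) M%:E)%E.
  have iK := integrable_itv_cst 0 1 (fine K).
  apply: (@le_lt_trans _ _ (\int[mu]_(x in `]0%R, 1%R[) (fine K)%:E)%E); last first.
    by rewrite -(fineK (integrable_fin_num m01 iK)) ltey.
  apply: ge0_le_integral_ae.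
  - by move=> t _; apply: integral_ge0 => y _; exact: abse_ge0.
  - by move=> t _; rewrite lee_fin fine_ge0// integral_ge0// => *; rewrite lee_fin.
  apply: (@filterS _ _ (ae_filter_ringOfSetsType mu) _ _ _ aeP) => x hx x01.
  rewrite (fineK (integrable_fin_num mT iM)); apply: ge0_le_integral_ae.
  - by move=> y _; exact: abse_ge0.
  - by move=> y _; rewrite lee_fin.
  apply: aeW => t; rewrite /= in_itv/= => /andP[t0 tT]; rewrite lee_fin normrM.
  rewrite (ger0_norm (e_ge0 _ _)) -[leRHS]mul1r; apply: ler_pM => //; first exact: e_le1.
  by apply: uM; [exact: hx|exact: ltW|exact: ltW].
have [h1 _ _ _] := fubini_rect (m1 := mu) (m2 := mu) (F := fun x t => e s t * u x t) m01 mT h.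
exact: h1.
Qed.

Let powR_pred s : 0 < s -> s `^ alpha = s `^ (alpha - 1) * s.
Proof. by move=> s0; rewrite -[X in _ * X]powRr1 ?ltW// -powRD ?subrK// gt_eqF// implybT. Qed.

(** The boundary term s^(alpha-1) exp(-s T) u(y, T) is absorbed here. It adds M to the 2 M of
    [caputo_laplace], hence the 3 M in [K]. *)
Let remainder s y := chat s y - s `^ alpha * W s y + s `^ (alpha - 1) * u0 y.
Let K s := 3 * M * (s `^ (alpha - 1) * e s T).

Let remainder_le s : 0 < s -> {ae mu, forall y, `]0, 1[%classic y -> `|remainder s y| <= K s}.
Proof.
move=> s0; have mT := measurable_itvoo 0 T.
(* At s = 0 the weight is 1, so this is the integrability of c(y, .) for almost every y. *)
have [_ ae0] := chat_integrable (lexx (0 : R)).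
apply: (@filterS2 _ _ (ae_filter_ringOfSetsType mu) _ _ _ _ aeP ae0) => y hP h0 y01.
have Py := hP y01; have [phi [iphi wE cE]] := u_phi Py.
have ic : mu.-integrable `]0, T[ (EFin \o c y).
  have := h0 y01; apply: (eq_integrable mT) => t _.
  by rewrite /e /comp mul0r oppr0 expR0 mul1r.
have cE' : {ae mu, forall t, `]0, T[%classic t ->
    c y t = (Gamma (1 - alpha))^-1 * \int[mu]_(x in `]0, t[) (phi x * kern alpha (t - x))}.
  by apply: aeW => t; rewrite /= in_itv/= => /andP[t0 tT]; apply: cE => //; exact: ltW.
have main := caputo_laplace alpha_gt0 alpha_lt1 T_gt0 iphi wE (uC Py) (fun t => @uM y t Py) s0 ic cE'.
have bT : `|s `^ (alpha - 1) * (e s T * u y T)| <= M * (s `^ (alpha - 1) * e s T).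
  rewrite mulrA normrM ger0_norm ?mulr_ge0 ?powR_ge0// mulrC ler_wpM2r ?mulr_ge0 ?powR_ge0//.
  by apply: uM => //; exact: ltW.
have -> : remainder s y = (chat s y - s `^ (alpha - 1) * (s * W s y - u y 0 + e s T * u y T)) +
    s `^ (alpha - 1) * (e s T * u y T).
  rewrite /remainder (powR_pred s0) (u0E Py).
  by move: (chat s y) (W s y) (u y T) (e s T) (s `^ (alpha - 1)) (u0 y) => a b d p q r; ring.
apply: le_trans (ler_normD _ _) _; apply: le_trans (lerD main bT) _.
rewrite /K -/(e s T) le_eqVlt; apply/orP; left; apply/eqP.
by move: (e s T) => z; ring.
Qed.

Let sub01 X : X <= 1 -> `]0, X[ `<=` (`]0, 1[%classic : set R).
Proof. by move=> X1; apply: subset_itvl; rewrite bnd_simp. Qed.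

Let iu0 X : X <= 1 -> mu.-integrable `]0, X[ (EFin \o u0).
Proof.
move=> X1; apply: integrable_within_continuous; apply: continuous_subspaceW u0C.
by apply: subset_itvl; rewrite bnd_simp.
Qed.

Let mhalf s := s `^ (alpha / 2).

Let mhalf_sqr s : 0 < s -> mhalf s ^+ 2 = s `^ alpha.
Proof.
by move=> s0; rewrite expr2 /mhalf -powRD -?splitr// gt_eqF// implybT.
Qed.

(** With m^2 = s^alpha the source term c^ - m^2 W of the variation of constants is the remainder
    minus the initial value. The factor exp(m) bounds sinh(m (X - y)), since X - y < 1. *)
Let pairing_le s X : 0 < s -> P X ->
  `|mhalf s * W s X + s `^ (alpha - 1) * \int[mu]_(y in `]0, X[) (sinhR (mhalf s * (X - y)) * u0 y)|
  <= expR (mhalf s) * K s.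
Proof.
move=> s0 PX; have := P01 PX; rewrite /= in_itv/= => /andP[X0 X1].
have mX := measurable_itvoo 0 X.
have m_gt0 : 0 < mhalf s by exact: powR_gt0.
have [ic1 _] := chat_integrable (ltW s0).
have icX : mu.-integrable `]0, X[ (EFin \o chat s) by exact: (integrableS (measurable_itvoo 0 1) mX (sub01 (ltW X1)) ic1).
have iWX : mu.-integrable `]0, X[ (EFin \o W s) by exact: (integrableS (measurable_itvoo 0 1) mX (sub01 (ltW X1)) (W_integrable (ltW s0))).
have cS : continuous (fun y : R => sinhR (mhalf s * (X - y))) by exact: continuous_sinh_affine.
have Wae : {ae mu, forall x, `]0, X[%classic x -> W s x = \int[mu]_(y in `]0, x[) ((x - y) * chat s y)}.
  apply: (@filterS _ _ (ae_filter_ringOfSetsType mu) _ _ _ aeP) => x hx xX.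
  by apply: W_repr; [exact: ltW|apply/hx/(sub01 (ltW X1))].
have -> := sinh_pairing (lt0r_neq0 m_gt0) X0 icX iWX Wae (W_repr (ltW s0) PX).
rewrite mhalf_sqr//.
pose S y := sinhR (mhalf s * (X - y)).
have i1 : mu.-integrable `]0, X[ (EFin \o (fun y => chat s y - s `^ alpha * W s y)).
  exact: (integrableB mX icX (integrableZl mX (s `^ alpha) iWX)).
have i2 : mu.-integrable `]0, X[ (EFin \o (fun y => s `^ (alpha - 1) * u0 y)).
  exact: (integrableZl mX (s `^ (alpha - 1)) (iu0 (ltW X1))).
have i3 : mu.-integrable `]0, X[ (EFin \o (fun y => remainder s y)).
  exact: (integrableD mX i1 i2).
have iS1 : mu.-integrable `]0, X[ (EFin \o (fun y => S y * (chat s y - s `^ alpha * W s y))).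
  exact: integrable_continuousM cS i1.
have iS2 : mu.-integrable `]0, X[ (EFin \o (fun y => S y * u0 y)).
  exact: integrable_continuousM cS (iu0 (ltW X1)).
have iS3 : mu.-integrable `]0, X[ (EFin \o (fun y => S y * remainder s y)).
  exact: integrable_continuousM cS i3.
have <- := RintegralZl (s `^ (alpha - 1)) mX iS2.
have <- := RintegralD mX iS1 (integrableZl mX (s `^ (alpha - 1)) iS2).
have -> : \int[mu]_(y in `]0, X[) (S y * (chat s y - s `^ alpha * W s y) + s `^ (alpha - 1) * (S y * u0 y)) =
    \int[mu]_(y in `]0, X[) (S y * remainder s y).
  apply: eq_Rintegral => y _; rewrite /remainder.
  by move: (S y) (chat s y) (W s y) (u0 y) (s `^ _) (s `^ _) => a b d p q r; ring.
have K0 : 0 <= expR (mhalf s) * K s.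
  by rewrite mulr_ge0 ?expR_ge0// /K mulr_ge0 ?mulr_ge0 ?powR_ge0.
apply: (@le_trans _ _ (expR (mhalf s) * K s * X)); last by rewrite ler_piMr// ltW.
apply: Rintegral_le_cst => //.
apply: (@filterS _ _ (ae_filter_ringOfSetsType mu) _ _ _ (remainder_le s0)) => y hy yX.
rewrite normrM; have := hy (sub01 (ltW X1) yX).
move: yX; rewrite /= in_itv/= => /andP[y0 yX].
have q0 : 0 <= mhalf s * (X - y) by rewrite mulr_ge0 ?subr_ge0// ltW.
have /andP[S0 S1] := sinhR_bound q0.
apply: ler_pM => //; rewrite ger0_norm//; apply: le_trans S1 _; rewrite ler_expR.
by rewrite ler_piMr ?(ltW m_gt0)//; lra.
Qed.

Let W_le s X : 0 < s -> P X -> `|W s X| <= M / s.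
Proof.
move=> s0 PX; have mT := measurable_itvoo 0 T.
have iu : mu.-integrable `]0, T[ (EFin \o u X) by exact: integrable_within_continuous (uC PX).
have ieu : mu.-integrable `]0, T[ (EFin \o (fun t => e s t * u X t)).
  exact: integrable_continuousM (@ce s) iu.
have ie : mu.-integrable `]0, T[ (EFin \o e s).
  by apply: integrable_within_continuous; apply: continuous_subspaceT; exact: ce.
apply: le_trans (le_normr_Rintegral mT ieu) _.
apply: (@le_trans _ _ (\int[mu]_(t in `]0, T[) (M * e s t))).
  apply: le_Rintegral; [exact: mT|exact: integrable_norm ieu|exact: (integrableZl mT M ie)|].
  move=> t; rewrite /= in_itv/= => /andP[t0 tT]; rewrite normrM (ger0_norm (e_ge0 _ _)) mulrC.
  by apply: ler_wpM2r => //; apply: uM => //; exact: ltW.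
have -> := RintegralZl M mT ie; apply: ler_wpM2l => //.
have de x : is_derive x (1 : R) (fun t => - (s^-1 * e s t)) (e s x).
  have h1 : is_derive x (1 : R) (fun x => - (s * x)) (- s).
    by apply: is_derive_eq; rewrite /GRing.scale/=; ring.
  have h2 := @is_derive1_comp R expR (fun x => - (s * x)) x _ _ (is_derive_expR _) h1.
  have h3 : is_derive x (1 : R) (fun t => - s^-1 *: e s t) (- s^-1 *: (expR (- (s * x)) * - s)).
    exact: is_deriveZ.
  rewrite (_ : (fun t => - (s^-1 * e s t)) = (fun t => - s^-1 *: e s t)); last first.
    by apply/funext => t; rewrite /GRing.scale/= mulNr.
  apply: is_derive_eq h3 _; rewrite /GRing.scale/= /e mulrN mulrNN mulrCA mulVf ?mulr1//.
  exact: lt0r_neq0.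
have -> := @Rintegral_FTC R (e s) (fun t => - (s^-1 * e s t)) 0 T T_gt0 (continuous_subspaceT (@ce s)) (fun x _ _ => de x).
have -> : e s 0 = 1 by rewrite /e mulr0 oppr0 expR0.
by rewrite mulr1 opprK gerDr oppr_le0 mulr_ge0 ?invr_ge0// ltW.
Qed.

(** Dividing [pairing_le] by s^(alpha-1) leaves the sinh moment of [u0]; both error terms stay
    bounded in n after the division. *)
Let initial_value_le X (n : nat) : P X -> (0 < n)%N ->
  `|\int[mu]_(y in `]0, X[) (expR (n%:R * (X - y)) * u0 y)| <= 3 * M + 6 * M * expR T^-1.
Proof.
move=> PX n_gt0; have := P01 PX; rewrite /= in_itv/= => /andP[X0 X1].
have mX := measurable_itvoo 0 X; have iu := iu0 (ltW X1).
have n1 : 1 <= n%:R :> R by rewrite ler1n.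
have n0 : 0 < n%:R :> R by rewrite ltr0n.
(* This makes m = n and s^(alpha-1) s = n^2, and s >= n^2 because alpha < 1. *)
pose s : R := n%:R `^ (2 / alpha).
have s0 : 0 < s by exact: powR_gt0.
have mE : mhalf s = n%:R.
  rewrite /mhalf /s -powRrM (_ : 2 / alpha * (alpha / 2) = 1) ?powRr1 ?ltW//.
  by field; exact: lt0r_neq0.
have sE : s `^ (alpha - 1) * s = n%:R ^+ 2 by rewrite -powR_pred// -mhalf_sqr// mE.
have sn : n%:R ^+ 2 <= s.
  rewrite -(powR_mulrn 2 (ltW n0)) /s; apply: ler_powR => //.
  by rewrite ler_pdivlMr// ler_piMr// ltW.
have := pairing_le s0 PX; rewrite mE.
set I := \int[mu]_(y in _) _ => pl.
have p0 : 0 < s `^ (alpha - 1) by exact: powR_gt0.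
have Ile : `|I| <= M + 3 * M * expR T^-1.
  have h1 : s `^ (alpha - 1) * `|I| <= n%:R * (M / s) + expR n%:R * K s.
    rewrite -[X in X * _](gtr0_norm p0) -normrM.
    rewrite (_ : s `^ (alpha - 1) * I = (n%:R * W s X + s `^ (alpha - 1) * I) - n%:R * W s X); last by rewrite addrAC subrr add0r.
    apply: le_trans (ler_normB _ _) _; rewrite addrC; apply: lerD pl.
    by rewrite normrM gtr0_norm// ler_pM2l//; exact: W_le.
  have h2 : n%:R * (M / s) <= s `^ (alpha - 1) * M.
    rewrite mulrA ler_pdivrMr// mulrAC sE; apply: ler_wpM2r => //.
    by rewrite expr2 ler_peMr// ltW.
  have h3 : expR n%:R * K s <= s `^ (alpha - 1) * (3 * M * expR T^-1).
    have T0 := T_gt0.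
    (* n - s T <= n - n^2 T <= 1/(4 T) by completing the square; 1/T is ample. *)
    have h : expR n%:R * e s T <= expR T^-1.
      rewrite /e -expRD ler_expR -(ler_pM2r T0) mulVf ?lt0r_neq0//.
      have := ler_wpM2r (sqr_ge0 T) sn; have := sqr_ge0 (n%:R * T - 2^-1).
      by rewrite !expr2 => q1 q2; lra.
    rewrite /K (_ : expR n%:R * _ = s `^ (alpha - 1) * (3 * M * (expR n%:R * e s T))); last first.
      by move: (e s T) => z; ring.
    by rewrite ler_pM2l// ler_wpM2l// mulr_ge0.
  rewrite -(ler_pM2l p0) mulrDr; apply: le_trans h1 _; exact: lerD.
have iE (g : R -> R) : continuous g -> mu.-integrable `]0, X[ (EFin \o (fun y => g y * u0 y)).
  by move=> cg; exact: integrable_continuousM cg iu.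
have cm : continuous (fun y : R => expR (- (n%:R * (X - y)))).
  move=> x; apply: (@continuous_comp _ _ _ (fun x => - (n%:R * (X - x))) expR); last exact: continuous_expR.
  by apply: cvgN; apply: cvgM; [exact: cvg_cst|apply: cvgB; [exact: cvg_cst|exact: cvg_id]].
have i1 := iE _ (@continuous_sinh_affine R n%:R X).
have i2 := iE _ cm.
(* exp = 2 sinh + exp(-.), and the decaying part contributes at most M. *)
have -> : \int[mu]_(y in `]0, X[) (expR (n%:R * (X - y)) * u0 y) =
    2 * I + \int[mu]_(y in `]0, X[) (expR (- (n%:R * (X - y))) * u0 y).
  have <- := RintegralZl 2 mX i1.
  have <- := RintegralD mX (integrableZl mX 2 i1) i2.
  by apply: eq_Rintegral => y _; rewrite /sinhR; field.
have J : `|\int[mu]_(y in `]0, X[) (expR (- (n%:R * (X - y))) * u0 y)| <= M.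
  apply: (@le_trans _ _ (M * X)); last by rewrite ler_piMr// ltW.
  apply: Rintegral_le_cst => //.
  apply: (@filterS _ _ (ae_filter_ringOfSetsType mu) _ _ _ aeP) => y hy yX.
  have Py := hy (sub01 (ltW X1) yX); rewrite -(u0E Py) normrM -[leRHS]mul1r.
  apply: ler_pM => //; last by apply: uM => //; exact: ltW.
  move: yX; rewrite /= in_itv/= => /andP[y0 yX].
  by rewrite ger0_norm ?expR_ge0// -expR0 ler_expR oppr_le0 mulr_ge0 ?subr_ge0// ltW.
apply: le_trans (ler_normD _ _) _; rewrite normrM (ger0_norm (_ : 0 <= 2 :> R))//.
apply: le_trans (lerD (ler_wpM2l _ Ile) J) _ => //.
by rewrite le_eqVlt; apply/orP; left; apply/eqP; ring.
Qed.

Let initial_value0 X y : P X -> 0 < y -> y < X -> u0 y = 0.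
Proof.
move=> PX; have := P01 PX; rewrite /= in_itv/= => /andP[X0 X1].
apply: (mikusinski_reflected X0).
  by apply: continuous_subspaceW u0C; apply: subset_itvl; rewrite bnd_simp ltW.
move=> ep ep0; exists (3 * M + 6 * M * expR T^-1), 1%N => n n1.
apply: le_trans (initial_value_le PX n1) _.
rewrite ler_peMr ?addr_ge0 ?mulr_ge0 ?expR_ge0// -expR0 ler_expR.
by rewrite mulr_ge0// ltW.
Qed.

(** With the initial value gone, s = n gives exp(n T) |W(X)| <= 3 M exp(n^(alpha/2)), whose exponent
    is at most sqrt n. *)
Lemma lateral_cauchy_zero X t : P X -> 0 < t -> t < T -> u X t = 0.
Proof.
move=> PX; have := P01 PX; rewrite /= in_itv/= => /andP[X0 X1].
have mT := measurable_itvoo 0 T.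
apply: (mikusinski_reflected T_gt0 (uC PX)) => ep ep0.
(* From n > ep^(-2) on, sqrt n <= ep n; the successor also ensures n >= 1. *)
exists (3 * M), (Num.bound (ep ^- 2)).+1 => n n1.
have n_gt0 : (0 < n)%N by exact: leq_trans n1.
have nR1 : 1 <= n%:R :> R by rewrite ler1n.
have n0 : 0 < n%:R :> R by rewrite ltr0n.
have Wle : `|W n%:R X| <= 3 * M * (e n%:R T * expR (mhalf n%:R)).
  have := pairing_le n0 PX.
  have -> : \int[mu]_(y in `]0, X[) (sinhR (mhalf n%:R * (X - y)) * u0 y) = 0.
    transitivity (\int[mu]_(y in `]0, X[) (cst 0 y)); last by rewrite Rintegral_cst ?mul0r//; exact: measurable_itvoo.
    apply: eq_Rintegral => y; rewrite inE/= in_itv/= => /andP[y0 yX].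
    by rewrite (initial_value0 PX y0 yX) mulr0.
  rewrite mulr0 addr0 normrM => h.
  have m1 : 1 <= mhalf n%:R.
    rewrite -[leLHS](powRr0 n%:R); apply: ler_powR => //.
    by rewrite divr_ge0// ltW.
  have p1 : n%:R `^ (alpha - 1) <= 1 :> R.
    by rewrite -[leRHS](powRr0 n%:R); apply: ler_powR => //; rewrite subr_le0 ltW.
  apply: (@le_trans _ _ (`|mhalf n%:R| * `|W n%:R X|)).
    by rewrite ler_peMl// ger0_norm// (le_trans _ m1).
  apply: le_trans h _; rewrite /K mulrCA; apply: ler_wpM2l; first by rewrite mulr_ge0.
  rewrite mulrC -mulrA; apply: le_trans (_ : 1 * (e n%:R T * expR (mhalf n%:R)) <= _); last by rewrite mul1r.
  by apply: ler_wpM2r => //; rewrite mulr_ge0 ?expR_ge0.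
have -> : \int[mu]_(t in `]0, T[) (expR (n%:R * (T - t)) * u X t) = expR (n%:R * T) * W n%:R X.
  have iu : mu.-integrable `]0, T[ (EFin \o u X) by exact: integrable_within_continuous (uC PX).
  have <- := RintegralZl (expR (n%:R * T)) mT (integrable_continuousM (@ce n%:R) iu).
  apply: eq_Rintegral => t' _; rewrite mulrA /e -expRD; congr (expR _ * _); ring.
rewrite normrM ger0_norm ?expR_ge0//.
apply: le_trans (ler_wpM2l (expR_ge0 _) Wle) _.
rewrite mulrCA; apply: ler_wpM2l; first by rewrite mulr_ge0.
rewrite mulrA /e -expRD subrr expR0 mul1r ler_expR.
apply: (@le_trans _ _ (Num.sqrt n%:R)).
  rewrite -(powR12_sqrt (ltW n0)) /mhalf; apply: ler_powR => //.
  by rewrite ler_pdivrMr// mulVf// ltW.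
rewrite -(ler_pXn2r (_ : (0 < 2)%N)) ?nnegrE ?sqrtr_ge0 ?mulr_ge0 ?ltW//.
rewrite sqr_sqrtr ?ltW// exprMn.
have h : ep ^- 2 < n%:R.
  apply: (@lt_le_trans _ _ (Num.bound (ep ^- 2))%:R); last by rewrite ler_nat ltnW.
  by apply: archi_boundP; rewrite invr_ge0 exprn_ge0// ltW.
have : 1 < ep ^+ 2 * n%:R.
  by rewrite mulrC -ltr_pdivrMr ?exprn_gt0// mul1r.
by move=> h'; rewrite [X in _ < _ * X]expr2 mulrA ltr_pMl.
Qed.

End lateral_cauchy.

(** * From almost everywhere to everywhere *)

Section ae_continuous.
Context {R : realType}.
Local Notation mu := (@lebesgue_measure R).
Local Notation RR := (measurableTypeR R).

(** A violation at t persists on a nondegenerate interval next to t, which no null set contains. The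
    end points are included, so the closed interval is recovered from the open one. *)
Lemma ae_le_continuous_itv (a b K : R) (g : R -> R) : a < b -> {within `[a, b], continuous g} ->
  {ae mu, forall t, `]a, b[%classic t -> g t <= K} ->
  forall t, a <= t -> t <= b -> g t <= K.
Proof.
move=> ab cg [N [mN N0 gN]] t at_ tb; rewrite leNgt; apply/negP => Kg.
have tI : `[a, b]%classic t by rewrite /= in_itv/= at_.
have /subspace_continuousP/(_ t tI) ct := cg.
have {ct}: \forall s \near t, `[a, b]%classic s -> K < g s by exact: (cvgr_gt _ ct).
move=> /nbhs_ballP[d /= d0 hd].
pose l := Num.max a (t - d); pose r := Num.min b (t + d).
have lr : l < r by rewrite /l /r gt_max !lt_min ab /=; apply/andP; split; [lra|apply/andP; split; lra].
have sub : `]l, r[%classic `<=` N.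
  move=> s; rewrite /= in_itv/= /l /r gt_max lt_min => /andP[/andP[as_ ds] /andP[sb sd]].
  apply: gN => /= h; have := h _; rewrite in_itv/= as_ sb => /(_ isT).
  rewrite leNgt => /negP; apply; apply: hd; last by rewrite /= in_itv/= !ltW.
  by rewrite /ball/= ltr_norml; apply/andP; split; lra.
have : (mu `]l, r[%classic <= mu N)%E by apply: le_measure => //; rewrite inE//; exact: measurable_itvoo.
rewrite N0 lebesgue_measure_itv/= lte_fin lr -EFinB lee_fin; lra.
Qed.

Lemma double_primitive_le (v : R -> R) (M y : R) : mu.-integrable `]0, 1[ (EFin \o v) ->
  (\int[mu]_(z in `]0%R, 1%R[) `|(v z)%:E| <= M%:E)%E -> 0 < y -> y < 1 ->
  `|\int[mu]_(z in `]0, y[) ((y - z) * v z)| <= M.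
Proof.
move=> iv vM y0 y1; have my := measurable_itvoo 0 y; have m01 := measurable_itvoo (0 : R) 1.
have sub : `]0, y[ `<=` `]0, 1[ by apply: subset_itvl; rewrite bnd_simp ltW.
have ivy : mu.-integrable `]0, y[ (EFin \o v) by exact: integrableS iv.
have iyv : mu.-integrable `]0, y[ (EFin \o (fun z => (y - z) * v z)).
  by apply: integrable_continuousM ivy => z; apply: cvgB; [exact: cvg_cst|exact: cvg_id].
apply: le_trans (le_normr_Rintegral my iyv) _; rewrite -lee_fin; apply: le_trans vM.
rewrite /Rintegral (fineK (integrable_fin_num my (integrable_norm iyv))).
apply: (@le_trans _ _ (\int[mu]_(z in `]0%R, y[) `|(v z)%:E|)%E); last first.
  apply: ge0_subset_integral => //; apply: measurableT_comp => //; exact: measurable_int iv.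
apply: ge0_le_integral_ae.
- by move=> z _; rewrite lee_fin normr_ge0.
- by move=> z _; exact: abse_ge0.
apply: aeW => z; rewrite /= in_itv/= => /andP[z0 zy]; rewrite lee_fin normrM ler_piMl//.
by rewrite ger0_norm; lra.
Qed.

End ae_continuous.

Theorem lemma2p4 (R : realType) (alpha T : R) (u : R -> R -> R)
  (alpha_gt0 : 0 < alpha) (alpha_lt1 : alpha < 1) (T_gt0 : 0 < T)
  (* each u(., t) is in H^2(0,1), given by its representative in C^1[0,1] *)
  (u_H2 : forall t, t \in `[0, T] ->
     H2 `]0, 1[ (u^~ t) /\ {within `[0, 1], continuous (u^~ t)})
  (u_Linfty : Linfty T (H2 `]0, 1[) (H2norm `]0, 1[) (fun t => u^~ t))
  (u_ac : {ae (@lebesgue_measure R), forall x, `]0, 1[%classic x ->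
     abs_continuous 0 T (u x)})
  (dtu_Linfty : Linfty T (L2 `]0, 1[) (L2norm `]0, 1[)
     (fun t x => caputo alpha (u x) t))
  (u_eq : {ae (@lebesgue_measure R), forall t, `]0, T]%classic t ->
     {ae (@lebesgue_measure R), forall x, `]0, 1[%classic x ->
        caputo alpha (u x) t
        - weak_derivative `]0, 1[ (weak_derivative `]0, 1[ (u^~ t)) x = 0}})
  (u_0 : forall t, t \in `[0, T] -> u 0 t = 0)
  (ux_0 : forall t, t \in `[0, T] ->
     h^-1 * (u h t - u 0 t) @[h --> 0^'+] --> 0)
  (x t : R) (hx : x \in `[0, 1]) (ht : t \in `[0, T]) :
  u x t = 0.
Proof.
pose mu := @lebesgue_measure R; pose RR := measurableTypeR R.
have [N [mN N0 acN]] := u_ac.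
have m01 := measurable_itvoo (0 : R) 1; have mT := measurable_itvoo 0 T.
(* Removing a measurable null set that covers the exceptional points makes [P] measurable. *)
pose P : set R := `]0, 1[%classic `\` N.
have mP : measurable (P : set RR) by exact: measurableD.
have P01 : P `<=` `]0, 1[ by move=> y [].
have acP y : P y -> abs_continuous 0 T (u y).
  by move=> [y01 Ny]; apply: contrapT => nac; apply: Ny; apply: acN => /= /(_ y01).
have aeP : {ae mu, forall y, `]0, 1[%classic y -> P y}.
  by exists N; split => // y; apply: contra_notP => Ny y01; split.
(* Zero off [P] and constant in time outside [0, T]: now every f(y, .) is continuous and every f(.,
   s) measurable, which gives joint measurability. *)
pose f (y s : R) : R := ((u ^~ (clamp T s)) \_ P) y.
have fP y : P y -> f y = u y \o clamp T by move=> Py; apply/funext => s; rewrite /f patchE mem_set.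
have fNP y : ~ P y -> f y = cst 0 by move=> Py; apply/funext => s; rewrite /f patchE memNset.
have clT s : clamp T s \in `[0, T] by rewrite in_itv/= clamp_itv.
have cf y : continuous (f y).
  have [Py|Py] := pselect (P y); first by rewrite fP//; exact: abs_continuous_clamp (acP _ Py).
  by rewrite fNP//; move=> s; exact: cvg_cst.
have mf : measurable_fun (setT : set (RR * RR)) (fun z : RR * RR => f z.1 z.2).
  apply: measurable_caratheodory => // s; apply/(measurable_restrictT _ mP).
  have [_ cu] := u_H2 _ (clT s).
  have mI : measurable (`[0, 1]%classic : set RR) by exact: measurable_itv.
  apply: (measurable_funS mI); first by move=> y /P01; apply: subset_itv_oo_cc.
  exact: subspace_continuous_measurable_fun.
(* A jointly measurable function that agrees with the Caputo derivative for y in [P] and 0 < s <=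
   T. *)
pose c (y s : R) : R := (Gamma (1 - alpha))^-1 *
  \int[mu]_(r in `]0, T[) (upper_derivative (f y) r * kern alpha (s - r)).
have mc : measurable_fun (setT : set (RR * RR)) (fun z : RR * RR => c z.1 z.2).
  apply: measurable_funM; first exact: measurable_cst.
  have md := measurable_upper_derivative mf.
  have h := @measurable_convolution R `]0, T[ (fun y => upper_derivative (f y)) (kern alpha) mT md (measurable_kern alpha).
  exact: h.
have cE y s : P y -> 0 < s -> s <= T -> c y s = caputo alpha (u y) s.
  move=> Py s0 sT; have [phi [_ _ _ h]] := caputo_abs_continuous T_gt0 alpha (acP _ Py).
  by rewrite (h s s0 sT) /c (fP _ Py).
have [_ _ [M0 H2M]] := u_Linfty.
pose M := 1 + M0 ^+ 2.
have M_ge0 : 0 <= M by rewrite addr_ge0// sqr_ge0.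
(* For almost every time, c(., s) = u_xx(., s) almost everywhere. Both the L^1 bound and the
   representation of [u] pass from u_xx to [c], since they see only integrals. *)
have slice : {ae mu, forall s, `]0, T[%classic s ->
    (\int[mu]_(y in `]0%R, 1%R[) `|(c y s)%:E| <= M%:E)%E /\
    forall y, `]0, 1[%classic y -> `|u y s| <= M /\ u y s = \int[mu]_(z in `]0, y[) ((y - z) * c z s)}.
  apply: (@filterS2 _ _ (ae_filter_ringOfSetsType mu) _ _ _ _ u_eq H2M) => s eqs Ms sT.
  have /andP[s0 sT'] : 0 < s < T by move: sT; rewrite /= in_itv.
  have sI : s \in `[0, T] by rewrite in_itv/= !ltW.
  have [uH2 cu] := u_H2 _ sI.
  pose v := weak_derivative `]0, 1[ (weak_derivative `]0, 1[ (u^~ s)).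
  have [mv vpsi] := H2_weak_second_derivative uH2.
  have vM := L1_le_L2norm mv (le_trans (L2norm_le_H2norm _) (Ms sT)).
  have cv : {ae mu, forall y, `]0, 1[%classic y -> c y s = v y}.
    have eqs' : {ae mu, forall y, `]0, 1[%classic y -> caputo alpha (u y) s - v y = 0}.
      by apply: eqs; rewrite /= in_itv/= s0 ltW.
    apply: (@filterS2 _ _ (ae_filter_ringOfSetsType mu) _ _ _ _ aeP eqs') => y hP he y01.
    by rewrite cE ?ltW//; [apply/eqP; rewrite -subr_eq0 he|exact: hP].
  have iv : mu.-integrable `]0, 1[ (EFin \o v).
    apply/integrableP; split; first exact/measurable_EFinP.
    by apply: le_lt_trans vM _; exact: ltry.
  split.
    rewrite (@integral_ae_eq _ _ _ mu _ _ (fun y => `|(v y)%:E|)%E)//.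
    by apply: (@filterS _ _ (ae_filter_ringOfSetsType mu) _ _ _ cv) => y h y01; rewrite h.
  move=> y y01; have /andP[y0 y1] : 0 < y < 1 by move: y01; rewrite /= in_itv.
  rewrite (weak_second_derivative_repr cu iv vpsi (u_0 _ sI) (ux_0 _ sI) y01).
  split; first exact: double_primitive_le iv vM y0 y1.
  congr fine; apply: integral_ae_eq.
  apply: (@filterS _ _ (ae_filter_ringOfSetsType mu) _ _ _ cv) => z h zy.
  rewrite h//; move: zy; rewrite /= !in_itv/= => /andP[-> zy].
  exact: lt_trans y1.
(* For y in [P], continuity in time extends the bound from almost every time to all of [0, T]. *)
have uM y s : P y -> 0 <= s -> s <= T -> `|f y s| <= M.
  move=> Py; apply: (@ae_le_continuous_itv R 0 T M (fun s => `|f y s|)) => //.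
    by apply: continuous_subspaceT => r; apply: cvg_norm; exact: cf.
  apply: (@filterS _ _ (ae_filter_ringOfSetsType mu) _ _ _ slice) => r hr rT.
  have [_ h] := hr rT; have [ur _] := h _ (P01 _ Py).
  move: rT; rewrite /= in_itv/= => /andP[r0 rT].
  by rewrite fP//= clampE// ltW.
have fE y s : P y -> 0 <= s -> s <= T -> f y s = u y s.
  by move=> Py s0 sT; rewrite fP//= clampE.
have f0 y s : P y -> 0 < s -> s < T -> f y s = 0.
  apply: (lateral_cauchy_zero alpha_gt0 alpha_lt1 T_gt0 M_ge0 aeP P01 mf mc _ uM _ _ _ _ (u0 := u^~ 0)).
  - apply: (@filterS _ _ (ae_filter_ringOfSetsType mu) _ _ _ slice) => r hr rT.
    have [h1 h2] := hr rT; split => // z Pz; have [_ <-] := h2 _ (P01 _ Pz).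
    move: rT; rewrite /= in_itv/= => /andP[r0 rT].
    by apply: fE => //; exact: ltW.
  - by move=> z Pz; apply: continuous_subspaceT; exact: cf.
  - move=> z Pz; have [phi [iphi uE cphi _]] := caputo_abs_continuous T_gt0 alpha (acP _ Pz).
    exists phi; split => // r r0 rT.
      by rewrite !fE// ?ltW//; exact: uE.
    by rewrite cE//; exact: cphi.
  - by have [] := u_H2 0 (_ : 0 \in `[0, T]); rewrite ?in_itv/= ?lexx ?ltW.
  - by move=> z Pz; rewrite fE// ltW.
(* The end points t = 0 and t = T follow from the continuity of u(y, .). *)
have uP0 y s : P y -> 0 <= s -> s <= T -> `|u y s| <= 0.
  move=> Py; apply: (@ae_le_continuous_itv R 0 T 0 (fun s => `|u y s|)) => //.
    by move=> r; apply: cvg_norm; exact: (abs_continuous_within T_gt0 (acP _ Py)).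
  apply: aeW => r; rewrite /= in_itv/= => /andP[r0 rT].
  by rewrite -(fE y r Py (ltW r0) (ltW rT)) (f0 _ _ Py r0 rT) normr0.
have tT : 0 <= t <= T by move: ht; rewrite in_itv.
move: hx; rewrite in_itv/= => /andP[x0 x1]; apply/eqP; rewrite -normr_le0.
have [_ cu] := u_H2 _ ht.
(* At fixed t, continuity in x reaches the points outside [P], in particular x = 0 and x = 1. *)
apply: (@ae_le_continuous_itv R 0 1 0 (fun y => `|u y t|)) => //.
  by move=> r; apply: cvg_norm; exact: cu.
apply: (@filterS _ _ (ae_filter_ringOfSetsType mu) _ _ _ aeP) => y hP y01.
by move: tT => /andP[t0 tT]; apply: uP0 => //; exact: hP.
Qed.
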